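(* Let $k>0$ and let $A:\mathcal{D}(A)\subset L^2((-1,1);(1-x^2)^{-1})\to L^2((-1,1);(1-x^2)^{-1})$ be the Jacobi self-adjoint operator $Af=\ell[f]$, $\mathcal{D}(A)=\Delta$, having the Jacobi polynomials $\{P_m^{(-1,-1)}\}_{m=2}^\infty$ as eigenfunctions. For each $n\in\mathbb{N}$ let $$V_n=\{f:(-1,1)\to\mathbb{C}\mid f\in AC^{(n-1)}_{\mathrm{loc}}(-1,1);\ f^{(j)}\in L^2((-1,1);(1-x^2)^{j-1}),\ j=0,1,\dots,n\},$$ $$(f,g)_n=\sum_{j=0}^n c_j(n,k)\int_{-1}^1 f^{(j)}(x)\overline{g}^{(j)}(x)(1-x^2)^{j-1}dx,$$ and $H_n=(V_n,(\cdot,\cdot)_n)$. Then $H_n$ is the $n$-th left-definite space associated with the pair $(L^2((-1,1);(1-x^2)^{-1}),A)$. Moreover, the Jacobi polynomials $\{P_m^{(-1,-1)}\}_{m=2}^\infty$ form a complete orthogonal set in each $H_n$; specifically, they satisfy $$(P_m^{(-1,-1)},P_l^{(-1,-1)})_n=(m(m-1)+k)^n\delta_{m,l}\qquad(m,l\ge2).$$ Furthermore, define $B_n:\mathcal{D}(B_n)\subset H_n\to H_n$ by $B_nf=\ell[f]$ for $f\in\mathcal{D}(B_n):=V_{n+2}$. Then $B_n$ is the $n$-th left-definite (self-adjoint) operator associated with the pair $(L^2((-1,1);(1-x^2)^{-1}),A)$. Lastly, the spectrum of $B_n$ is $$\sigma(B_n)=\{m(m-1)+k\mid m=2,3,4,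\dots\}=\sigma(A).$$
   Context: The differential expression is $\ell[y](x)=-(1-x^2)y''(x)+ky(x)$, $x\in(-1,1)$. Write $(f,g)_{-1,-1}=\int_{-1}^1 f\overline{g}(1-x^2)^{-1}dx$ for the inner product of $L^2((-1,1);(1-x^2)^{-1})$. The domain of $A$ is $$\Delta=\{f:(-1,1)\to\mathbb{C}\mid f,f'\in AC_{\mathrm{loc}}(-1,1);\ f,\ell[f]\in L^2((-1,1);(1-x^2)^{-1})\};$$ $A$ is self-adjoint and bounded below by $kI$. The notation $f\in AC^{(n-1)}_{\mathrm{loc}}(-1,1)$ means $f,f',\dots,f^{(n-1)}$ are absolutely continuous on every compact subinterval of $(-1,1)$. For $m\ge2$, $P_m^{(-1,-1)}$ is the multiple of $\sum_{j=0}^m\binom{m-1}{j}\binom{m-1}{m-j}\left(\frac{x-1}{2}\right)^j\left(\frac{x+1}{2}\right)^{m-j}$ (with $\binom{m-1}{m}=0$) normalized to have norm $1$ in $L^2((-1,1);(1-x^2)^{-1})$. Coefficients (for $k>0$): $c_0(n,k)=k^n$ and, for $1\le j\le n$, $c_j(n,k)=\sum_{r=0}^{n-j}\binom{n}{r}S(n-r,j)k^r$, where $S(\nu,j)$ (needed only for $\nu\ge j\geq 1$) are the Jacobi-Stirling numbers: $S(\nu,1)=\delta_{\nu,1}$ and, for $j\ge2$, $$S(\nu,j)=\sum_{r=2}^j(-1)^{r+j}\frac{(2r-1)(r-2)!\,[r(r-1)]^\nu}{r!\,(j-r)!\,(j+r-1)!}.$$ Left-definite space: let $S$ be a self-adjoint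 operator in a Hilbert space $(H,(\cdot,\cdot))$ bounded below by $\rho I$, $\rho>0$, and let $s>0$. For a vector subspace $V_s$ of $H$ with inner product $(\cdot,\cdot)_s$, $H_s=(V_s,(\cdot,\cdot)_s)$ is an $s$-th left-definite space associated with $(H,S)$ if: (i) $H_s$ is a Hilbert space; (ii) $\mathcal{D}(S^s)$ is a vector subspace of $V_s$; (iii) $\mathcal{D}(S^s)$ is dense in $H_s$; (iv) $(x,x)_s\ge\rho^s(x,x)$ for all $x\in V_s$; (v) $(x,y)_s=(S^sx,y)$ for all $x\in\mathcal{D}(S^s)$, $y\in V_s$. (Such a space is unique.) Here the lower bound used for $A$ is $\rho=k$. Left-definite operator: a self-adjoint operator $S_s:\mathcal{D}(S_s)\subset H_s\to H_s$ with $S_sx=Sx$ for all $x\in\mathcal{D}(S_s)\subset\mathcal{D}(S)$ is called an $s$-th left-definite operator associated with $(H,S)$. (Such an operator is unique.) *)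

(* Defs.v *)
From mathcomp Require Import all_boot all_order all_algebra.
From mathcomp Require Import complex.
From mathcomp Require Import all_classical all_reals all_analysis.

Set Implicit Arguments.
Unset Strict Implicit.
Unset Printing Implicit Defensive.

Import Order.TTheory GRing.Theory Num.Theory.
Import numFieldNormedType.Exports.

Local Open Scope classical_set_scope.
Local Open Scope ring_scope.
Local Open Scope complex_scope.

(** * Operators in complex Hilbert spaces

    As is usual for [L^2], a space is given by its representatives: a set of
    vectors of an ambient complex vector space [T] with a positive semidefinite
    hermitian form, linear in the first argument.  The vectors of the space in
    the strict sense are the classes of representatives for the relation
    "the difference has norm 0", written [hsame] below, and every notion is
    stated up to that relation. *)

Section AbstractOperators.
Variables (R : realType) (T : lmodType R[i]).

Record space := Space { carrier : set T ; ip : T -> T -> R[i] }.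

(* Only the values of [oact] on [odom] matter. *)
Record operator := Operator { odom : set T ; oact : T -> T }.

Implicit Types (H K : space) (S B : operator) (x y z : T).

Definition hnorm H x : R := Num.sqrt (complex.Re (ip H x x)).

Definition hsame H x y : Prop :=
  [/\ carrier H x, carrier H y & hnorm H (x - y) = 0].

Definition subspace (V : set T) : Prop :=
  V 0 /\ forall (a : R[i]) x y, V x -> V y -> V (a *: x + y).

Definition inner_product H : Prop :=
  [/\ forall (a : R[i]) x y z, carrier H x -> carrier H y -> carrier H z ->
        ip H (a *: x + y) z = a * ip H x z + ip H y z,
      forall x y, carrier H x -> carrier H y -> ip H y x = (ip H x y)^* &
      forall x, carrier H x -> 0 <= ip H x x].

Definition complete_space H : Prop :=
  forall u : nat -> T, (forall n, carrier H (u n)) ->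
    (forall e : R, 0 < e -> exists N : nat, forall m n : nat,
       (N <= m)%N -> (N <= n)%N -> hnorm H (u m - u n) < e) ->
    exists2 x, carrier H x &
      hnorm H (u n - x) @[n --> \oo] --> (0 : R).

Definition hilbert H : Prop :=
  [/\ subspace (carrier H), inner_product H & complete_space H].

Definition dense_in H (D : set T) : Prop :=
  forall y, carrier H y -> forall e : R, 0 < e ->
    exists x, [/\ D x, carrier H x & hnorm H (y - x) < e].

Definition linear_operator H S : Prop :=
  [/\ subspace (odom S),
      forall x, odom S x -> carrier H x /\ carrier H (oact S x),
      forall x y, odom S x -> odom S y -> hsame H x y ->
        hsame H (oact S x) (oact S y) &
      forall (a : R[i]) x y, odom S x -> odom S y ->
        hsame H (oact S (a *: x + y)) (a *: oact S x + oact S y)].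

(* [x] is (a representative of) a vector of the domain and [z] of its image. *)
Definition graph H S x z : Prop :=
  exists2 x', odom S x' & hsame H x x' /\ hsame H z (oact S x').

Definition adjoint_graph H S y z : Prop :=
  [/\ carrier H y, carrier H z &
      forall x, odom S x -> ip H (oact S x) y = ip H x z].

Definition selfadjoint H S : Prop :=
  [/\ linear_operator H S, dense_in H (odom S) &
      forall y z, graph H S y z <-> adjoint_graph H S y z].

Definition bounded_below H S (rho : R) : Prop :=
  forall x, odom S x -> rho%:C * ip H x x <= ip H (oact S x) x.

(* [graph_pow H S n x z]: [x] is in the domain of [S^n] and [z] is [S^n x]. *)
Fixpoint graph_pow H S (n : nat) x z : Prop :=
  if n is m.+1 then exists2 y, graph_pow H S m x y & graph H S y z
  else hsame H x z.

Definition dom_pow H S (n : nat) : set T :=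
  [set x | exists z, graph_pow H S n x z].

Definition resolvent H S (l : R[i]) : Prop :=
  let Sl x := oact S x - l *: x in
  [/\ forall x, odom S x -> hsame H (Sl x) 0 -> hsame H x 0,
      forall z, carrier H z -> exists2 x, odom S x & hsame H (Sl x) z &
      exists M : R, forall x, odom S x -> hnorm H x <= M * hnorm H (Sl x)].

Definition spectrum H S : set R[i] := ~` resolvent H S.

(* [Hs] is the [s]-th left-definite space associated with [(H, S)], for a
   positive integer [s] and the lower bound [rho]; [S^s] is then the [s]-fold
   composition.  The second clause of the second group says that [Hs] and [H]
   identify the same representatives, so that the classes of [Hs] are vectors
   of [H]; the converse implication follows from (iv). *)
Definition left_definite_space H S (rho : R) (s : nat) Hs : Prop :=
  [/\ [/\ (0 < s)%N, 0 < rho, hilbert H, selfadjoint H S &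
          bounded_below H S rho],
      [/\ carrier Hs `<=` carrier H, subspace (carrier Hs) &
          forall x y, carrier Hs x -> carrier Hs y ->
            hsame H x y -> hsame Hs x y] &
      [/\ (* (i) *) hilbert Hs,
          (* (ii) *) forall x, dom_pow H S s x ->
            exists2 x', carrier Hs x' & hsame H x x',
          (* (iii) *) dense_in Hs (dom_pow H S s),
          (* (iv) *) forall x, carrier Hs x ->
            (rho ^+ s)%:C * ip H x x <= ip Hs x x &
          (* (v) *) forall x y z, carrier Hs x -> carrier Hs y ->
            graph_pow H S s x z -> ip Hs x y = ip H z y]].

(* [B] is the [s]-th left-definite operator associated with [(H, S)], and it
   acts in the [s]-th left-definite space [Hs]. *)
Definition left_definite_operator H S (rho : R) (s : nat) Hs B : Prop :=
  [/\ left_definite_space H S rho s Hs,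
      selfadjoint Hs B &
      forall x, odom B x -> graph H S x (oact B x)].

(* Orthogonal system whose linear span is dense. *)
Definition complete_orthogonal H (e : nat -> T) : Prop :=
  [/\ forall i, carrier H (e i),
      forall i j, i != j -> ip H (e i) (e j) = 0 &
      forall x, carrier H x -> forall eps : R, 0 < eps ->
        exists N : nat, exists a : nat -> R[i],
          hnorm H (x - \sum_(i < N) a i *: e i) < eps].

End AbstractOperators.

(** * Functions on (-1,1)

    A complex function on (-1,1) is a total function [R -> R[i]] of which only
    the values on (-1,1) are used. *)

Section Functions.
Variable R : realType.
Implicit Types (f g : R -> R[i]) (a b : R).

Let I : set R := `]-1, 1[%classic.

(* [derive1n] is total; its value is 0 where the derivative does not exist. *)
Definition cderiv (j : nat) f : R -> R[i] := fun x =>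
  derive1n j (@complex.Re R \o f) x +i* derive1n j (@complex.Im R \o f) x.

Definition cderivable f (x : R) : Prop :=
  derivable (@complex.Re R \o f) x 1 /\ derivable (@complex.Im R \o f) x 1.

Definition abs_cont a b f : Prop :=
  forall e : R, 0 < e -> exists2 d : R, 0 < d &
    forall (N : nat) (u v : 'I_N -> R),
      (forall i, [/\ a <= u i, u i <= v i & v i <= b]) ->
      (forall i j, i != j -> v i <= u j \/ v j <= u i) ->
      \sum_(i < N) (v i - u i) < d ->
      \sum_(i < N) Normc.normc (f (v i) - f (u i)) < e.

Definition AC_loc f : Prop :=
  forall a b, -1 < a -> a <= b -> b < 1 -> abs_cont a b f.

(* [f, f', ..., f^(n-1)] exist everywhere on (-1,1) and are locally absolutely
   continuous; this is [AC_loc^(n-1)] for [n >= 1]. *)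
Definition AC_loc_upto (n : nat) f : Prop :=
  (forall j : nat, (j.+1 < n)%N -> forall x, I x -> cderivable (cderiv j f) x) /\
  (forall j : nat, (j < n)%N -> AC_loc (cderiv j f)).

Definition weight (e : int) (x : R) : R := (1 - x ^+ 2) ^ e.

(* Square integrable for the weight; Borel measurable representatives. *)
Definition L2w (e : int) : set (R -> R[i]) := [set f : R -> R[i] |
  [/\ measurable_fun I (@complex.Re R \o f),
      measurable_fun I (@complex.Im R \o f) &
      (\int[lebesgue_measure]_(x in I)
         (Normc.normc (f x) ^+ 2 * weight e x)%:E < +oo)%E]].

Definition cintegral (h : R -> R[i]) : R[i] :=
  (\int[lebesgue_measure]_(x in I) complex.Re (h x))%R +i*
  (\int[lebesgue_measure]_(x in I) complex.Im (h x))%R.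

Definition wip (e : int) f g : R[i] :=
  cintegral (fun x => f x * (g x)^* * (weight e x)%:C).

Definition L2 : space (R -> R[i]) := Space (L2w (-1)) (wip (-1)).

(** * The Jacobi expression for the parameters (-1,-1) *)

Definition ell (k : R) f : R -> R[i] := fun x =>
  - (1 - x ^+ 2)%:C * cderiv 2 f x + k%:C * f x.

Definition Delta (k : R) : set (R -> R[i]) := [set f : R -> R[i] |
  [/\ AC_loc_upto 2 f, L2w (-1) f & L2w (-1) (ell k f)]].

Definition jacobiA (k : R) : operator (R -> R[i]) :=
  Operator (Delta k) (ell k).

Definition jacobi_sum (m : nat) : R -> R[i] := fun x =>
  (\sum_(j < m.+1) ('C(m.-1, j) * 'C(m.-1, m - j))%N%:R *
     ((x - 1) / 2) ^+ j * ((x + 1) / 2) ^+ (m - j)%N)%:C.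

Definition jacobiP (m : nat) : R -> R[i] :=
  ((hnorm L2 (jacobi_sum m))^-1)%:C *: jacobi_sum m.

(* Jacobi-Stirling numbers, for [1 <= j <= nu]. *)
Definition jacobi_stirling (nu j : nat) : R :=
  if j == 1%N then (nu == 1%N)%:R
  else \sum_(2 <= r < j.+1)
    (-1) ^+ (r + j)%N *
    (((2 * r - 1) * (r - 2)`! * (r * (r - 1)) ^ nu)%N%:R /
     (r`! * (j - r)`! * (j + r - 1)`!)%N%:R).

Definition coef (n : nat) (k : R) (j : nat) : R :=
  if j == 0%N then k ^+ n
  else \sum_(r < (n - j).+1%N)
    'C(n, r)%:R * jacobi_stirling (n - r)%N j * k ^+ r.

Definition Vn (n : nat) : set (R -> R[i]) := [set f : R -> R[i] |
  AC_loc_upto n f /\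
  forall j : nat, (j <= n)%N -> L2w (j%:Z - 1) (cderiv j f)].

Definition ipn (n : nat) (k : R) f g : R[i] :=
  \sum_(j < n.+1) (coef n k j)%:C *
    wip (j%:Z - 1) (cderiv j f) (cderiv j g).

Definition Hn (n : nat) (k : R) : space (R -> R[i]) :=
  Space (Vn n) (ipn n k).

Definition Bn (n : nat) (k : R) : operator (R -> R[i]) :=
  Operator (Vn n.+2) (ell k).

Definition jacobi_eigenvalue (k : R) (m : nat) : R := (m * (m - 1))%N%:R + k.

Definition eigenfunction (k l : R) f : Prop :=
  [/\ odom (jacobiA k) f, hnorm L2 f != 0 &
      hsame L2 (oact (jacobiA k) f) (l%:C *: f)].

End Functions.

Arguments L2 {R}.
Arguments jacobiP {R} m.

(* Main.v *)
(** Everything is read off the coefficients [(f, e_m)] in the orthonormal basis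
    of Jacobi polynomials of [L^2((1-x^2)^-1)].  Integration by parts gives
    [(l[f], e_m) = mu_m (f, e_m)] on the domain of [A], and, with the
    Jacobi-Stirling identity [(x + k)^n = sum_j c_j(n,k) <x>_j] where
    [<x>_j = prod_(r < j) (x - r (r - 1))], also
    [(f, e_m)_n = mu_m^n (f, e_m)] on [V_n], for [mu_m = m (m - 1) + k].  Since
    [V_n] is complete, [mu_m^(-n/2) e_m] is an orthonormal basis of [H_n], and
    [V_n] consists of the [f] with [sum_m mu_m^n |(f, e_m)|^2] finite, up to
    equality almost everywhere.  Hence [A] on [L^2] and [B_n] on [H_n] are
    diagonal operators with eigenvalues [mu_m]; self-adjointness, the
    left-definite properties and the spectra are statements on sequences.  No
    Hardy type inequality is needed: that [l] maps [V_(n+2)] into [V_n] follows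
    from the coefficients and from the continuity of [l[f]].  The boundary terms
    vanish because a function of [L^2((1-x^2)^-1)] has lower limit 0 at both
    endpoints.  *)
Require Import Defs.
From mathcomp Require Import all_boot all_order all_algebra.
From mathcomp Require Import complex.
From mathcomp Require Import all_classical all_reals all_analysis.
From mathcomp Require Import measurable_realfun.
From mathcomp Require Import ring lra zify.

Set Implicit Arguments.
Unset Strict Implicit.
Unset Printing Implicit Defensive.

Import Order.TTheory GRing.Theory Num.Theory.
Import numFieldNormedType.Exports.

Local Open Scope classical_set_scope.
Local Open Scope ring_scope.

(** * Jacobi-Stirling numbers *)

(** Spaces consist of representatives, so an argument on coefficients produces a function only up to
    a null set, whereas [Vn] and [Delta] require derivatives at every point. Riesz-Fischer inside
    [Hn] bridges this gap: a coefficient sequence of finite weighted square sum is realised by a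
    genuine element of [Vn]. Maximality of both domains rests on it: that of A goes through [Vn 2],
    that of [Bn n] through [Vn n.+2]. Totality is proved in [L2] only and carried to each [Hn] by
    the formula for [(f, e_m)_n]. The analytic obstacle is absolute continuity in its epsilon-delta
    form. Dyadic difference quotients form a martingale bounded in L^1; uniform integrability and
    the divergence of a strictly convex function make it Cauchy, and its limit is the density. Since
    each weight is bounded below on compact subintervals, weighted convergence implies local L^1
    convergence, under which differentiation is closed; this gives completeness of [Vn]. All
    analysis is done on real functions, and the complex spaces are assembled from real and imaginary
    parts at the end. *)

Section JacobiStirling.
Variable R : realType.
Local Notation S := (jacobi_stirling R).

Definition jfact (x : R) (j : nat) : R := \prod_(r < j) (x - (r * r.-1)%:R).

Definition js_term (nu j r : nat) : R :=
  (-1) ^+ (r + j) * (((2 * r - 1) * (r - 2)`! * (r * (r - 1)) ^ nu)%N%:R /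
     (r`! * (j - r)`! * (j + r - 1)`!)%N%:R).

Lemma jacobi_stirlingE nu j : (2 <= j)%N ->
  S nu j = \sum_(2 <= r < j.+1) js_term nu j r.
Proof. by case: j => [|[|j]]. Qed.

Lemma fact_neq0R n : (n`!)%:R != 0 :> R.
Proof. by rewrite pnatr_eq0 -lt0n fact_gt0. Qed.

(** The factor [r (r - 1) - (j + 1) j = - (j + 1 - r) (j + r)] cancels one step in each of the
    factorials [(j + 1 - r)!] and [(j + r)!], so the triangular recurrence already holds term by
    term for [r <= j]. *)
Lemma js_term_rec nu j r : (2 <= r)%N -> (r <= j)%N ->
  js_term nu.+1 j.+1 r - (j.+1 * j)%:R * js_term nu j.+1 r = js_term nu j r.
Proof.
move=> r2 rj; rewrite /js_term.
have -> : (r + j.+1 = (r + j).+1)%N by lia.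
have -> : (j.+1 - r = (j - r).+1)%N by lia.
have -> : (j.+1 + r - 1 = (j + r - 1).+1)%N by lia.
rewrite !factS expnS.
have f1 := fact_neq0R r; have f2 := fact_neq0R (j - r).
have f3 := fact_neq0R (j + r - 1).
rewrite exprS !natrM.
have g1 : (j - r).+1%:R != 0 :> R by rewrite pnatr_eq0.
have g2 : (j + r - 1).+1%:R != 0 :> R by rewrite pnatr_eq0.
move: g1 g2; have -> : (j + r - 1).+1 = (j + r)%N by lia.
rewrite -natr1 natrD [in (r - 1)%N%:R]natrB ?(ltnW r2)// natrB// -natr1 => g1 g2.
set A := r`!%:R in f1 *; set B := _`!%:R in f2 *; set C := _`!%:R in f3 *.
set E := (_ ^ nu)%:R; set F := (r - 2)`!%:R; set G := (2 * r - 1)%:R.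
set s := (-1) ^+ _.
by field; rewrite f1 f2 f3 g1 g2.
Qed.

Lemma jacobi_stirling_rec nu j : (2 <= j)%N ->
  S nu.+1 j.+1 = S nu j + (j.+1 * j)%:R * S nu j.+1.
Proof.
move=> j2; rewrite !jacobi_stirlingE// 1?ltnW// !(@big_nat_recr _ _ _ j.+1 2)/=; [|lia..].
rewrite mulrDr mulr_sumr.
rewrite [X in _ = X + _](_ : _ = \sum_(2 <= r < j.+1) (js_term nu.+1 j.+1 r - (j.+1 * j)%:R * js_term nu j.+1 r)); last first.
  by apply: eq_big_nat => r /andP[r2 rj]; rewrite js_term_rec.
rewrite sumrB addrA subrK; congr (_ + _).
(* Only the term [r = j.+1] is left, for which [r (r - 1)] is exactly [j.+1 * j]. *)
rewrite /js_term expnS.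
have -> : (j.+1 * (j.+1 - 1) = j.+1 * j)%N by lia.
by rewrite [in LHS]mulnCA natrM; ring.
Qed.

Lemma jacobi_stirling_2 nu : S nu.+2 2 = 2 ^+ nu.
Proof.
rewrite jacobi_stirlingE// big_nat1 /js_term.
have -> : ((2 * 2 - 1) * (2 - 2)`! * (2 * (2 - 1)) ^ nu.+2 = 12 * 2 ^ nu)%N.
  by rewrite !expnS (_ : (2 * 2 - 1) * (2 - 2)`! = 3)%N// (_ : 2 * (2 - 1) = 2)%N//; lia.
have -> : (2`! * (2 - 2)`! * (2 + 2 - 1)`! = 12)%N by [].
by rewrite natrM natrX (_ : (2 + 2 = 4)%N)// !exprS expr0; field.
Qed.

(* [js_term 2 j r] is the difference of consecutive values of this sequence. *)
Definition js_tele (j r : nat) : R :=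
  (-1) ^+ (r + j) * ((r * r.-1 * r.-2)%:R / (j - 2)%:R) *
  (if (r <= j)%N then ((j - r)`! * (j + r - 2)`!)%N%:R^-1 else 0).

(** Writing [r = a + 2] and [j = b + a + 3] covers all [2 <= r < j] and turns every truncated
    subtraction into an addition, so that [field] can conclude. *)
Lemma js_term_tele a b :
  js_term 2 (b + a + 3) a.+2 = js_tele (b + a + 3) a.+2 - js_tele (b + a + 3) a.+3.
Proof.
rewrite /js_term /js_tele.
have -> : (a.+2 <= b + a + 3)%N by lia.
have -> : (a.+3 <= b + a + 3)%N by lia.
have -> : (a.+2 - 2 = a)%N by lia.
have -> : (b + a + 3 - a.+2 = b.+1)%N by lia.
have -> : (b + a + 3 - a.+3 = b)%N by lia.
have -> : (b + a + 3 + a.+2 - 2 = b + a + a + 3)%N by lia.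
have -> : (b + a + 3 + a.+3 - 2 = (b + a + a + 3).+1)%N by lia.
have -> : (b + a + 3 + a.+2 - 1 = (b + a + a + 3).+1)%N by lia.
have -> : (b + a + 3 - 2 = (b + a).+1)%N by lia.
have -> : (2 * a.+2 - 1 = 2 * a + 3)%N by lia.
have -> : (a.+2 - 1 = a.+1)%N by lia.
rewrite !addSn !exprS !factS -mulnn /= !natrM.
set sg := (-1) ^+ _.
set x : R := a%:R; set y : R := b%:R.
have -> : (2 * a + 3)%:R = 2 * x + 3 by rewrite natrD natrM.
have -> : (b + a + a + 3).+1%:R = y + 2 * x + 4 by rewrite -natr1 !natrD /x /y; ring.
have -> : a.+1%:R = x + 1 by rewrite natr1.
have -> : a.+2%:R = x + 2 by rewrite -!natr1 /x; ring.
have -> : a.+3%:R = x + 3 by rewrite -!natr1 /x; ring.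
have -> : b.+1%:R = y + 1 by rewrite natr1.
have -> : (b + a).+1%:R = y + x + 1 by rewrite -natr1 natrD.
have x0 : 0 <= x by rewrite ler0n.
have y0 : 0 <= y by rewrite ler0n.
have f1 := fact_neq0R a; have f2 := fact_neq0R b.
have f3 := fact_neq0R (b + a + a + 3).
set A := a`!%:R in f1 *; set B := b`!%:R in f2 *; set C := _`!%:R in f3 *.
clearbody x y.
by field; rewrite f1 f2 f3 /=; repeat (apply/andP; split); apply/eqP; lra.
Qed.

Lemma js_term_tele_last a :
  js_term 2 a.+3 a.+3 = js_tele a.+3 a.+3 - js_tele a.+3 a.+4.
Proof.
rewrite /js_term /js_tele leqnn ltnn.
have -> : (a.+3 - 2 = a.+1)%N by lia.
have -> : (a.+3 - a.+3 = 0)%N by lia.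
have -> : (a.+3 + a.+3 - 2 = (a + a + 4))%N by lia.
have -> : (a.+3 + a.+3 - 1 = (a + a + 4).+1)%N by lia.
have -> : (2 * a.+3 - 1 = 2 * a + 5)%N by lia.
have -> : (a.+3 - 1 = a.+2)%N by lia.
rewrite !factS -mulnn /= !natrM.
set x : R := a%:R.
have -> : (2 * a + 5)%:R = 2 * x + 5 by rewrite natrD natrM.
have -> : (a + a + 4).+1%:R = 2 * x + 5 by rewrite -natr1 !natrD /x; ring.
have -> : a.+1%:R = x + 1 by rewrite natr1.
have -> : a.+2%:R = x + 2 by rewrite -!natr1 /x; ring.
have -> : a.+3%:R = x + 3 by rewrite -!natr1 /x; ring.
have x0 : 0 <= x by rewrite ler0n.
have f1 := fact_neq0R a.
have f3 := fact_neq0R (a + a + 4).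
set A := a`!%:R in f1 *; set C := _`!%:R in f3 *.
rewrite fact0; clearbody x.
by field; rewrite f1 f3 /=; repeat (apply/andP; split); apply/eqP; lra.
Qed.

(** The defining sum telescopes along [js_tele j], which vanishes at [r = 2] through the factor
    [r.-2] and at [r = j.+1] through its cutoff. *)
Lemma jacobi_stirling_2_0 j : (2 < j)%N -> S 2 j = 0.
Proof.
move=> j2; rewrite jacobi_stirlingE 1?ltnW//.
transitivity (\sum_(2 <= r < j.+1) (js_tele j r - js_tele j r.+1)).
  apply: eq_big_nat => r /andP[r2 rj].
  have [rj'|] := ltnP r j.
    have := js_term_tele (r - 2) (j - r.+1).
    have -> : ((j - r.+1) + (r - 2) + 3 = j)%N by lia.
    by have -> : (r - 2).+2 = r by lia.
  move=> jr; have <- : j = r by lia.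
  by have := js_term_tele_last (j - 3); have -> : (j - 3).+3 = j by lia.
under eq_bigr do rewrite -opprB.
rewrite sumrN telescope_sumr; last lia.
by rewrite /js_tele ltnn /= !mulr0 !mul0r !mulr0 mul0r subr0 oppr0.
Qed.

(** The recurrence propagates the zeros of the row [nu = 2]. Row 1 could not start the induction:
    the closed formula gives 1/2 at [nu = 1], [j = 2]. *)
Lemma jacobi_stirling_gt nu j : (2 <= nu)%N -> (nu < j)%N -> S nu j = 0.
Proof.
case: nu => [|[|nu]]// _; elim: nu j => [|nu IH] j nuj.
  exact: jacobi_stirling_2_0.
case: j nuj => // j nuj; rewrite jacobi_stirling_rec; last lia.
by rewrite !IH ?mulr0 ?addr0//; lia.
Qed.

Lemma jacobi_stirling_diag nu : (0 < nu)%N -> S nu nu = 1.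
Proof.
case: nu => [//|[|nu]] _; first by rewrite /jacobi_stirling.
elim: nu => [|nu IH]; first by rewrite jacobi_stirling_2 expr0.
rewrite jacobi_stirling_rec// IH jacobi_stirling_gt// mulr0 addr0//.
Qed.

Lemma jacobi_stirling_ge0 nu j : (0 < j)%N -> (j <= nu)%N -> 0 <= S nu j.
Proof.
case: j => [//|[|j]] _; first by rewrite /jacobi_stirling /= ler0n.
case: nu => [//|[//|nu]]; elim: nu j => [|nu IH] j jn.
  by case: j jn => // _; rewrite jacobi_stirling_2 expr0 ler01.
case: j jn => [|j] jn; first by rewrite jacobi_stirling_2 exprn_ge0.
rewrite jacobi_stirling_rec//; apply: addr_ge0; first by apply: IH; lia.
have [jj|jj] := leqP j.+3 nu.+2; first by rewrite mulr_ge0 ?ler0n ?IH.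
by rewrite jacobi_stirling_gt ?mulr0.
Qed.

Lemma jfactS x j : jfact x j.+1 = jfact x j * (x - (j * j.-1)%:R).
Proof. by rewrite /jfact big_ord_recr. Qed.

(** Multiplication by [x] acts by [x * jfact x j = jfact x j.+1 + j (j - 1) * jfact x j], which is
    the recurrence of the Jacobi-Stirling numbers. For exponents from 2 on the term [j = 1] is 0, so
    the induction runs on sums starting at 2. *)
Lemma expr_jacobi_stirling (x : R) nu : (0 < nu)%N ->
  x ^+ nu = \sum_(1 <= j < nu.+1) S nu j * jfact x j.
Proof.
case: nu => [//|[|nu]] _.
  by rewrite big_nat1 mul1r /jfact big_ord1 subr0 expr1.
transitivity (\sum_(2 <= j < nu.+3) S nu.+2 j * jfact x j); last first.
  by rewrite [RHS]big_ltn// mul0r add0r.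
elim: nu => [|nu IH].
  rewrite big_nat1 jacobi_stirling_2 mul1r /jfact !big_ord_recr big_ord0 /=.
  by rewrite !subr0 mul1r expr2.
rewrite exprSr IH mulr_suml.
transitivity (\sum_(2 <= j < nu.+3) (S nu.+2 j * jfact x j.+1 +
    (j * j.-1)%:R * S nu.+2 j * jfact x j)).
  by apply: eq_bigr => j _; rewrite jfactS; ring.
rewrite big_split /= [in RHS]big_ltn//.
rewrite [X in _ = _ + X]big_add1 /=.
have -> : \sum_(2 <= i < nu.+3) S nu.+3 i.+1 * jfact x i.+1 =
  \sum_(2 <= i < nu.+3) S nu.+2 i * jfact x i.+1 +
  \sum_(2 <= i < nu.+3) (i.+1 * i)%:R * S nu.+2 i.+1 * jfact x i.+1.
  rewrite -big_split /=; apply: eq_big_nat => j /andP[j2 _].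
  by rewrite jacobi_stirling_rec//; ring.
rewrite addrCA; congr (_ + _).
transitivity (\sum_(2 <= i < nu.+4) (i * i.-1)%:R * S nu.+2 i * jfact x i).
  by rewrite [RHS]big_nat_recr//= jacobi_stirling_gt// mulr0 mul0r addr0.
rewrite big_ltn//; congr (_ + _); last by rewrite big_add1.
by rewrite !jacobi_stirling_2 exprS.
Qed.

(** All summands are nonnegative, and the last one, [r = n - j], contains the diagonal value
    [S j j = 1]. *)
Lemma coef_gt0 n (k : R) j : 0 < k -> (j <= n)%N -> 0 < coef n k j.
Proof.
move=> k0 jn; rewrite /coef; case: eqP => [_|/eqP j0]; first by rewrite exprn_gt0.
rewrite big_ord_recr /= ltr_wpDl//.
  apply: sumr_ge0 => r _; rewrite mulr_ge0 ?exprn_ge0 ?(ltW k0)// mulr_ge0 ?ler0n//.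
  by rewrite jacobi_stirling_ge0 ?lt0n//; have := ltn_ord r; lia.
rewrite subKn// jacobi_stirling_diag ?lt0n// mulr1 mulr_gt0 ?exprn_gt0//.
by rewrite ltr0n bin_gt0; lia.
Qed.

(** Expanding the right side by the binomial theorem and each positive power of [x] by
    [expr_jacobi_stirling] gives a sum over a triangle, which is exchanged; the remaining binomial
    term [k^n] is the coefficient of index 0. *)
Lemma sum_coef_jfact n (k x : R) : (0 < n)%N ->
  \sum_(j < n.+1) coef n k j * jfact x j = (x + k) ^+ n.
Proof.
move=> n0; rewrite big_ord_recl /= {1}/coef /= {1}/jfact big_ord0 mulr1.
rewrite exprDn big_ord_recr /= subnn expr0 mul1r binn mulr1n addrC; congr (_ + _).
transitivity (\sum_(j < n) \sum_(r < n | (r + j < n)%N)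
   'C(n, r)%:R * S (n - r) j.+1 * k ^+ r * jfact x j.+1).
  apply: eq_bigr => j _; rewrite /coef /= /bump leq0n add1n mulr_suml.
  rewrite (big_ord_widen_cond n predT (fun r => 'C(n, r)%:R * S (n - r) j.+1 * k ^+ r * jfact x j.+1)); last by lia.
  by apply: eq_bigl => r /=; have := ltn_ord j; have := ltn_ord r; lia.
rewrite (exchange_big_dep predT)//=; apply: eq_bigr => r _.
rewrite (expr_jacobi_stirling x) ?subn_gt0// -mulrnAr mulr_suml.
rewrite big_add1 /= big_mkord.
rewrite (big_ord_widen_cond n predT (fun i => S (n - r) i.+1 * jfact x i.+1 * (k ^+ r *+ 'C(n, r)))); last by lia.
apply: eq_big => [i|i _] /=; first by have := ltn_ord r; lia.
by rewrite -mulr_natr; ring.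
Qed.

End JacobiStirling.

(** * The Jacobi polynomials for the parameters (-1,-1) *)

Section JacobiPolynomial.
Variable R : realType.
Implicit Types (m i j : nat).

Definition jac_coef m j : nat := ('C(m.-1, j) * 'C(m.-1, m - j))%N.

Definition jac_mon m j : {poly R} := ('X - 1) ^+ j * ('X + 1) ^+ (m - j).

Definition jac m : {poly R} :=
  2^-1 ^+ m *: \sum_(j < m.+1) (jac_coef m j)%:R *: jac_mon m j.

Lemma jacobi_sumE m (x : R) : jacobi_sum m x = ((jac m).[x])%:C%C.
Proof.
rewrite /jacobi_sum /jac hornerZ horner_sum mulr_sumr; congr (_%:C%C).
apply: eq_bigr => j _; rewrite hornerZ /jac_mon !hornerE !expr_div_n -!exprVn.
have e : 2^-1 ^+ m = 2^-1 ^+ j * 2^-1 ^+ (m - j) :> R.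
  by rewrite -exprD subnKC// -ltnS ltn_ord.
by rewrite /= e /jac_coef; ring.
Qed.

(** This two-term relation is what recombines the two shifted sums that [jac_mon_ode] produces. *)
Lemma jac_coef_rec m i : (0 < m)%N -> (i <= m)%N ->
  (jac_coef m i.+1 * (i.+1 * i) = jac_coef m i * ((m - i) * (m - i).-1))%N.
Proof.
case: m => // m _ im; rewrite /jac_coef /=.
have [->|im'] := eqVneq i m.+1; first by rewrite subnn !muln0 bin_small// mul0n.
have {}im : (i <= m)%N by lia.
have h1 := mul_bin_left m i.
have h2 := mul_bin_left m (m - i).
have e : (m - (m - i) = i)%N by lia.
rewrite e in h2; have -> : (m.+1 - i.+1 = m - i)%N by lia.
have -> : (m.+1 - i = (m - i).+1)%N by lia.
by rewrite /=; nia.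
Qed.

Lemma deriv_jac_mon i l :
  (('X - 1) ^+ i * ('X + 1) ^+ l)^`() =
  ('X - 1) ^+ i.-1 * ('X + 1) ^+ l *+ i + ('X - 1) ^+ i * ('X + 1) ^+ l.-1 *+ l
  :> {poly R}.
Proof.
rewrite derivM !deriv_exp derivB derivD derivX !derivC subr0 addr0 !mul1r.
by rewrite mulrnAl mulrnAr.
Qed.

Lemma expr_predM (A : {poly R}) n : A * A ^+ n.-1 *+ n = A ^+ n *+ n.
Proof. by case: n => // n; rewrite exprS. Qed.

(** With [A = X - 1] and [B = X + 1] one has [1 - X^2 = - A B], and multiplying a second derivative
    of [A^i B^(m - i)] by [A B] leaves only the exponents [i - 1], [i] and [i + 1] of [A]. *)
Lemma jac_mon_ode m i : (i <= m)%N ->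
  (1 - 'X^2) * (jac_mon m i)^`()^`() =
  - (jac_mon m i.-1 *+ (i * i.-1) + jac_mon m i *+ (2 * i * (m - i))
     + jac_mon m i.+1 *+ ((m - i) * (m - i).-1)).
Proof.
move=> im; rewrite /jac_mon subnS.
have -> : 1 - 'X^2 = - (('X - 1) * ('X + 1)) :> {poly R} by ring.
have -> : ('X - 1 : {poly R}) ^+ i.-1 * ('X + 1) ^+ (m - i.-1) *+ (i * i.-1) =
    ('X - 1) ^+ i.-1 * ('X + 1) ^+ (m - i).+1 *+ (i * i.-1).
  by case: i im => // i im; rewrite subnSK.
rewrite deriv_jac_mon derivD !derivMn !deriv_jac_mon.
move: ('X - 1) ('X + 1) (m - i)%N => A B l.
have hA n : A * A ^+ n.-1 *+ n = A ^+ n *+ n by exact: expr_predM.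
have hB n : B * B ^+ n.-1 *+ n = B ^+ n *+ n by exact: expr_predM.
rewrite mulNr; congr (- _).
transitivity ((A * A ^+ i.-1.-1 *+ i.-1) * (B * B ^+ l) *+ i
   + (A * A ^+ i.-1 *+ i) * (B * B ^+ l.-1 *+ l) *+ 2
   + (A * A ^+ i) * (B * B ^+ l.-1.-1 *+ l.-1) *+ l); first by ring.
rewrite !hA !hB -!exprS; congr (_ + _ + _).
- by rewrite mulrnAl -mulrnA mulnC.
- by rewrite mulrnAl mulrnAr -!mulrnA; congr (_ *+ _); lia.
- by rewrite mulrnAr -mulrnA mulnC.
Qed.

(** After both shifts the [i]-th monomial carries the factor [i (i - 1) + 2 i (m - i) + (m - i) (m -
    i - 1)], which does not depend on [i]: it is [m (m - 1)]. *)
Lemma jac_ode m : (0 < m)%N ->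
  (1 - 'X^2) * (jac m)^`()^`() = - (jac m *+ (m * (m - 1))).
Proof.
move=> m0; rewrite /jac !derivZ -scalerAr scalerMnr -scalerN; congr (_ *: _).
rewrite !raddf_sum /= mulr_sumr.
transitivity (\sum_(j < m.+1) (- (jac_mon m j.-1 *+ (jac_coef m j * (j * j.-1)) + jac_mon m j *+ (jac_coef m j * (2 * j * (m - j)))
     + jac_mon m j.+1 *+ (jac_coef m j * ((m - j) * (m - j).-1))))).
  apply: eq_bigr => j _; rewrite !derivZ -scalerAr jac_mon_ode -1?ltnS// scalerN.
  by rewrite !scaler_nat !mulrnDl -!mulrnA !(mulnC (jac_coef m j)).
rewrite sumrN -sumrMnl; congr (- _).
rewrite !big_split /=.
rewrite [X in X + _ + _ = _]big_ord_recl /= mul0n muln0 mulr0n add0r.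
rewrite [X in _ + _ + X = _]big_ord_recr /= subnn mul0n muln0 mulr0n addr0.
under eq_bigr => i _ do rewrite /bump leq0n add1n /= jac_coef_rec ?(ltnW (ltn_ord i))//.
have -> : \sum_(i < m) jac_mon m i *+ (jac_coef m i * ((m - i) * (m - i).-1)) =
   \sum_(i < m.+1) jac_mon m i *+ (jac_coef m i * ((m - i) * (m - i).-1)).
  by rewrite big_ord_recr /= subnn mul0n muln0 mulr0n addr0.
have -> : \sum_(i < m) jac_mon m i.+1 *+ (jac_coef m i * ((m - i) * (m - i).-1)) =
   \sum_(i < m.+1) jac_mon m i *+ (jac_coef m i * (i * i.-1)).
  rewrite [RHS]big_ord_recl /= mul0n muln0 mulr0n add0r; apply: eq_bigr => i _.
  by rewrite /bump leq0n add1n -jac_coef_rec// ltnW.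
rewrite -!big_split /=; apply: eq_bigr => i _.
rewrite scaler_nat -mulrnA -!mulrnDr -!mulnDr; congr (_ *+ (_ * _)).
have : (i <= m)%N by rewrite -ltnS.
case: (nat_of_ord i) => [|j] /=; nia.
Qed.

Lemma jac_mon_monic m j : (j <= m)%N ->
  jac_mon m j \is monic /\ size (jac_mon m j) = m.+1.
Proof.
move=> jm.
have eA : 'X - 1 = 'X - 1%:P :> {poly R} by rewrite polyC1.
have eB : 'X + 1 = 'X - (-1)%:P :> {poly R} by rewrite polyCN opprK polyC1.
have mA : 'X - 1 \is @monic R by rewrite eA monicXsubC.
have mB : 'X + 1 \is @monic R by rewrite eB monicXsubC.
rewrite /jac_mon; split; first by rewrite monicMl monic_exp.
rewrite size_monicM ?monic_exp ?monic_neq0 ?monic_exp// eA eB.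
by rewrite !size_exp_XsubC; lia.
Qed.

(** Every [jac_mon m j] is monic of degree [m], so the leading coefficient is a positive multiple of
    the sum of the [jac_coef m j], whose term [j = 1] is [m - 1]. *)
Lemma size_jac m : (1 < m)%N -> size (jac m) = m.+1.
Proof.
move=> m1; apply/eqP; rewrite eqn_leq; apply/andP; split.
  rewrite (leq_trans (size_scale_leq _ _))// (leq_trans (size_sum _ _ _))//.
  apply/bigmax_leqP => j _; rewrite (leq_trans (size_scale_leq _ _))//.
  by have [_ ->] := @jac_mon_monic m j (ltn_ord j).
rewrite ltnNge; apply/negP => /leq_sizeP/(_ m (leqnn _))/eqP.
rewrite coefZ mulf_eq0 expf_eq0 invr_eq0 pnatr_eq0 andbF /= coef_sum.
have -> : \sum_(j < m.+1) ((jac_coef m j)%:R *: jac_mon m j)`_m =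
   (\sum_(j < m.+1) jac_coef m j)%:R.
  rewrite natr_sum; apply: eq_bigr => j _; rewrite coefZ.
  have [/monicP + s] := @jac_mon_monic m j (ltn_ord j).
  by rewrite /lead_coef s /= => ->; rewrite mulr1.
rewrite pnatr_eq0 -leqn0 leqNgt => /negP; apply.
have m1' : (1 < m.+1)%N by lia.
rewrite (bigD1 (Ordinal m1'))//= ltn_addr// /jac_coef bin1 subn1 binn muln1; lia.
Qed.

Lemma jac_neq0 m : (1 < m)%N -> jac m != 0.
Proof. by move=> m1; rewrite -size_poly_eq0 size_jac. Qed.

(* The quotient of [jac m] by [1 - X^2], read off the differential equation. *)
Definition jacq m : {poly R} := - (m * (m - 1))%:R^-1 *: (jac m)^`()^`().

Lemma jac_jacq m : (1 < m)%N -> jac m = (1 - 'X^2) * jacq m.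
Proof.
move=> m1; rewrite /jacq -scalerAr jac_ode; last lia.
rewrite scaleNr scalerN opprK -[jac m *+ _]scaler_nat scalerA mulVf ?scale1r//.
by rewrite pnatr_eq0; lia.
Qed.

Lemma size_jacq m : (1 < m)%N -> size (jacq m) = m.-1.
Proof.
move=> m1; have := size_jac m1; have := jac_neq0 m1; rewrite jac_jacq//.
rewrite mulf_eq0 negb_or => /andP[w0 q0].
have sw : size (1 - 'X^2 : {poly R}) = 3.
  by rewrite -opprB size_polyN -[1]polyC1 size_XnsubC.
by rewrite size_mul// sw; move: (size (jacq m)) => s; lia.
Qed.

(** The polynomials [jacq 2, jacq 3, ...] have degrees 0, 1, ..., so leading terms are eliminated
    one at a time. *)
Lemma poly_jacq_span (q : {poly R}) :
  exists c : nat -> R, q = \sum_(i < size q) c i *: jacq i.+2.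
Proof.
move: {2}(size q) (leqnn (size q)) => n; elim: n q => [|n IH] q sq.
  exists (fun=> 0); have /eqP e : size q == 0%N by rewrite -leqn0.
  by move/eqP: (e); rewrite size_poly_eq0 => /eqP ->; rewrite size_poly0 big_ord0.
have sn : size (jacq n.+2) = n.+1 by rewrite size_jacq.
pose a := q`_n / lead_coef (jacq n.+2).
have l0 : lead_coef (jacq n.+2) != 0 by rewrite lead_coef_eq0 -size_poly_eq0 sn.
have [|c cE] := IH (q - a *: jacq n.+2).
  apply/leq_sizeP => j nj; rewrite coefB coefZ.
  have [->|jn] := eqVneq j n.
    have -> : (jacq n.+2)`_n = lead_coef (jacq n.+2) by rewrite /lead_coef sn.
    by rewrite divfK ?subrr.
  rewrite !nth_default ?mulr0 ?subr0 ?sn//; first lia.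
  by apply: leq_trans sq _; lia.
have [sq'|sq'] := leqP (size q) n; first by exact: IH.
have {sq'}sq' : size q = n.+1 by lia.
have sz : (size (q - a *: jacq n.+2)%R <= n.+1)%N.
  by rewrite (leq_trans (size_polyD _ _))// geq_max sq size_polyN (leq_trans (size_scale_leq _ _)) ?sn.
move: (size (q - a *: jacq n.+2)%R) sz cE => sz szn cE.
exists (fun i => (if (i < sz)%N then c i else 0) + (if i == n then a else 0)).
rewrite sq'; under eq_bigr do rewrite scalerDl.
rewrite big_split /=.
rewrite [X in _ + X](_ : _ = a *: jacq n.+2); last first.
  rewrite big_ord_recr /= eqxx big1 ?add0r// => i _.
  by rewrite ltn_eqF ?scale0r.
apply/eqP; rewrite -subr_eq cE; apply/eqP.
rewrite (big_ord_widen_cond n.+1 predT (fun i => c i *: jacq i.+2))// big_mkcond /=.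
by apply: eq_bigr => i _; case: ifP => _; rewrite ?scale0r.
Qed.

(** Differentiating the equation once more lowers the eigenvalue by [2 j]; the accumulated
    [j (j - 1)] is the origin of the factors of [jfact]. *)
Lemma jac_derivn_ode m j : (0 < m)%N ->
  (1 - 'X^2) * (jac m)^`(j.+2) - 'X * (jac m)^`(j.+1) *+ (2 * j)
  = - ((m * (m - 1))%:R - (j * j.-1)%:R) *: (jac m)^`(j).
Proof.
move=> m0; elim: j => [|j IH].
  rewrite muln0 mulr0n !subr0 scaleNr scaler_nat.
  by rewrite derivn0 -jac_ode.
have := congr1 (@deriv R) IH.
rewrite derivB derivM derivMn derivM derivZ -!derivnS derivB derivXn derivX.
rewrite -[X in X^`() - _]polyC1 derivC sub0r /= expr1 => e.
apply/eqP; rewrite -subr_eq0; apply/eqP.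
move/eqP: e; rewrite -subr_eq0 => /eqP <-.
rewrite -!mul_polyC !polyCN !polyCB !polyC_natr.
case: j {IH} => [|j] /=; rewrite ?natrM -?natr1; ring.
Qed.

End JacobiPolynomial.

(** * Completeness of weighted Lebesgue spaces *)

Section RieszFischer.
Context {d : measure_display} {T : measurableType d} {R : realType}.
Variables (mu : {measure set T -> \bar R}) (D : set T) (mD : measurable D).
Variables (p : nat) (p0 : (0 < p)%N) (w : T -> R) (mw : measurable_fun D w)
  (w0 : forall x, D x -> 0 < w x).

Definition pdens (f g : T -> R) (x : T) : \bar R := (`|f x - g x| ^+ p * w x)%:E.

(** Valued in the extended reals, so that it makes sense before integrability is known. It is used
    with [p = 1] for difference quotients and with [p = 2] for the weighted spaces. *)
Definition pdist (f g : T -> R) : \bar R := (\int[mu]_(x in D) pdens f g x)%E.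

Lemma measurable_pdens (f g : T -> R) : measurable_fun D f -> measurable_fun D g ->
  measurable_fun D (pdens f g).
Proof.
move=> mf mg; apply/measurable_EFinP; apply: measurable_funM => //.
apply: measurable_funX; apply: measurableT_comp => //.
exact: measurable_funB.
Qed.

Lemma pdens_ge0 (f g : T -> R) x : D x -> (0 <= pdens f g x)%E.
Proof. by move=> Dx; rewrite lee_fin mulr_ge0 ?exprn_ge0// ltW// w0. Qed.

Lemma riesz_fischer (u : nat -> T -> R) :
  (forall n, measurable_fun D (u n)) ->
  (forall e : R, 0 < e -> exists N, forall m n, (N <= m)%N -> (N <= n)%N ->
     (pdist (u m) (u n) <= e%:E)%E) ->
  exists2 g : T -> R, measurable_fun D g &
    forall e : R, 0 < e -> exists N, forall n, (N <= n)%N ->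
     (pdist (u n) g <= e%:E)%E.
Proof.
move=> mu_ cau.
(* Multiplied by [(2^k)^p], these distances are at most [2^-(k+1)], with sum at most 1. *)
pose eps k : R := (1 / (2 ^ k.+1)%:R) / (2 ^+ k) ^+ p.
have eps0 k : 0 < eps k by rewrite divr_gt0 ?exprn_gt0// divr_gt0// ltr0n expn_gt0.
have /choice[N0 N0P] k := cau _ (eps0 k).
(* These partial sums are nondecreasing in [k] and dominate both [N0 k] and [k]. *)
pose phi k := (\sum_(i < k.+1) (N0 i).+1)%N.
have phiN k : (N0 k <= phi k)%N.
  by rewrite /phi big_ord_recr (leq_trans (leqnSn _))// leq_addl.
have phi_nd k l : (k <= l)%N -> (phi k <= phi l)%N.
  elim: l => [|l IH]; first by rewrite leqn0 => /eqP ->.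
  rewrite leq_eqVlt => /predU1P[->//|]; rewrite ltnS => /IH kl.
  by rewrite (leq_trans kl)// /phi [in leqRHS]big_ord_recr leq_addr.
have phik k : (k <= phi k)%N.
  rewrite /phi (leq_trans (leqnSn _))// -[X in (X <= _)%N]card_ord -sum1_card.
  exact: leq_sum.
pose v k := u (phi k).
have mv k : measurable_fun D (v k) by exact: mu_.
have vP k l : (k <= l)%N -> (pdist (v k) (v l) <= (eps k)%:E)%E.
  by move=> kl; apply: N0P => //; rewrite (leq_trans (phiN k))// phi_nd.
pose F k (x : T) : \bar R := (((2 ^+ k) ^+ p)%:E * pdens (v k) (v k.+1) x)%E.
have F0 k x : D x -> (0 <= F k x)%E.
  by move=> Dx; rewrite mule_ge0 ?pdens_ge0// lee_fin !exprn_ge0.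
have mF k : measurable_fun D (F k).
  exact: emeasurable_funM (measurable_cst _) (measurable_pdens (mv _) (mv _)).
have mS : measurable_fun D (fun x => \sum_(0 <= k <oo) F k x)%E.
  apply: ge0_emeasurable_sum => [k x Dx _|k _]; [exact: F0|exact: mF].
have S0 x : D x -> (0 <= \sum_(0 <= k <oo) F k x)%E.
  by move=> Dx; apply: nneseries_ge0 => k _ _; exact: F0.
have IF : (\int[mu]_(x in D) (\sum_(0 <= k <oo) F k x) < +oo)%E.
  rewrite integral_nneseries//.
  apply: (@le_lt_trans _ _ 1%:E); last exact: ltry.
  apply: (le_trans _ (epsilon_trick0 _ (@ler01 R))).
  apply: lee_nneseries => [k _ _|k _]; first by apply: integral_ge0 => x /F0.
  rewrite /F ge0_integralZl//; last 2 first.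
  - exact: measurable_pdens (mv _) (mv _).
  - by move=> x Dx; exact: pdens_ge0.
  apply: (@le_trans _ _ (((2 ^+ k) ^+ p)%:E * (eps k)%:E)%E).
    by apply: lee_wpmul2l; [rewrite lee_fin !exprn_ge0|exact: vP].
  by rewrite -EFinM lee_fin /eps mulrC divfK// lt0r_neq0 ?exprn_gt0.
have iS : mu.-integrable D (fun x => \sum_(0 <= k <oo) F k x)%E.
  apply/integrableP; split => //.
  apply: le_lt_trans IF; apply: ge0_le_integral => //.
  - by apply: measurableT_comp.
  - by move=> x Dx; rewrite gee0_abs// S0.
have aeF := integrable_ae mD iS.
(* An upper limit is measurable whether or not the sequence converges, and equals the limit where it
   does. *)
pose g x : R := fine (limn_esup (fun k => (v k x)%:E)).
have gP x : D x -> (\sum_(0 <= k <oo) F k x)%E \is a fin_num ->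
   v k x @[k --> \oo] --> g x.
  (* For [t = 2^k |v k x - v k.+1 x|], finiteness of the series bounds [t^p] by its sum over [w x].
     The added 1 ensures that [t > C] would imply [t <= t^p], a contradiction; so the increments are
     geometrically small. *)
  move=> Dx Sfin; pose C := (fine (\sum_(0 <= k <oo) F k x)%E / w x) + 1.
  have C1 : 1 <= C by rewrite lerDr divr_ge0 ?(ltW (w0 Dx))// fine_ge0// S0.
  have dk k : `|v k x - v k.+1 x| <= C * 2^-1 ^+ k.
    have h : (F k x <= \sum_(0 <= k <oo) F k x)%E.
      apply: le_trans (nneseries_lim_ge k.+1 _); last by move=> n _ _; exact: F0.
      by rewrite big_nat_recr//= leeDr// sume_ge0// => i _; exact: F0.
    move: h; rewrite -(fineK Sfin) /F /pdens -EFinM lee_fin mulrA -exprMn.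
    rewrite -ler_pdivlMr ?w0// => h.
    rewrite exprVn ler_pdivlMr ?exprn_gt0// mulrC.
    set t := 2 ^+ k * _ in h *; have t0 : 0 <= t by rewrite mulr_ge0 ?exprn_ge0.
    rewrite leNgt; apply/negP => Ct; have : t <= t ^+ p.
      by apply: ler_eXnr => //; rewrite (le_trans C1)// ltW.
    by move=> /(fun H => le_trans H h) tS; move: Ct; rewrite ltNge /C (le_trans tS)// lerDl.
  have cv : cvgn (v ^~ x).
    rewrite (_ : v ^~ x = fun n => v 0%N x + series (telescope (v ^~ x)) n); last first.
      by apply/funext => n; rewrite -eq_sum_telescope.
    apply: is_cvgD; first exact: is_cvg_cst.
    apply: normed_cvg; apply: (@series_le_cvg _ _ (geometric C 2^-1)) => //.
    - by move=> n; exact: normr_ge0.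
    - by move=> n; rewrite /geometric /= mulr_ge0 ?exprn_ge0// (le_trans _ C1).
    - by move=> n; have := dk n; rewrite distrC.
    - by apply: is_cvg_geometric_series; rewrite ger0_norm// invf_lt1// ltr1n.
  have /cvg_ex[l vl] := cv.
  have : (v k x)%:E @[k --> \oo] --> l%:E by apply: cvg_EFin vl; exact: nearW.
  by move=> /cvg_limn_einf_sup[_]; rewrite /g => ->.
have mg : measurable_fun D g.
  apply: measurableT_comp => //; apply: measurable_fun_limn_esup => k.
  exact/measurable_EFinP.
exists g => //.
move=> e e0; have [N NP] := cau _ e0; exists N => n Nn.
(* The density against [g] is almost everywhere the lower limit of the densities against [v k], so
   Fatou's lemma transfers the Cauchy bound to the limit. *)
rewrite /pdist (@ge0_ae_eq_integral _ _ _ mu D _ (fun x => limn_einf (fun k => pdens (u n) (v k) x)))//; last 5 first.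
- exact: measurable_pdens.
- under eq_fun do rewrite /limn_einf.
  apply: measurableT_comp => //; apply: measurable_fun_limn_esup => k.
  apply: measurableT_comp => //; exact: measurable_pdens (mu_ n) (mv k).
- by move=> x Dx; exact: pdens_ge0.
- move=> x Dx; rewrite limn_einf_lim; apply: lime_ge; first exact: is_cvg_einfs.
  apply: nearW => k; apply: le_ereal_inf_tmp => _ [j _ <-]; exact: pdens_ge0.
- apply: filterS aeF => x /= h Dx; have {}h := gP x Dx (h Dx).
  apply/esym; apply: (cvg_limn_einf_sup _).1; apply: cvg_EFin; first exact: nearW.
  apply: cvgM; last exact: cvg_cst.
  apply: (cvg_comp (fun k => `|u n x - v k x|) (fun y : R => y ^+ p) _ (@exprn_continuous R p `|u n x - g x|)).
  by apply: cvg_norm; apply: cvgB => //; exact: cvg_cst.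
apply: le_trans (fatou _ _ _ _) _ => //.
- by move=> k; exact: measurable_pdens (mu_ n) (mv k).
- by move=> k x Dx; exact: pdens_ge0.
rewrite limn_einf_lim; apply: lime_le; first exact: is_cvg_einfs.
apply: nearW => k; apply: le_trans (_ : pdist (u n) (v (maxn k N)) <= _)%E.
  by apply: ereal_inf_lbound => /=; exists (maxn k N) => //=; rewrite leq_maxl.
by apply: NP => //; rewrite (leq_trans _ (phik _))// leq_maxr.
Qed.

End RieszFischer.

(** * Absolutely continuous functions *)

Section FiniteSums.
Lemma sum_block (V : nmodType) (N K : nat) (F : nat -> V) :
  \sum_(i < N * K) F i = \sum_(q < N) \sum_(r < K) F (q * K + r)%N.
Proof.
elim: N => [|N IH]; first by rewrite !big_ord0.
by rewrite big_ord_recr -IH mulSn addnC big_split_ord.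
Qed.
End FiniteSums.

Section StepIntegral.
Variable R : realType.
Local Notation mu := (@lebesgue_measure R).

Lemma integrable_setU (A B : set R) (f : R -> \bar R) :
  measurable A -> measurable B -> [disjoint A & B] ->
  mu.-integrable A f -> mu.-integrable B f -> mu.-integrable (A `|` B) f.
Proof.
move=> mA mB AB /integrableP[mf fA] /integrableP[mf' fB].
have mU : measurable_fun (A `|` B) f by apply/measurable_funU.
apply/integrableP; split => //; rewrite ge0_integral_setU//; last exact: measurableT_comp.
exact: lte_add_pinfty.
Qed.

Lemma step_integral (g : R -> R) (y c : nat -> R) (N : nat) :
  (forall i, (i < N)%N -> y i <= y i.+1) ->
  (forall i x, (i < N)%N -> y i <= x < y i.+1 -> g x = c i) ->
  mu.-integrable `[y 0%N, y N[ (EFin \o g) /\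
  \int[mu]_(x in `[y 0%N, y N[) g x = \sum_(i < N) c i * (y i.+1 - y i).
Proof.
elim: N => [|N IH] ymon gc.
  rewrite set_itvco0; split; first exact: integrable_set0.
  by rewrite Rintegral_set0 big_ord0.
have [|i x iN|i1 i2] := IH; first by move=> i iN; apply: ymon; rewrite ltnS ltnW.
  by apply: gc; rewrite ltnS ltnW.
have y0N n : (n <= N)%N -> y 0%N <= y n.
  elim: n => // n IHn nN; rewrite (le_trans (IHn (ltnW nN)))//.
  by apply: ymon; rewrite ltnS ltnW.
have E : `[y 0%N, y N.+1[%classic = `[y 0%N, y N[ `|` `[y N, y N.+1[.
  by apply: itv_bndbnd_setU; rewrite bnd_simp ?y0N ?ymon.
have dis : [disjoint `[y 0%N, y N[%classic & `[y N, y N.+1[%classic].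
  apply/disj_setPS => x /=; rewrite !in_itv/= => -[/andP[_ xN] /andP[Nx _]].
  by move: (lt_le_trans xN Nx); rewrite ltxx.
have gN : {in `[y N, y N.+1[%classic, (cst (c N)) =1 g}.
  by move=> x; rewrite inE/= in_itv/= => /(gc N _ (ltnSn N)) ->.
have iN : mu.-integrable `[y N, y N.+1[ (EFin \o g).
  apply: (@eq_integrable _ _ _ _ _ _ (EFin \o cst (c N))) => //.
    by move=> x /gN /= ->.
  apply/measurable_bounded_integrable => //.
  - by rewrite /= lebesgue_measure_itv; case: ifP => _; rewrite ?ltry// -EFinB ltry.
  - exact: bounded_cst.
rewrite E; split; first by apply: integrable_setU.
rewrite Rintegral_setU//; last by apply: integrable_setU.
rewrite i2 big_ord_recr /=; congr (_ + _).
transitivity (\int[mu]_(x in `[y N, y N.+1[) (cst (c N)) x).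
  by apply: eq_Rintegral => x /gN.
rewrite Rintegral_cst//= lebesgue_measure_itv /= lte_fin.
have := ymon N (ltnSn N); rewrite le_eqVlt => /predU1P[->|->//].
by rewrite ltxx subrr.
Qed.

End StepIntegral.

(** * Absolutely continuous functions are primitives: dyadic difference quotients *)

Section AbsContGrid.
Variable R : realType.

Definition rabs_cont (a b : R) (f : R -> R) : Prop :=
  forall e : R, 0 < e -> exists2 d : R, 0 < d &
    forall (N : nat) (u v : 'I_N -> R),
      (forall i, [/\ a <= u i, u i <= v i & v i <= b]) ->
      (forall i j, i != j -> v i <= u j \/ v j <= u i) ->
      \sum_(i < N) (v i - u i) < d ->
      \sum_(i < N) `|f (v i) - f (u i)| < e.

Lemma rabs_cont_unif a b f : rabs_cont a b f -> forall e : R, 0 < e ->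
  exists2 d : R, 0 < d & forall x y, a <= x -> x <= y -> y <= b -> y - x < d ->
    `|f y - f x| < e.
Proof.
move=> fac e e0; have [d d0 H] := fac e e0; exists d => // x y ax xy yb xyd.
have := H 1%N (fun=> x) (fun=> y); rewrite !big_ord1; apply => //.
by move=> i j; rewrite !ord1 eqxx.
Qed.

Variables (a b : R) (ab : a < b) (f : R -> R) (fac : rabs_cont a b f).

(** Mesh width of the dyadic grid with [2^n] cells on [[a, b]]; [gx] gives its nodes and [gs] the
    slopes of [f] over its cells. *)
Definition gl n : R := (b - a) / 2 ^+ n.
Definition gx n i : R := a + gl n * i%:R.
Definition gs n i : R := (f (gx n i.+1) - f (gx n i)) / gl n.

Lemma gl_gt0 n : 0 < gl n.
Proof. by rewrite divr_gt0 ?subr_gt0 ?exprn_gt0. Qed.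

Lemma gxS n i : gx n i.+1 = gx n i + gl n.
Proof. by rewrite /gx -natr1; ring. Qed.

Lemma gx0 n : gx n 0 = a. Proof. by rewrite /gx mulr0 addr0. Qed.

Lemma glD n p : gl n = (2 ^ p)%:R * gl (n + p).
Proof.
rewrite /gl exprD natrX; have : 2 ^+ p != 0 :> R by rewrite expf_neq0.
have : 2 ^+ n != 0 :> R by rewrite expf_neq0.
by move=> h1 h2; field; rewrite h1 h2.
Qed.

Lemma gxD n p q : gx (n + p) (q * 2 ^ p) = gx n q.
Proof. by rewrite /gx (glD n p) natrM; ring. Qed.

Lemma gx_last n : gx n (2 ^ n) = b.
Proof.
by rewrite /gx /gl natrX divfK ?expf_neq0//; ring.
Qed.

Lemma gx_le n i j : (i <= j)%N -> gx n i <= gx n j.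
Proof. by move=> ij; rewrite lerD2l ler_pM2l ?gl_gt0// ler_nat. Qed.

Lemma gs_gl n i : gs n i * gl n = f (gx n i.+1) - f (gx n i).
Proof. by rewrite /gs divfK// lt0r_neq0// gl_gt0. Qed.

Lemma gs_gl_abs n i : `|gs n i| * gl n = `|f (gx n i.+1) - f (gx n i)|.
Proof. by rewrite -gs_gl [in RHS]normrM; congr (_ * _); rewrite gtr0_norm ?gl_gt0. Qed.

Lemma gl_cvg0 (e : R) : 0 < e -> exists N, forall n, (N <= n)%N -> gl n < e.
Proof.
move=> e0; have ba0 : 0 < b - a by rewrite subr_gt0.
have [N hN] : exists N, (b - a) / e < N%:R.
  by exists (Num.truncn ((b - a) / e)).+1; rewrite truncnS_gt.
exists N => n Nn; rewrite /gl ltr_pdivrMr ?exprn_gt0// mulrC -ltr_pdivrMr//.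
rewrite (lt_trans hN)// (le_lt_trans (_ : _ <= n%:R)) ?ler_nat//.
by rewrite -natrX ltr_nat ltn_expl.
Qed.

(** Cells outside [P] are collapsed to their left node, where they contribute nothing; this keeps
    the index type ['I_(2 ^ n)] required by [rabs_cont]. *)
Lemma grid_ac (e : R) : 0 < e -> exists2 d : R, 0 < d & forall n (P : pred nat),
  \sum_(i < 2 ^ n | P i) gl n < d -> \sum_(i < 2 ^ n | P i) `|gs n i| * gl n < e.
Proof.
move=> e0; have [d d0 H] := fac e0; exists d => // n P Pd.
pose u (i : 'I_(2 ^ n)) := gx n i.
pose v (i : 'I_(2 ^ n)) := if P i then gx n i.+1 else gx n i.
have hA i : [/\ a <= u i, u i <= v i & v i <= b].
  rewrite /u /v; split.
  - by rewrite -(gx0 n) gx_le.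
  - by case: ifP => _ //; rewrite gx_le.
  - by case: ifP => _; rewrite -(gx_last n) gx_le// ltnW.
have hB (i j : 'I_(2 ^ n)) : i != j -> v i <= u j \/ v j <= u i.
  rewrite /u /v neq_lt => /orP[ij|ji]; [left|right];
    by case: ifP => _; rewrite gx_le// ltnW.
have := H _ u v hA hB; rewrite !(big_mkcond (fun i : 'I__ => P i)) /= in Pd *.
have -> : \sum_(i < 2 ^ n) (v i - u i) = \sum_(i < 2 ^ n) (if P i then gl n else 0).
  by apply: eq_bigr => i _; rewrite /u /v; case: ifP => _; rewrite ?subrr// gxS; ring.
move=> /(_ Pd); congr (_ < _); apply: eq_bigr => i _; rewrite /u /v.
by case: ifP => _; rewrite ?subrr ?normr0// gs_gl_abs.
Qed.

Lemma grid_block n p (F : nat -> nat -> R) :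
  \sum_(i < 2 ^ (n + p)) F (i %/ 2 ^ p)%N i =
  \sum_(q < 2 ^ n) \sum_(r < 2 ^ p) F q (q * 2 ^ p + r)%N.
Proof.
rewrite expnD (sum_block _ _ (fun i => F (i %/ 2 ^ p)%N i)).
apply: eq_bigr => q _; apply: eq_bigr => r _.
by rewrite divnMDl ?expn_gt0// divn_small// addn0.
Qed.

(** The martingale property: a slope is the mean of the finer slopes in its cell. *)
Lemma gs_block n p q :
  \sum_(r < 2 ^ p) gs (n + p) (q * 2 ^ p + r) * gl (n + p) = gs n q * gl n.
Proof.
rewrite gs_gl; under eq_bigr do rewrite gs_gl -addnS.
rewrite -(big_mkord predT (fun r => f (gx (n + p) (q * 2 ^ p + r.+1)) - f (gx (n + p) (q * 2 ^ p + r)))).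
rewrite telescope_sumr// addn0 gxD; congr (f _ - _).
by rewrite -mulSnr gxD.
Qed.

Lemma grid_abs_mono n p :
  \sum_(i < 2 ^ n) `|gs n i| * gl n <= \sum_(i < 2 ^ (n + p)) `|gs (n + p) i| * gl (n + p).
Proof.
rewrite (grid_block n p (fun _ i => `|gs (n + p) i| * gl (n + p))).
apply: ler_sum => q _; rewrite -[X in _ * X]gtr0_norm ?gl_gt0// -normrM -(gs_block n p).
rewrite (le_trans (ler_norm_sum _ _ _))//; apply: ler_sum => r _.
by rewrite normrM [X in _ * X]gtr0_norm ?gl_gt0.
Qed.

(** Choose [n0] with cells shorter than the modulus of [grid_ac] for 1. Within each of these [2^n0]
    cells every finer level has variation below 1, and an arbitrary level is compared with a
    refinement of it. *)
Lemma grid_bv : exists2 C : R, 0 < C & forall n,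
  \sum_(i < 2 ^ n) `|gs n i| * gl n <= C.
Proof.
have [d d0 H] := grid_ac ltr01; have [n0 n0P] := gl_cvg0 d0.
have large p : \sum_(i < 2 ^ (n0 + p)) `|gs (n0 + p) i| * gl (n0 + p) <= (2 ^ n0)%:R.
  rewrite (grid_block n0 p (fun q i => `|gs (n0 + p) i| * gl (n0 + p))).
  rewrite -[X in _ <= X%:R]card_ord -sum1_card natr_sum; apply: ler_sum => q _.
  have pick (G : nat -> R) : \sum_(i < 2 ^ (n0 + p) | (i %/ 2 ^ p)%N == q) G i =
      \sum_(r < 2 ^ p) G (q * 2 ^ p + r)%N.
    rewrite big_mkcond /=.
    have /= -> := grid_block n0 p (fun j i => if j == q then G i else 0).
    rewrite (bigD1 q)//= eqxx [X in _ + X]big1 ?addr0// => j jq.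
    by apply: big1 => r _; rewrite (negbTE (jq : (j : nat) != q)).
  rewrite -(pick (fun i => `|gs (n0 + p) i| * gl (n0 + p))).
  apply/ltW/(H _ (fun i => (i %/ 2 ^ p)%N == q)).
  rewrite (pick (fun=> gl (n0 + p))) sumr_const card_ord -mulr_natl -glD.
  exact: n0P.
exists (2 ^ n0)%:R; first by rewrite ltr0n expn_gt0.
by move=> n; rewrite (le_trans (grid_abs_mono n n0))// addnC large.
Qed.

(** Uniform integrability, by Markov's inequality: with [M = 2 C / d] the cells of slope above [M]
    have total length at most [C / M = d / 2], which is below the modulus [d] of [grid_ac]. *)
Lemma grid_ui (e : R) : 0 < e -> exists2 M : R, 0 < M & forall n,
  \sum_(i < 2 ^ n | M < `|gs n i|) `|gs n i| * gl n < e.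
Proof.
move=> e0; have [C C0 CP] := grid_bv; have [d d0 H] := grid_ac e0.
exists (2 * C / d) => [|n]; first by rewrite divr_gt0// mulr_gt0.
apply: (H n (fun i => 2 * C / d < `|gs n i|)).
rewrite -(@ltr_pM2l _ (2 * C / d)) ?divr_gt0 ?mulr_gt0// divfK ?lt0r_neq0//.
apply: (@le_lt_trans _ _ C); last by rewrite ltr_pMl// ltr1n.
apply: le_trans (CP n); rewrite mulr_sumr big_mkcond /=; apply: ler_sum => i _.
case: ifP => [h|_]; last by rewrite mulr_ge0// ltW// gl_gt0.
by rewrite ler_pM2r ?gl_gt0// ltW.
Qed.

(* Bregman divergence of the strictly convex function [sqrt (1 + x^2)]. *)
Definition breg (s t : R) : R :=
  Num.sqrt (1 + s ^+ 2) - Num.sqrt (1 + t ^+ 2)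
  - t / Num.sqrt (1 + t ^+ 2) * (s - t).

Lemma sqrt1_gt0 (s : R) : 0 < Num.sqrt (1 + s ^+ 2).
Proof. by rewrite sqrtr_gt0 ltr_pwDl// sqr_ge0. Qed.

Lemma sqrt1_sqr (s : R) : Num.sqrt (1 + s ^+ 2) ^+ 2 = 1 + s ^+ 2.
Proof. by rewrite sqr_sqrtr// addr_ge0// sqr_ge0. Qed.

Lemma sqrt1_le (s : R) : Num.sqrt (1 + s ^+ 2) <= 1 + `|s|.
Proof.
rewrite -(@ler_pXn2r _ 2) ?nnegrE ?sqrtr_ge0 ?addr_ge0// sqrt1_sqr sqrrD.
by rewrite expr1n mul1r real_normK ?num_real// lerD2r lerDl mulrn_wge0.
Qed.

(** Multiplication by the conjugate expression removes the square roots. Hence the divergence is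
    nonnegative and controls [(s - t)^2] as long as both slopes stay bounded. *)
Lemma bregE (s t : R) : breg s t * (Num.sqrt (1 + t ^+ 2) *
    (Num.sqrt (1 + s ^+ 2) * Num.sqrt (1 + t ^+ 2) + 1 + s * t)) = (s - t) ^+ 2.
Proof.
rewrite /breg; have := sqrt1_sqr s; have := sqrt1_sqr t.
have := sqrt1_gt0 t; set x := Num.sqrt _; set y := Num.sqrt _ => x0 xx yy.
have -> : (y - x - t / x * (s - t)) * (x * (y * x + 1 + s * t)) =
   (y * x - x ^+ 2 - t * (s - t)) * (y * x + 1 + s * t).
  by field; rewrite lt0r_neq0.
have -> : (y * x - x ^+ 2 - t * (s - t)) * (y * x + 1 + s * t) =
  (y * x - (1 + s * t)) * (y * x + 1 + s * t) by rewrite xx; ring.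
have -> : (y * x - (1 + s * t)) * (y * x + 1 + s * t) = y ^+ 2 * x ^+ 2 - (1 + s * t) ^+ 2 by ring.
by rewrite xx yy; ring.
Qed.

Lemma breg_den_gt0 (s t : R) : 0 < Num.sqrt (1 + t ^+ 2) *
    (Num.sqrt (1 + s ^+ 2) * Num.sqrt (1 + t ^+ 2) + 1 + s * t).
Proof.
rewrite mulr_gt0 ?sqrt1_gt0//.
have sq (z : R) : `|z| <= Num.sqrt (1 + z ^+ 2).
  by rewrite -sqrtr_sqr ler_wsqrtr// lerDr.
have : `|s * t| <= Num.sqrt (1 + s ^+ 2) * Num.sqrt (1 + t ^+ 2).
  by rewrite normrM ler_pM.
by rewrite ler_norml => /andP[h _]; lra.
Qed.

Lemma breg_ge0 (s t : R) : 0 <= breg s t.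
Proof. by rewrite -(pmulr_lge0 _ (breg_den_gt0 s t)) bregE sqr_ge0. Qed.

(** If a slope exceeds [M], the tail terms suffice. Otherwise either [|s - t| <= e], or
    [|s - t| <= (s - t)^2 / e], and the factor in [bregE] is at most [(1 + M) * (2 * (1 + M)^2)]. *)
Lemma breg_bound (M e s t : R) : 0 < M -> 0 < e ->
  `|s - t| <= e + (2 * (1 + M) ^+ 3 / e) * breg s t
     + (if M < `|s| then 2 * `|s| else 0) + (if M < `|t| then 2 * `|t| else 0).
Proof.
move=> M0 e0.
have B0 : 0 <= 2 * (1 + M) ^+ 3 / e * breg s t.
  by rewrite mulr_ge0 ?breg_ge0// divr_ge0 ?(ltW e0)// mulr_ge0// exprn_ge0; lra.
have st := ler_normB s t; have s0 := normr_ge0 s; have t0 := normr_ge0 t.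
case: ltP => sM; case: ltP => tM; [lra|lra|lra|].
have [h|h] := leP `|s - t| e; first by lra.
rewrite !addr0; apply: (@le_trans _ _ ((s - t) ^+ 2 / e)).
  by rewrite ler_pdivlMr// -real_normK ?num_real// expr2 ler_pM2l ?ltW// (lt_trans e0).
apply: (@le_trans _ _ (2 * (1 + M) ^+ 3 / e * breg s t)); last by rewrite lerDr ltW.
rewrite [leRHS]mulrAC ler_pM2r ?invr_gt0//.
rewrite -(bregE s t) mulrC ler_wpM2r ?breg_ge0//.
have h1 := sqrt1_le s; have h2 := sqrt1_le t.
have p1 := sqrt1_gt0 s; have p2 := sqrt1_gt0 t.
have q1 : Num.sqrt (1 + s ^+ 2) <= 1 + M by lra.
have q2 : Num.sqrt (1 + t ^+ 2) <= 1 + M by lra.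
have : s * t <= M * M by rewrite (le_trans (ler_norm _))// normrM ler_pM.
have : Num.sqrt (1 + s ^+ 2) * Num.sqrt (1 + t ^+ 2) <= (1 + M) * (1 + M).
  by rewrite ler_pM// ltW.
move=> r1 r2; rewrite (_ : 2 * (1 + M) ^+ 3 = (1 + M) * (2 * (1 + M) ^+ 2)); last by ring.
rewrite ler_pM//.
  by rewrite -(pmulr_rge0 _ p2) ltW// breg_den_gt0.
by rewrite expr2; nra.
Qed.

Lemma sum_gl n : \sum_(i < 2 ^ n) gl n = b - a.
Proof.
rewrite sumr_const card_ord -mulr_natl -[X in gl X]add0n -glD.
by rewrite /gl expr0 divr1.
Qed.

(** The length of the polygonal line through the points of the graph of [f] above the nodes. *)
Definition gPhi n : R := \sum_(i < 2 ^ n) Num.sqrt (1 + gs n i ^+ 2) * gl n.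

(* The divergence sums telescope because [gs n q] is the mean of the finer
   slopes over its block, so the linear terms cancel. *)
Lemma gPhiB n p :
  \sum_(i < 2 ^ (n + p)) breg (gs (n + p) i) (gs n (i %/ 2 ^ p)) * gl (n + p)
  = gPhi (n + p) - gPhi n.
Proof.
rewrite (grid_block n p (fun q i => breg (gs (n + p) i) (gs n q) * gl (n + p))).
rewrite /gPhi (grid_block n p (fun _ i => Num.sqrt (1 + gs (n + p) i ^+ 2) * gl (n + p))).
rewrite -sumrB; apply: eq_bigr => q _.
rewrite /breg; set t := gs n q; set x := Num.sqrt (1 + t ^+ 2).
transitivity (\sum_(r < 2 ^ p) Num.sqrt (1 + gs (n + p) (q * 2 ^ p + r) ^+ 2) * gl (n + p)
   - (x - t / x * t) * \sum_(r < 2 ^ p) gl (n + p)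
   - t / x * \sum_(r < 2 ^ p) gs (n + p) (q * 2 ^ p + r) * gl (n + p)).
  by rewrite !mulr_sumr -!sumrB; apply: eq_bigr => r _; ring.
by rewrite gs_block sumr_const card_ord -mulr_natl -glD -/t; ring.
Qed.

Lemma gPhi_mono n p : gPhi n <= gPhi (n + p).
Proof.
rewrite -subr_ge0 -gPhiB sumr_ge0// => i _.
by rewrite mulr_ge0 ?breg_ge0// ltW// gl_gt0.
Qed.

Lemma gPhi_cauchy (e : R) : 0 < e -> exists N, forall n p, (N <= n)%N ->
  gPhi (n + p) - gPhi n <= e.
Proof.
move=> e0; have [C C0 CP] := grid_bv.
have bd n : gPhi n <= (b - a) + C.
  apply: (@le_trans _ _ (\sum_(i < 2 ^ n) (gl n + `|gs n i| * gl n))).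
    apply: ler_sum => i _; rewrite -{2}[gl n]mul1r -mulrDl ler_pM2r ?gl_gt0//.
    exact: sqrt1_le.
  rewrite big_split /= sum_gl lerD2l; exact: CP.
pose E := range gPhi.
have hs : has_sup E by split; [exists (gPhi 0), 0%N|exists (b - a + C) => _ [n _ <-]].
have [_ [N _ <-] hN] := sup_adherent e0 hs.
exists N => n p Nn; rewrite lerBlDr.
have h1 : gPhi (n + p) <= sup E by apply: sup_upper_bound => //; exists (n + p)%N.
have h2 : gPhi N <= gPhi n by rewrite -(subnKC Nn) gPhi_mono.
lra.
Qed.

(** Summing [breg_bound] over the cells leaves a small constant, a multiple of an increment of the
    convergent sequence [gPhi], and two tails that are small by uniform integrability. *)
Lemma gs_cauchy (e : R) : 0 < e -> exists N, forall n p, (N <= n)%N ->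
  \sum_(i < 2 ^ (n + p)) `|gs (n + p) i - gs n (i %/ 2 ^ p)| * gl (n + p) <= e.
Proof.
(* The budget is [e / 8] for the constant, [e / 8] for the divergence and [2 * (e / 8)] for each of
   the two tails. *)
move=> e0; pose e1 := e / 8 / (b - a).
have ba : 0 < b - a by rewrite subr_gt0.
have e10 : 0 < e1 by rewrite !divr_gt0.
have e80 : 0 < e / 8 by rewrite divr_gt0.
have [M M0 MP] := grid_ui e80.
pose K := 2 * (1 + M) ^+ 3 / e1.
have K0 : 0 < K by rewrite divr_gt0// mulr_gt0// exprn_gt0; lra.
have eK : 0 < e / 8 / K by rewrite divr_gt0.
have [N NP] := gPhi_cauchy eK; exists N => n p Nn.
apply: (@le_trans _ _ (\sum_(i < 2 ^ (n + p)) (e1 * gl (n + p)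
   + K * (breg (gs (n + p) i) (gs n (i %/ 2 ^ p)) * gl (n + p))
   + (if M < `|gs (n + p) i| then 2 * (`|gs (n + p) i| * gl (n + p)) else 0)
   + (if M < `|gs n (i %/ 2 ^ p)| then 2 * (`|gs n (i %/ 2 ^ p)| * gl (n + p)) else 0)))).
  apply: ler_sum => i _.
  have := @breg_bound M e1 (gs (n + p) i) (gs n (i %/ 2 ^ p)) M0 e10.
  rewrite -/K => /(ler_wpM2r (ltW (gl_gt0 (n + p)))) h.
  apply: (le_trans h); rewrite le_eqVlt; apply/orP; left; apply/eqP.
  by case: ifP => _; case: ifP => _; ring.
rewrite !big_split /= -mulr_sumr sum_gl -mulr_sumr gPhiB -!big_mkcond -!mulr_sumr /=.
have h1 : e1 * (b - a) = e / 8 by rewrite /e1 divfK// lt0r_neq0.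
have h2 : K * (gPhi (n + p) - gPhi n) <= e / 8.
  by rewrite -ler_pdivlMl// mulrC NP.
have h3 := MP (n + p)%N.
have h4 : \sum_(i < 2 ^ (n + p) | M < `|gs n (i %/ 2 ^ p)|) `|gs n (i %/ 2 ^ p)| * gl (n + p) < e / 8.
  rewrite big_mkcond /=.
  have /= -> := grid_block n p (fun q i => if M < `|gs n q| then `|gs n q| * gl (n + p) else 0).
  apply: le_lt_trans (MP n); rewrite [leRHS]big_mkcond /=; apply: ler_sum => q _.
  case: ifP => _; last by rewrite big1.
  by rewrite sumr_const card_ord -mulr_natl mulrCA -glD.
lra.
Qed.

Local Notation mu := (@lebesgue_measure R).

Definition gstep n (x : R) : R := gs n (Num.truncn ((x - a) / gl n)).

Lemma gstepE n i x : gx n i <= x < gx n i.+1 -> gstep n x = gs n i.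
Proof.
move=> /andP[ix xi]; rewrite /gstep (@truncn_def _ _ i)//.
rewrite ler_pdivlMr ?gl_gt0// ltr_pdivrMr ?gl_gt0//.
by move: ix xi; rewrite /gx !(mulrC (gl n)) => ? ?; lra.
Qed.

Lemma gx_div n p i x : gx (n + p) i <= x < gx (n + p) i.+1 ->
  gx n (i %/ 2 ^ p) <= x < gx n (i %/ 2 ^ p).+1.
Proof.
move=> /andP[ix xi]; rewrite -!(gxD n p); apply/andP; split.
  by rewrite (le_trans _ ix)// gx_le// leq_trunc_div.
by rewrite (lt_le_trans xi)// gx_le// ltn_ceil// expn_gt0.
Qed.

Lemma gstep_integral n (x : R) i : gx n i <= x <= gx n i.+1 -> x <= b ->
  mu.-integrable `[a, x[ (EFin \o gstep n) /\
  \int[mu]_(t in `[a, x[) gstep n t = f (gx n i) - f a + gs n i * (x - gx n i).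
Proof.
move=> /andP[ix xi] xb.
pose y j := if (j <= i)%N then gx n j else x.
have yj j : (j < i)%N -> y j.+1 = gx n j.+1 /\ y j = gx n j.
  by move=> ji; rewrite /y ji (ltnW ji).
have y0 : y 0%N = a by rewrite /y gx0.
have yi : y i = gx n i by rewrite /y leqnn.
have yi1 : y i.+1 = x by rewrite /y ltnn.
have [|j z|] := @step_integral R (gstep n) y (gs n) i.+1.
- move=> j; rewrite ltnS leq_eqVlt => /predU1P[->|/yj[-> ->]].
    by rewrite yi yi1.
  exact: gx_le.
- rewrite ltnS leq_eqVlt => /predU1P[->|/yj[-> ->]]; last exact: gstepE.
  rewrite yi yi1 => /andP[iz zx]; apply: gstepE.
  by rewrite iz (lt_le_trans zx).
rewrite y0 yi1 => i1 ->; split => //.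
rewrite big_ord_recr /= yi yi1; congr (_ + _).
rewrite (eq_bigr (fun j : 'I_i => f (gx n j.+1) - f (gx n j))); last first.
  by move=> j _; have [-> ->] := yj j (ltn_ord j); rewrite gxS addrAC subrr add0r gs_gl -gxS.
by rewrite -(big_mkord predT (fun j => f (gx n j.+1) - f (gx n j))) telescope_sumr// gx0.
Qed.

Lemma gstep_dist n p :
  mu.-integrable `[a, b[ (EFin \o (fun x => `|gstep (n + p) x - gstep n x|)) /\
  \int[mu]_(t in `[a, b[) `|gstep (n + p) t - gstep n t| =
  \sum_(i < 2 ^ (n + p)) `|gs (n + p) i - gs n (i %/ 2 ^ p)| * gl (n + p).
Proof.
have [|j z|] := @step_integral R (fun x => `|gstep (n + p) x - gstep n x|)
   (gx (n + p)) (fun i => `|gs (n + p) i - gs n (i %/ 2 ^ p)|) (2 ^ (n + p)).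
- by move=> i _; rewrite gx_le.
- by move=> _ h; rewrite (gstepE h) (gstepE (gx_div h)).
rewrite gx0 gx_last => i1 ->; split => //.
by apply: eq_bigr => i _; rewrite gxS addrAC subrr add0r.
Qed.

Lemma grid_cell n (x : R) : a <= x -> exists i, gx n i <= x < gx n i.+1.
Proof.
move=> ax; exists (Num.truncn ((x - a) / gl n)).
have h : 0 <= (x - a) / gl n by rewrite divr_ge0 ?subr_ge0// ltW// gl_gt0.
have := truncn_itv h; rewrite ler_pdivlMr ?gl_gt0// ltr_pdivrMr ?gl_gt0//.
by rewrite /gx !(mulrC (gl n)) => /andP[h1 h2]; apply/andP; split; lra.
Qed.

Lemma grid_cell_le n (x : R) : a <= x <= b ->
  exists2 i, (i < 2 ^ n)%N & gx n i <= x <= gx n i.+1.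
Proof.
move=> /andP[ax]; rewrite le_eqVlt => /predU1P[->|xb].
  exists (2 ^ n).-1; first by rewrite ltn_predL expn_gt0.
  by rewrite prednK ?expn_gt0// gx_last lexx andbT -(gx_last n) gx_le// leq_pred.
have [i /andP[h1 h2]] := grid_cell n ax; exists i; last by rewrite h1 ltW.
rewrite ltnNge; apply/negP => /(gx_le n); rewrite gx_last => h3.
by have := lt_le_trans xb h3; rewrite ltNge h1.
Qed.

Lemma integrable_itv_co_cc (g : R -> R) :
  mu.-integrable `[a, b[ (EFin \o g) -> mu.-integrable `[a, b] (EFin \o g).
Proof.
move=> ig; have -> : `[a, b]%classic = `[a, b[ `|` [set b].
  by rewrite setUitv1// bnd_simp ltW.
apply: integrable_setU => //.
  apply/disj_setPS => x [] /=; rewrite in_itv/= => /andP[_ xb] xE.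
  by move: xb; rewrite xE ltxx.
apply: measurable_bounded_integrable => //.
- by rewrite /= lebesgue_measure_set1 ltry.
- exact: measurable_fun_set1.
- exists `|g b|; split; first exact: num_real.
  by move=> M bM x /= ->; rewrite ltW.
Qed.

(** The step functions of the slopes converge in L^1, and their integrals from [a] agree with
    [f - f a] at the nodes; the limit is therefore a density of [f]. *)
Lemma abs_cont_primitive : exists2 g : R -> R,
  mu.-integrable `[a, b] (EFin \o g) &
  forall x, a <= x <= b -> f x - f a = \int[mu]_(t in `[a, x]) g t.
Proof.
have mD : @measurable _ (measurableTypeR R) `[a, b[%classic by exact: measurable_itv.
have bb : a <= b <= b by rewrite lexx ltW.
have ih n : mu.-integrable `[a, b[ (EFin \o gstep n).
  by have [i _ /gstep_integral[]] := grid_cell_le n bb.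
have mh n : measurable_fun `[a, b[ (gstep n).
  by have /integrableP[/measurable_EFinP] := ih n.
have pdE n p : pdist mu `[a, b[ 1 (fun=> 1) (gstep (n + p)) (gstep n) =
    (\sum_(i < 2 ^ (n + p)) `|gs (n + p) i - gs n (i %/ 2 ^ p)| * gl (n + p))%:E.
  have [i1 <-] := gstep_dist n p; rewrite /Rintegral fineK; last exact: integrable_fin_num.
  by apply: eq_integral => x _; rewrite /pdens expr1 mulr1.
have pdC u v : pdist mu `[a, b[ 1 (fun=> 1) u v = pdist mu `[a, b[ 1 (fun=> 1) v u.
  by apply: eq_integral => x _; rewrite /pdens distrC.
have [||e e0|g mg gP] := @riesz_fischer _ _ _ mu `[a, b[%classic mD 1%N isT (fun=> 1) _ _ gstep mh.
- exact: measurable_cst.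
- by move=> x _; exact: ltr01.
- have [N NP] := gs_cauchy e0; exists N => m n.
  wlog mn : m n / (n <= m)%N => [hw Nm Nn|].
    by have [/hw|/ltnW/hw] := leqP n m; [apply|rewrite pdC; apply].
  by move=> Nm Nn; rewrite -(subnKC mn) pdE lee_fin NP.
have idiff n : (pdist mu `[a, b[%classic 1%N (fun=> 1%R) (gstep n) g < +oo)%E ->
    mu.-integrable `[a, b[ (EFin \o (fun x => gstep n x - g x)).
  move=> fin; apply/integrableP; split.
    by apply/measurable_EFinP; exact: (measurable_funB (mh n) mg).
  apply: le_lt_trans fin; rewrite le_eqVlt; apply/orP; left; apply/eqP.
  by apply: eq_integral => x _; rewrite /pdens expr1 mulr1.
have ig : mu.-integrable `[a, b[ (EFin \o g).
  have [N /(_ N (leqnn N)) h] := gP _ ltr01.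
  have := integrableB mD (ih N) (idiff N (le_lt_trans h (ltry _))).
  by apply: eq_integrable => // x _ /=; rewrite -EFinB; congr (_%:E); ring.
exists g; first exact: integrable_itv_co_cc.
move=> x axb; have /andP[ax xb] := axb.
have sub : `[a, x[%classic `<=` `[a, b[%classic.
  by move=> t /=; rewrite !in_itv/= => /andP[-> h]; rewrite (lt_le_trans h).
have igx : mu.-integrable `[a, x[ (EFin \o g) by exact: integrableS ig.
rewrite -Rintegral_itv_bndo_bndc//.
apply/eqP; rewrite -subr_eq0 -normr_le0; apply/ler_addgt0Pr => e e0; rewrite add0r.
have e30 : 0 < e / 3 by rewrite divr_gt0.
have [d d0 dP] := rabs_cont_unif fac e30.
have [N1 N1P] := gl_cvg0 d0; have [N2 N2P] := gP _ e30.
(* At this level the L^1 distance is at most [e / 3], and cells are so short that [f] varies by less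
   than [e / 3] on each: once for passing from [x] to a node, once for the linear interpolation. *)
pose n := maxn N1 N2.
have [i i2 ixi] := grid_cell_le n axb; have /andP[ix xi] := ixi.
have [ihx hE] := gstep_integral ixi xb.
have xib : gx n i.+1 <= b by rewrite -(gx_last n) gx_le.
have axi : a <= gx n i by rewrite -(gx0 n) gx_le.
have gld : gl n < d by apply: N1P; rewrite leq_maxl.
have dist : mu.-integrable `[a, b[ (EFin \o (fun t => `|gstep n t - g t|)) /\
    \int[mu]_(t in `[a, b[) `|gstep n t - g t| <= e / 3.
  have h := N2P n (leq_maxr _ _).
  have := idiff n (le_lt_trans h (ltry _)) => /integrable_norm i1; split => //.
  rewrite -lee_fin /Rintegral fineK ?integrable_fin_num//; apply: le_trans h.
  rewrite le_eqVlt; apply/orP; left; apply/eqP.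
  by apply: eq_integral => t _; rewrite /pdens expr1 mulr1.
have [id dle] := dist.
have h1 : `|\int[mu]_(t in `[a, x[) (gstep n t - g t)| <= e / 3.
  apply: le_trans (le_normr_Rintegral _ _) _ => //.
    apply: eq_integrable (integrableB _ ihx igx) => //.
  apply: le_trans dle; rewrite /Rintegral fine_le//.
  - by apply: integrable_fin_num => //; exact: integrableS id.
  - exact: integrable_fin_num.
  - apply: ge0_subset_integral => //.
      by have /integrableP[] := id.
have h2 : `|f x - f (gx n i)| < e / 3.
  apply: dP => //; apply: le_lt_trans gld; move: xi; rewrite gxS; lra.
have h3 : `|gs n i * (x - gx n i)| < e / 3.
  rewrite normrM; apply: (@le_lt_trans _ _ (`|gs n i| * gl n)).
    by rewrite ler_wpM2l// ger0_norm ?subr_ge0//; move: xi; rewrite gxS; lra.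
  rewrite gs_gl_abs; apply: dP => //; first exact: gx_le.
  by rewrite gxS addrAC subrr add0r.
move: h1; rewrite RintegralB// hE => h1.
have -> : f x - f a - \int[mu]_(t in `[a, x[) g t =
   (f (gx n i) - f a + gs n i * (x - gx n i) - \int[mu]_(t in `[a, x[) g t)
   + (f x - f (gx n i)) - gs n i * (x - gx n i) by ring.
rewrite (le_trans (ler_normB _ _))// (le_trans (lerD (ler_normD _ _) (lexx _)))//.
lra.
Qed.

End AbsContGrid.

(** * Measurability of the derivative of a continuous function *)

Section DeriveMeasurable.
Variable R : realType.

Let dquot (f : R -> R) (h x : R) : R := h^-1 *: (f (h + x) - f x).

(** A Cauchy condition on the difference quotients with countably many parameters. For continuous
    [f] each such set is closed, so the set of points of derivability is Borel. *)
Let osc_le (f : R -> R) (k j : nat) : set R := [set x | forall h h' : R,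
  0 < `|h| < j.+1%:R^-1 -> 0 < `|h'| < j.+1%:R^-1 ->
  `|dquot f h x - dquot f h' x| <= k.+1%:R^-1].

Let derivable_set (f : R -> R) : set R := \bigcap_k \bigcup_j osc_le f k j.

Lemma invS_lt (e : R) : 0 < e -> exists k : nat, k.+1%:R^-1 < e.
Proof.
move=> e0; exists (Num.truncn e^-1); rewrite invf_plt ?posrE ?ltr0n//.
exact: truncnS_gt.
Qed.

Let derivable_dquot (f : R -> R) (x : R) : derivable f x 1 <-> cvg (dquot f h x @[h --> 0^']).
Proof.
rewrite /derivable; set F := (F in cvg (F @ _) <-> _).
by have -> : F = dquot f ^~ x by apply/funext => h; rewrite /F /dquot [h *: 1]mulr1.
Qed.

Let derivable_setP (f : R -> R) (x : R) : derivable_set f x <-> derivable f x 1.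
Proof.
rewrite derivable_dquot; split=> [dx|/cvg_ex[/= l ql] k _].
  apply: cauchy_cvg; apply: cauchy_exP => e e0.
  have [k ke] := invS_lt e0; have [j _ oj] := dx k I.
  have j0 : 0 < j.+1%:R^-1 :> R by rewrite invr_gt0 ltr0n.
  exists (dquot f j.+2%:R^-1 x).
  have : \forall h \near 0^', ball (dquot f j.+2%:R^-1 x) e (dquot f h x); last by [].
  near=> h.
  rewrite /ball /=; apply: le_lt_trans ke; apply: oj.
    rewrite gtr0_norm; last by rewrite invr_gt0 ltr0n.
    rewrite invr_gt0 ltr0n /=.
    by rewrite ltf_pV2 ?posrE ?ltr0n// ltr_nat.
  rewrite normr_gt0; apply/andP; split; first by near: h; exact: nbhs_dnbhs_neq.
  by near: h; exact: dnbhs0_lt.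
have k0 : 0 < k.+1%:R^-1 / 2 :> R by rewrite divr_gt0 ?invr_gt0 ?ltr0n.
have /cvgrPdist_lt/(_ _ k0) := ql.
rewrite near_withinE => /nbhs_ballP[r r0 rP].
have [j jr] := invS_lt r0; exists j => // h h'.
have near_l (z : R) : 0 < `|z| < j.+1%:R^-1 -> `|l - dquot f z x| < k.+1%:R^-1 / 2.
  move=> /andP[z0 zj]; apply: rP; last by rewrite -normr_gt0.
  by rewrite /ball /= sub0r normrN (lt_trans zj).
move=> /near_l h1 /near_l h2.
have -> : dquot f h x - dquot f h' x = (l - dquot f h' x) - (l - dquot f h x) by ring.
by rewrite (le_trans (ler_normB _ _))// [leRHS]splitr lerD// ltW.
Unshelve. all: by end_near. Qed.

Let continuous_dquot (f : R -> R) (h : R) : continuous f -> continuous (dquot f h).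
Proof.
move=> cf x; apply: cvgZr; apply: cvgB; last exact: cf.
apply: (@continuous_comp _ _ _ (fun y => h + y) f); last exact: cf.
by apply: cvgD; [exact: cvg_cst|exact: cvg_id].
Qed.

Let closed_osc_le f k j : continuous f -> closed (osc_le f k j).
Proof.
move=> cf.
rewrite (_ : osc_le f k j = \bigcap_(p in [set p : R * R |
    0 < `|p.1| < j.+1%:R^-1 /\ 0 < `|p.2| < j.+1%:R^-1])
    ((fun x => `|dquot f p.1 x - dquot f p.2 x|) @^-1` [set y | y <= k.+1%:R^-1])); last first.
  apply/seteqP; split => [x H [h h'] /= [] hj h'j|x H h h' hj h'j]; first exact: H.
  exact: (H (h, h')).
apply: closed_bigI => -[h h'] _; apply: closed_comp; last exact: closed_le.
move=> x _; apply: cvg_norm; apply: cvgB; exact: continuous_dquot.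
Qed.

Lemma derive1_measurable (f : R -> R) : continuous f ->
  measurable_fun [set: R] (derive1 f).
Proof.
move=> cf.
have mD : measurable (derivable_set f).
  apply: bigcap_measurable => // k _; apply: bigcup_measurable => j _.
  apply: (@closed_measurable R); exact: closed_osc_le.
have -> : [set: R] = derivable_set f `|` ~` derivable_set f by rewrite setUv.
apply/measurable_funU => //; first exact: measurableC.
split.
  apply: (@measurable_fun_cvg _ _ _ _ (fun n => dquot f n.+1%:R^-1)).
    move=> n; have mq : measurable_fun [set: R] (dquot f n.+1%:R^-1).
      by apply: continuous_measurable_fun; exact: continuous_dquot.
    by apply: measurable_funS mq.
  move=> x /derivable_setP/derivable_dquot dx.
  have /cvgr_dnbhsP := dx; apply; split; last exact: cvg_harmonic.
  by move=> n; rewrite invr_eq0 pnatr_eq0.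
(* Where [f] is not derivable, [derive1] takes its default value, which is constant. *)
apply: (@eq_measurable_fun _ _ _ _ _ (cst point)).
  move=> x; rewrite inE => xD; rewrite /derive1 /cst dvgP// => dx.
  by apply: xD; apply/derivable_setP/derivable_dquot.
exact: measurable_cst.
Qed.

End DeriveMeasurable.

(** * Lebesgue's fundamental theorem of calculus *)

Section Primitive.
Variable R : realType.
Local Notation mu := (@lebesgue_measure R).
Implicit Types (f g : R -> R) (a b x y : R).

Lemma ae_imp (P Q : R -> Prop) : (forall x, P x -> Q x) ->
  {ae mu, forall x, P x} -> {ae mu, forall x, Q x}.
Proof.
by move=> PQ; apply: filterS => //; exact: (ae_filter_ringOfSetsType mu).
Qed.

Lemma ae_imp2 (P Q S : R -> Prop) : (forall x, P x -> Q x -> S x) ->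
  {ae mu, forall x, P x} -> {ae mu, forall x, Q x} -> {ae mu, forall x, S x}.
Proof.
by move=> PQ; apply: filterS2 => //; exact: (ae_filter_ringOfSetsType mu).
Qed.

Lemma ae_integrable (D : set R) f g : measurable D -> measurable_fun D g ->
  {ae mu, forall x, D x -> f x = g x} -> mu.-integrable D (EFin \o f) ->
  mu.-integrable D (EFin \o g).
Proof.
move=> mD mg fg /integrableP[mf iF].
apply/integrableP; split; first exact/measurable_EFinP.
rewrite -(@ge0_ae_eq_integral _ _ _ mu D (fun x => `|(EFin \o f) x|)%E)//.
- exact: measurableT_comp.
- by apply: measurableT_comp => //; exact/measurable_EFinP.
- by apply: ae_imp fg => x h Dx /=; rewrite h.
Qed.

Lemma ae_Rintegral (D : set R) f g : measurable D -> measurable_fun D f ->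
  measurable_fun D g -> {ae mu, forall x, D x -> f x = g x} ->
  \int[mu]_(x in D) f x = \int[mu]_(x in D) g x.
Proof.
move=> mD mf mg fg; rewrite /Rintegral; congr fine; apply: ae_eq_integral => //.
- exact/measurable_EFinP.
- exact/measurable_EFinP.
- by apply: ae_imp fg => x h Dx; rewrite h.
Qed.

Lemma integrable_sub_itv (i j : interval R) (f : R -> \bar R) :
  [set` i] `<=` [set` j] -> mu.-integrable [set` j] f -> mu.-integrable [set` i] f.
Proof. by move=> ij; apply: integrableS => //; exact: measurable_itv. Qed.

Lemma near_dist_lt x (d : R) : 0 < d -> \forall y \near x, `|y - x| < d.
Proof.
by move=> d0; apply/nbhs_ballP; exists d => //= y; rewrite /ball /= distrC.
Qed.

Lemma near_itv a b x : a < x < b -> \forall z \near x, a <= z <= b.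
Proof.
move=> /andP[ax xb]; near=> z; apply/andP; split; apply/ltW.
  by near: z; exact: lt_nbhsr.
by near: z; exact: lt_nbhsl.
Unshelve. all: by end_near. Qed.

Let derive_shift f F x c l : (\forall z \near x, f z = F z + c) ->
  derivable F x 1 /\ derive1 F x = l -> derivable f x 1 /\ derive1 f x = l.
Proof.
move=> fF [dF lF].
have e : {near x, F \+ cst c =1 f} by apply: filterS fF => z ->.
have dF' : is_derive x (1 : R) F l by split => //; rewrite -derive1E.
have [d dl] := is_deriveD dF' (is_derive_cst c x (1 : R)).
split; first exact: near_eq_derivable d.
by rewrite derive1E -(near_eq_derive _ e) dl addr0.
Qed.

Let primitive_near a b f g x : a < x < b ->
  (forall x, a <= x <= b -> f x - f a = \int[mu]_(t in `[a, x]) g t) ->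
  \forall z \near x, f z = \int[mu]_(t in `[a, z]) g t + f a.
Proof.
move=> axb fg; apply: filterS (near_itv axb) => z azb.
by rewrite -fg ?subrK.
Qed.

Lemma primitive_ae a b f g : mu.-integrable `[a, b] (EFin \o g) ->
  (forall x, a <= x <= b -> f x - f a = \int[mu]_(t in `[a, x]) g t) ->
  {ae mu, forall x, a < x < b -> derivable f x 1 /\ derive1 f x = g x}.
Proof.
move=> ig fg; pose h := g \_ `[a, b].
have ih : mu.-integrable setT (EFin \o h).
  by rewrite /h -restrict_EFin; apply/integrable_restrict => //=; rewrite setTI.
have lh : locally_integrable setT h by apply: open_integrable_locally => //; exact: openT.
have ihy y : mu.-integrable [set` Interval (BLeft a) (BRight y)] (EFin \o h).
  exact: integrableS ih.
have := FTC1 ihy lh; apply: ae_imp => x /= + /andP[ax xb].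
rewrite lte_fin => /(_ ax) dh.
have hx : h x = g x by rewrite /h patchE mem_set//= in_itv/= !ltW.
rewrite -hx; apply: (derive_shift (c := f a)) dh.
have := primitive_near (introT andP (conj ax xb)) fg.
have : \forall z \near x, z < b by exact: lt_nbhsl.
apply: filterS2 => z zb ->; congr (_ + _); apply: eq_Rintegral => t.
rewrite inE/= in_itv/= => /andP[at_ tz]; rewrite /h patchE mem_set//= in_itv/= at_.
by rewrite (le_trans tz)// ltW.
Qed.

(** Unlike [primitive_ae] this reaches each given point, as is needed for the derivatives of order
    below [n] of a limit in [Vn], which must exist everywhere. *)
Lemma primitive_continuous a b f g x : mu.-integrable `[a, b] (EFin \o g) ->
  (forall x, a <= x <= b -> f x - f a = \int[mu]_(t in `[a, x]) g t) ->
  a < x < b -> {for x, continuous g} -> derivable f x 1 /\ derive1 f x = g x.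
Proof.
move=> ig fg axb gx; have /andP[ax xb] := axb.
have := continuous_FTC1_closed xb ig ax gx.
by apply: (derive_shift (c := f a)); exact: primitive_near axb fg.
Qed.

(** The integral of [|g|] over a set is small when the measure of the set is. Open intervals are
    used because the closed ones may share endpoints. *)
Lemma primitive_abs_cont a b f g : mu.-integrable `[a, b] (EFin \o g) ->
  (forall x y, a <= x -> x <= y -> y <= b ->
     f y - f x = \int[mu]_(t in `[x, y]) g t) ->
  rabs_cont a b f.
Proof.
move=> ig fg e e0; pose h := g \_ `[a, b].
have ih : mu.-integrable setT (EFin \o h).
  by rewrite /h -restrict_EFin; apply/integrable_restrict => //=; rewrite setTI.
have [d [d0 dP]] := integral_normr_continuous ih e0.
exists d => // N u v uv dis uvd.
pose A (i : 'I_N) : set R := `]u i, v i[%classic.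
have mA i : measurable (A i) by exact: measurable_itv.
pose U := \big[setU/set0]_(i <- index_enum 'I_N) A i.
have tA : trivIset [set` index_enum 'I_N] A.
  apply/trivIsetP => i j _ _ ij; apply/seteqP; split => // x [] /=.
  rewrite /A /= !in_itv/= => /andP[ui vi] /andP[uj vj].
  by case: (dis i j ij) => ?; lra.
have mU : measurable U by apply: bigsetU_measurable.
have muU : (mu U < d%:E)%E.
  rewrite /U measure_semi_additive_ord//; last first.
    by move=> i j _ _; apply: tA => /=; rewrite mem_index_enum.
  apply: le_lt_trans (_ : (\sum_(i < N) (v i - u i))%:E < _)%E; last by rewrite lte_fin.
  rewrite -sumEFin; apply: lee_sum => i _.
  rewrite /A /= lebesgue_measure_itv /= lte_fin; case: ifP => //= _.
  by rewrite lee_fin subr_ge0; have [] := uv i.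
have := dP _ mU muU; apply: le_lt_trans.
have inorm : mu.-integrable U (EFin \o (fun x => `|h x|)).
  by apply: integrableS (integrable_norm ih).
have -> : \int[mu]_(x in U) `|h x| = \sum_(i < N) \int[mu]_(x in A i) `|h x|.
  rewrite /Rintegral integral_bigsetU_EFin//; last first.
  - by have /integrableP[] := inorm.
  - exact: index_enum_uniq.
  rewrite sum_fine// => i _; apply: integrable_fin_num; first exact: mA.
  by apply: integrableS (integrable_norm ih) => //; exact: mA.
apply: ler_sum => i _; have [au uvi vb] := uv i; rewrite fg//.
have sub : `[u i, v i]%classic `<=` `[a, b]%classic.
  by move=> x /=; rewrite !in_itv/= => /andP[h1 h2]; rewrite (le_trans au)//= (le_trans h2).
have iuv : mu.-integrable `[u i, v i] (EFin \o g) by exact: integrableS ig.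
apply: le_trans (le_normr_Rintegral _ iuv) _ => //.
have iuo : mu.-integrable `[u i, v i[ (EFin \o (fun t => `|g t|)).
  apply: integrable_sub_itv (integrable_norm iuv).
  by move=> t /=; rewrite !in_itv/= => /andP[h1 h2]; rewrite h1 ltW.
rewrite -(Rintegral_itv_bndo_bndc iuo) -Rintegral_itv_obnd_cbnd; last first.
  apply: integrable_sub_itv iuo.
  by move=> t /=; rewrite !in_itv/= => /andP[h1 h2]; rewrite ltW.
rewrite le_eqVlt; apply/orP; left; apply/eqP; apply: eq_Rintegral => x.
rewrite inE/= => xA; rewrite /h patchE mem_set//; apply: sub => /=.
by move: xA; rewrite !in_itv/= => /andP[h1 h2]; rewrite !ltW.
Qed.

Lemma rabs_cont_dist a b f : rabs_cont a b f -> forall e : R, 0 < e ->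
  exists2 d : R, 0 < d & forall x y, a <= x <= b -> a <= y <= b ->
    `|y - x| < d -> `|f y - f x| < e.
Proof.
move=> fac e e0; have [d d0 H] := rabs_cont_unif fac e0; exists d => // x y.
wlog xy : x y / x <= y => [hw xab yab d'|].
  have [xy|/ltW yx] := leP x y; first exact: hw.
  by rewrite distrC hw// distrC.
move=> /andP[ax xb] /andP[ay yb] xyd; apply: H => //.
by rewrite -(ger0_norm (_ : 0 <= y - x)) ?subr_ge0.
Qed.

Lemma rabs_cont_continuous a b f x : rabs_cont a b f -> a < x < b ->
  {for x, continuous f}.
Proof.
move=> fac /andP[ax xb]; apply/cvgrPdist_lt => e e0.
have [d d0 H] := rabs_cont_dist fac e0.
have := near_itv (introT andP (conj ax xb)).
apply: filterS2 (near_dist_lt x d0) => y yd ayb; rewrite distrC; apply: H => //.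
by rewrite !ltW.
Qed.

Let clamp a b x : R := Num.max a (Num.min x b).

Lemma rabs_cont_derive1_measurable a b f : a <= b -> rabs_cont a b f ->
  measurable_fun `]a, b[ (derive1 f).
Proof.
(* Extended by constants, [f] becomes continuous on the whole line without changing its derivative
   inside the interval. *)
move=> ab fac; pose F x := f (clamp a b x).
have clampab x : a <= clamp a b x <= b.
  by rewrite /clamp le_max lexx ge_max ab ge_min lexx orbT.
have clampd x y : `|clamp a b x - clamp a b y| <= `|x - y|.
  have h1 := ler_norm (x - y); have h2 := ler_norm (y - x).
  rewrite (distrC y x) in h2; have h3 := normr_ge0 (x - y).
  rewrite /clamp; case: (ltP x b) => xb; case: (ltP y b) => yb;
    case: (ltP a x) => ax; case: (ltP a y) => ay;
    rewrite ?(max_r ab) ?(max_r (ltW ax)) ?(max_l ax) ?(max_r (ltW ay)) ?(max_l ay);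
    rewrite ler_norml; apply/andP; split; lra.
have cF : continuous F.
  move=> x; apply/cvgrPdist_lt => e e0.
  have [d d0 H] := rabs_cont_dist fac e0.
  apply: filterS (near_dist_lt x d0) => y yd; rewrite distrC.
  by apply: H => //; apply: le_lt_trans (clampd _ _) _.
apply: (@eq_measurable_fun _ _ _ _ _ (derive1 F)); last first.
  by apply: measurable_funS (derive1_measurable cF).
move=> x; rewrite inE/= in_itv/= => /andP[ax xb].
rewrite !derive1E; apply: near_eq_derive.
have := near_itv (introT andP (conj ax xb)); apply: filterS => z /andP[az zb].
by rewrite /F /clamp min_l ?max_r.
Qed.

(** The density from [abs_cont_primitive] equals [derive1 f] almost everywhere; as [derive1 f] is
    measurable, it can take its place under the integral. *)
Lemma rabs_cont_FTC a b f : a < b -> rabs_cont a b f ->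
  [/\ mu.-integrable `]a, b[ (EFin \o derive1 f),
      forall x y, a <= x -> x <= y -> y <= b ->
        f y - f x = \int[mu]_(t in `]x, y[) derive1 f t &
      {ae mu, forall x, a < x < b -> derivable f x 1}].
Proof.
move=> ab fac; have [g ig fg] := abs_cont_primitive ab fac.
have ae := primitive_ae ig fg.
have md := rabs_cont_derive1_measurable (ltW ab) fac.
have igo : mu.-integrable `]a, b[ (EFin \o g).
  by apply: integrableS ig => //; exact: subset_itvW.
have aeE : {ae mu, forall x, `]a, b[%classic x -> g x = derive1 f x}.
  by apply: ae_imp ae => x h; rewrite /= in_itv/= => /h[_ ->].
split; [by apply: ae_integrable aeE igo| |by apply: ae_imp ae => x h /h[]].
move=> x y ax xy yb.
have sub : `]x, y[%classic `<=` `]a, b[%classic.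
  by move=> t /=; rewrite !in_itv/= => /andP[h1 h2]; rewrite (le_lt_trans ax)//= (lt_le_trans h2).
have subc : `[a, y]%classic `<=` `[a, b]%classic by exact: subset_itvl.
have -> : f y - f x = \int[mu]_(t in `]x, y[) g t.
  rewrite (_ : f y - f x = (f y - f a) - (f x - f a)); last by ring.
  rewrite !fg ?ax ?xy ?yb ?(le_trans ax) ?(le_trans xy)//.
  rewrite Rintegral_itvB//; last first.
    by apply: integrableS ig.
  rewrite -Rintegral_itv_bndo_bndc//; apply: integrableS igo => //.
have mg : measurable_fun `]a, b[ g by have /integrableP[/measurable_EFinP] := igo.
apply: ae_Rintegral => //; [exact: measurable_funS mg|exact: measurable_funS md|].
by apply: ae_imp aeE => t h /sub/h.
Qed.

End Primitive.

(** * Local absolute continuity on (-1,1) *)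

Section LocalAbsCont.
Variable R : realType.
Local Notation mu := (@lebesgue_measure R).
Local Notation I := (`]-1, 1[%classic : set R).
Implicit Types (f g : R -> R) (a b x y : R).

Section RealIntegrable.
Variables (D : set R) (mD : @measurable _ (measurableTypeR R) D).
Local Notation rint f := (mu.-integrable D (EFin \o f)).

Lemma rintD f g : rint f -> rint g -> rint (fun x => f x + g x).
Proof.
move=> jf jg; have := integrableD mD jf jg.
by apply: eq_integrable => // x _ /=; rewrite EFinD.
Qed.

Lemma rintB f g : rint f -> rint g -> rint (fun x => f x - g x).
Proof.
move=> jf jg; have := integrableB mD jf jg.
by apply: eq_integrable => // x _ /=; rewrite EFinB.
Qed.

Lemma rintZ c f : rint f -> rint (fun x => c * f x).
Proof.
move=> jf; have := integrableZl mD c jf.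
by apply: eq_integrable => // x _ /=; rewrite EFinM.
Qed.

Lemma rint_abs f : rint f -> rint (fun x => `|f x|).
Proof. exact: integrable_norm. Qed.

Lemma rint_le f g : measurable_fun D f -> (forall x, D x -> `|f x| <= g x) ->
  rint g -> rint f.
Proof.
move=> mf fg; apply: le_integrable => //; first exact/measurable_EFinP.
move=> x Dx /=; rewrite lee_fin (le_trans (fg x Dx))// ler_norm//.
Qed.

Lemma rint_measurable f : rint f -> measurable_fun D f.
Proof. by move=> /integrableP[/measurable_EFinP]. Qed.

Lemma le_Rint_sub f (E : set R) : @measurable _ (measurableTypeR R) E ->
  E `<=` D -> rint f -> (forall x, D x -> 0 <= f x) ->
  \int[mu]_(x in E) f x <= \int[mu]_(x in D) f x.
Proof.
move=> mE ED jf f0; rewrite /Rintegral fine_le//.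
- by apply: integrable_fin_num => //; exact: integrableS jf.
- exact: integrable_fin_num.
- by apply: ge0_subset_integral => //; have /integrableP[] := jf.
Qed.

End RealIntegrable.

Lemma rint_cst_itv a b (c : R) : mu.-integrable `[a, b] (EFin \o cst c).
Proof.
apply: measurable_bounded_integrable => //; last exact: bounded_cst.
by rewrite /= lebesgue_measure_itv /=; case: ifP => _; rewrite -?EFinB ltry.
Qed.

Lemma Rint_cst_itv a b (c : R) : a <= b -> \int[mu]_(x in `[a, b]) c = c * (b - a).
Proof.
move=> ab; rewrite Rintegral_cst//= lebesgue_measure_itv /= lte_fin.
by case: ltP ab => [//|ba ab]; rewrite (@le_anti _ _ a b) ?ab// subrr mulr0.
Qed.

Definition rAC f : Prop :=
  forall a b, -1 < a -> a <= b -> b < 1 -> rabs_cont a b f.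

Lemma inI x : I x = (-1 < x < 1).
Proof. by rewrite /= in_itv. Qed.

Lemma measI : @measurable _ (measurableTypeR R) I.
Proof. exact: measurable_itv. Qed.

(** Endpoint of an exhaustion of (-1,1) by symmetric intervals; the shift by 2 makes [exh 0] equal
    to 1/2 and so positive. *)
Definition exh n : R := 1 - n.+2%:R^-1.

Lemma exh_gt0 n : 0 < exh n.
Proof. by rewrite subr_gt0 invf_lt1 ?ltr0n// ltr1n. Qed.

Lemma exh_lt1 n : exh n < 1.
Proof. by rewrite ltrBlDr ltrDl invr_gt0 ltr0n. Qed.

Lemma exh_mem x : I x -> exists n, - exh n < x < exh n.
Proof.
rewrite inI => /andP[x1 x2].
have [k k1] : exists k : nat, k.+1%:R^-1 < 1 - `|x|.
  by apply: invS_lt; rewrite subr_gt0 ltr_norml x1.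
exists k; rewrite -ltr_norml /exh ltrBrDr -ltrBrDl (le_lt_trans _ k1)//.
by rewrite lef_pV2 ?posrE ?ltr0n// ler_nat.
Qed.

Lemma I_bigcup : I = \bigcup_n `] - exh n, exh n[%classic.
Proof.
apply/seteqP; split => x; first by move=> /exh_mem[n nx]; exists n => //=; rewrite in_itv.
move=> [n _] /=; rewrite !in_itv/= => /andP[h1 h2].
by rewrite (lt_trans _ h1) ?(lt_trans h2)// ?exh_lt1// ltrN2 exh_lt1.
Qed.

Lemma ae_I (P : R -> Prop) :
  (forall a b, -1 < a -> a < b -> b < 1 -> {ae mu, forall x, a < x < b -> P x}) ->
  {ae mu, forall x, I x -> P x}.
Proof.
move=> H; have Hn n : {ae mu, forall x, - exh n < x < exh n -> P x}.
  have := exh_gt0 n; have := exh_lt1 n => h1 h2; apply: H => //; lra.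
have := ae_foralln Hn; apply: ae_imp => x h /exh_mem[n]; exact: h.
Qed.

Lemma rAC_continuous f x : rAC f -> I x -> {for x, continuous f}.
Proof.
move=> fac /exh_mem[n nx]; apply: rabs_cont_continuous nx.
by have := exh_gt0 n; have := exh_lt1 n => h1 h2; apply: fac => //; lra.
Qed.

Lemma continuous_measurable_I f : (forall x, I x -> {for x, continuous f}) ->
  measurable_fun I f.
Proof.
move=> cf; apply: open_continuous_measurable_fun; first exact: interval_open.
by move=> x; rewrite inE => /cf.
Qed.

Lemma rAC_measurable f : rAC f -> measurable_fun I f.
Proof. by move=> fac; apply: continuous_measurable_I => x; exact: rAC_continuous. Qed.

Lemma rAC_derive1_measurable f : rAC f -> measurable_fun I (derive1 f).
Proof.
move=> fac; rewrite I_bigcup; apply/measurable_fun_bigcup => n.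
  exact: measurable_itv.
have := exh_gt0 n; have := exh_lt1 n => h1 h2.
by apply: rabs_cont_derive1_measurable; [lra|apply: fac; lra].
Qed.

Lemma rAC_ae_derivable f : rAC f -> {ae mu, forall x, I x -> derivable f x 1}.
Proof.
move=> fac; apply: ae_I => a b a1 ab b1.
by have [] := rabs_cont_FTC ab (fac a b a1 (ltW ab) b1).
Qed.

Lemma rAC_FTC f a b : rAC f -> -1 < a -> a <= b -> b < 1 ->
  mu.-integrable `[a, b] (EFin \o derive1 f) /\
  f b - f a = \int[mu]_(t in `[a, b]) derive1 f t.
Proof.
(* The larger interval is nondegenerate even when [a = b], and its interior contains the closed
   interval [[a, b]]. *)
move=> fac a1 ab b1; pose a' := (a - 1) / 2; pose b' := (b + 1) / 2.
have ha : -1 < a' < a by apply/andP; split; rewrite /a'; lra.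
have hb : b < b' < 1 by apply/andP; split; rewrite /b'; lra.
have [/andP[ha1 ha2] /andP[hb1 hb2]] := (ha, hb).
have ab' : a' < b' by lra.
have [i1 i2 _] := rabs_cont_FTC ab' (fac _ _ ha1 (ltW ab') hb2).
have i3 : mu.-integrable `[a, b] (EFin \o derive1 f).
  apply: integrable_sub_itv i1 => t /=; rewrite !in_itv/= => /andP[h1 h2].
  by rewrite (lt_le_trans ha2)// (le_lt_trans h2).
split => //; rewrite (i2 a b (ltW ha2) ab (ltW hb1)).
have sub1 : mu.-integrable `[a, b[ (EFin \o derive1 f).
  by apply: integrable_sub_itv i3 => t /=; rewrite !in_itv/= => /andP[-> /ltW].
rewrite -(Rintegral_itv_bndo_bndc sub1) -Rintegral_itv_obnd_cbnd//.
by apply: integrable_sub_itv sub1 => t /=; rewrite !in_itv/= => /andP[/ltW -> ->].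
Qed.

Lemma primitive_rAC f g :
  (forall a b, -1 < a -> a <= b -> b < 1 -> mu.-integrable `[a, b] (EFin \o g) /\
     f b - f a = \int[mu]_(t in `[a, b]) g t) -> rAC f.
Proof.
move=> fg a b a1 ab b1; apply: (@primitive_abs_cont _ a b f g); first by have [] := fg a b a1 ab b1.
by move=> x y ax xy yb; have [|||//] := fg x y; [exact: lt_le_trans ax|by []|exact: le_lt_trans b1].
Qed.

Lemma primitive_I_ae f g :
  (forall a b, -1 < a -> a <= b -> b < 1 -> mu.-integrable `[a, b] (EFin \o g) /\
     f b - f a = \int[mu]_(t in `[a, b]) g t) ->
  {ae mu, forall x, I x -> derivable f x 1 /\ derive1 f x = g x}.
Proof.
move=> fg; apply: ae_I => a b a1 ab b1; apply: primitive_ae.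
  by have [] := fg a b a1 (ltW ab) b1.
by move=> x /andP[ax xb]; have [] := fg a x a1 ax (le_lt_trans xb b1).
Qed.

Lemma primitive_I_continuous f g x :
  (forall a b, -1 < a -> a <= b -> b < 1 -> mu.-integrable `[a, b] (EFin \o g) /\
     f b - f a = \int[mu]_(t in `[a, b]) g t) ->
  I x -> {for x, continuous g} -> derivable f x 1 /\ derive1 f x = g x.
Proof.
move=> fg /exh_mem[n nx]; have := exh_gt0 n; have := exh_lt1 n => h1 h2.
apply: primitive_continuous nx.
  by apply: (fg (- exh n) (exh n) _ _ _).1; lra.
by move=> y /andP[ay yb]; apply: (fg (- exh n) y _ _ _).2; lra.
Qed.

(** A one-dimensional Sobolev inequality: integrate [|d y| <= |d t| + K] over [t], where [K] is the
    integral of [|e|]. It turns L^1 convergence of functions and of derivatives into uniform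
    convergence. *)
Lemma pointwise_le_L1 a b d e y : a < b -> a <= y <= b ->
  mu.-integrable `[a, b] (EFin \o d) -> mu.-integrable `[a, b] (EFin \o e) ->
  (forall x y, a <= x -> x <= y -> y <= b ->
     d y - d x = \int[mu]_(t in `[x, y]) e t) ->
  (b - a) * `|d y| <= \int[mu]_(t in `[a, b]) `|d t|
                      + (b - a) * \int[mu]_(t in `[a, b]) `|e t|.
Proof.
move=> ab yab jd je de; set K := \int[mu]_(t in `[a, b]) `|e t|.
have mab : @measurable _ (measurableTypeR R) `[a, b]%classic by exact: measurable_itv.
have dist x z : a <= x -> x <= z -> z <= b -> `|d z - d x| <= K.
  move=> ax xz zb; rewrite de//.
  have sub : `[x, z]%classic `<=` `[a, b]%classic.
    by move=> t /=; rewrite !in_itv/= => /andP[h1 h2]; rewrite (le_trans ax)//= (le_trans h2).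
  have ixz := integrable_sub_itv sub je.
  apply: le_trans (le_normr_Rintegral _ ixz) _ => //.
  by apply: le_Rint_sub => //; exact: rint_abs.
have pt t : `[a, b]%classic t -> `|d y| <= `|d t| + K.
  rewrite /= in_itv/= => /andP[at_ tb]; have /andP[ay yb] := yab.
  rewrite -lerBlDl (le_trans (lerB_dist _ _))//.
  have [yt|/ltW ty] := leP y t; last exact: dist.
  by rewrite distrC dist.
have jK := rint_cst_itv a b K; have ja := rint_abs jd.
have := le_Rintegral mab (rint_cst_itv a b `|d y|) (rintD mab ja jK) pt.
rewrite RintegralD// !(Rint_cst_itv _ (ltW ab)).
move=> h; rewrite [leLHS]mulrC [in leRHS](mulrC (b - a)).
exact: h.
Qed.

End LocalAbsCont.

(** * Closedness of differentiation under local L^1 convergence *)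

Section ClosedDerivative.
Variable R : realType.
Local Notation mu := (@lebesgue_measure R).
Local Notation I := (`]-1, 1[%classic : set R).
Implicit Types (f g h : R -> R) (u : nat -> R -> R) (a b x y : R).

Let mitv (i : interval R) : @measurable _ (measurableTypeR R) [set` i].
Proof. exact: measurable_itv. Qed.

(** L^1 convergence on compact subintervals, a notion common to all weights and therefore to all
    orders of derivatives. *)
Definition lcv u g : Prop := forall a b, -1 < a -> a < b -> b < 1 ->
  mu.-integrable `[a, b] (EFin \o g) /\
  forall e : R, 0 < e -> exists N, forall n, (N <= n)%N ->
    mu.-integrable `[a, b] (EFin \o u n) /\
    \int[mu]_(t in `[a, b]) `|u n t - g t| <= e.

Lemma lcv_cauchy u g a b e : lcv u g -> -1 < a -> a < b -> b < 1 -> 0 < e ->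
  exists N, forall m n, (N <= m)%N -> (N <= n)%N ->
    mu.-integrable `[a, b] (EFin \o (fun t => u m t - u n t)) /\
    \int[mu]_(t in `[a, b]) `|u m t - u n t| <= e.
Proof.
move=> ug a1 ab b1 e0; have [ig H] := ug a b a1 ab b1.
have e20 : 0 < e / 2 by rewrite divr_gt0.
have [N NP] := H _ e20; exists N => m n Nm Nn.
have [im dm] := NP m Nm; have [jn dn] := NP n Nn.
have mI := mitv `[a, b].
split; first exact: rintB.
apply: (@le_trans _ _ (\int[mu]_(t in `[a, b]) (`|u m t - g t| + `|u n t - g t|))).
  apply: le_Rintegral => //.
  - exact: rint_abs (rintB mI im jn).
  - exact: rintD (rint_abs (rintB _ im ig)) (rint_abs (rintB _ jn ig)).
  - move=> t _; rewrite (_ : u m t - u n t = (u m t - g t) - (u n t - g t)); last by ring.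
    exact: ler_normB.
rewrite RintegralD//; [lra|exact: rint_abs (rintB _ im ig)|exact: rint_abs (rintB _ jn ig)].
Qed.

Lemma lcv_Rintegral u g a b e : lcv u g -> -1 < a -> a < b -> b < 1 -> 0 < e ->
  exists N, forall n, (N <= n)%N -> forall x y, a <= x -> x <= y -> y <= b ->
    `|\int[mu]_(t in `[x, y]) u n t - \int[mu]_(t in `[x, y]) g t| <= e.
Proof.
move=> ug a1 ab b1 e0; have [ig H] := ug a b a1 ab b1.
have [N NP] := H _ e0; exists N => n Nn x y ax xy yb.
have [jn dn] := NP n Nn.
have sub : `[x, y]%classic `<=` `[a, b]%classic.
  by move=> t /=; rewrite !in_itv/= => /andP[h1 h2]; rewrite (le_trans ax)//= (le_trans h2).
have jxy := integrable_sub_itv sub jn; have gxy := integrable_sub_itv sub ig.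
rewrite -RintegralB//; apply: le_trans dn.
apply: le_trans (le_normr_Rintegral _ (rintB (mitv _) jxy gxy)) _ => //.
by apply: le_Rint_sub => //; exact: rint_abs (rintB _ jn ig).
Qed.

(** By [pointwise_le_L1] the functions [u n] are uniformly Cauchy on compact subintervals. Their
    limit [G] inherits the integral formula with density [h] and agrees with the L^1 limit [g]
    almost everywhere. *)
Lemma closed_derivative u g h :
  (forall n, rAC (u n)) -> lcv u g -> lcv (fun n => derive1 (u n)) h ->
  exists G, (forall a b, -1 < a -> a <= b -> b < 1 ->
    mu.-integrable `[a, b] (EFin \o h) /\ G b - G a = \int[mu]_(t in `[a, b]) h t) /\
  {ae mu, forall x, I x -> G x = g x}.
Proof.
move=> uac ug uh.
have unif a b e : -1 < a -> a < b -> b < 1 -> 0 < e -> exists N, forall m n,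
    (N <= m)%N -> (N <= n)%N -> forall y, a <= y <= b -> `|u m y - u n y| <= e.
  move=> a1 ab b1 e0; have ba : 0 < b - a by lra.
  have e20 : 0 < e / 2 by rewrite divr_gt0.
  have e3 : 0 < (b - a) * (e / 2) by rewrite mulr_gt0.
  have [N1 H1] := lcv_cauchy ug a1 ab b1 e3.
  have [N2 H2] := lcv_cauchy uh a1 ab b1 e20.
  exists (maxn N1 N2) => m n; rewrite !geq_max => /andP[m1 m2] /andP[n1 n2] y yab.
  have [i1 d1] := H1 m n m1 n1; have [i2 d2] := H2 m n m2 n2.
  rewrite -(@ler_pM2l _ (b - a))//.
  apply: le_trans (pointwise_le_L1 ab yab i1 i2 _) _.
    move=> x z ax xz zb.
    have hx : -1 < x by lra.
    have hz : z < 1 by lra.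
    have [j1 e1] := rAC_FTC (uac m) hx xz hz.
    have [j2 e2] := rAC_FTC (uac n) hx xz hz.
    by rewrite RintegralB// -e1 -e2; ring.
  by rewrite [e in leRHS]splitr mulrDr lerD// ler_pM2l.
have cvu y : I y -> cvgn (u ^~ y).
  move=> /exh_mem[k ky]; have k0 := exh_gt0 R k; have k1 := exh_lt1 R k.
  apply: cauchy_cvg; apply: cauchy_exP => e e0.
  have [N NP] : exists N, forall m n, (N <= m)%N -> (N <= n)%N ->
      forall z, - exh R k <= z <= exh R k -> `|u m z - u n z| <= e / 2.
    by apply: unif; rewrite ?divr_gt0//; lra.
  exists (u N y); exists N => // n /= Nn.
  rewrite /ball /=; apply: le_lt_trans (NP N n (leqnn _) Nn y _) _; last by lra.
  by move: ky => /andP[? ?]; rewrite !ltW.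
pose G y := limn (u ^~ y).
have unifG a b e : -1 < a -> a < b -> b < 1 -> 0 < e -> exists N, forall n,
    (N <= n)%N -> forall y, a <= y <= b -> `|u n y - G y| <= e.
  move=> a1 ab b1 e0; have [N NP] := unif a b e a1 ab b1 e0; exists N => n Nn y yab.
  have yI : I y by rewrite inI; lra.
  apply/ler_addgt0Pr => d d0.
  have /cvgrPdist_lt/(_ _ d0)[M _ MP] := cvu y yI.
  have := MP (maxn M N) (leq_maxl _ _); have := NP n (maxn M N) Nn (leq_maxr _ _) y yab.
  rewrite -/(G y) => h1 h2.
  rewrite (_ : u n y - G y = (u n y - u (maxn M N) y) - (G y - u (maxn M N) y)); last by ring.
  by rewrite (le_trans (ler_normB _ _))// lerD// ltW.
exists G; split.
  move=> a b a1 ab b1.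
  pose a' := (a - 1) / 2; pose b' := (b + 1) / 2.
  have a'1 : -1 < a' by rewrite /a'; lra.
  have b'1 : b' < 1 by rewrite /b'; lra.
  have ab' : a' < b' by rewrite /a' /b'; lra.
  have aa' : a' <= a by rewrite /a'; lra.
  have bb' : b <= b' by rewrite /b'; lra.
  have [ih _] := uh a' b' a'1 ab' b'1.
  split.
    apply: integrable_sub_itv ih => t /=; rewrite !in_itv/= => /andP[h1 h2].
    by rewrite (le_trans aa')//= (le_trans h2).
  apply/eqP; rewrite -subr_eq0 -normr_le0; apply/ler_addgt0Pr => e e0; rewrite add0r.
  have e30 : 0 < e / 3 by rewrite divr_gt0.
  have [N1 H1] := unifG a' b' (e / 3) a'1 ab' b'1 e30.
  have [N2 H2] := lcv_Rintegral uh a'1 ab' b'1 e30.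
  pose n := maxn N1 N2.
  have [_ ftc] := rAC_FTC (uac n) a1 ab b1.
  have h1 : `|u n a - G a| <= e / 3 by apply: H1; rewrite ?leq_maxl//; lra.
  have h2 : `|u n b - G b| <= e / 3 by apply: H1; rewrite ?leq_maxl//; lra.
  have := H2 n (leq_maxr _ _) a b aa' ab bb'; rewrite -ftc => h3.
  move: h1 h2 h3; set J := \int[mu]_(_ in _) _ => h1 h2 h3.
  rewrite (_ : G b - G a - J = (u n b - u n a - J) - (u n b - G b) + (u n a - G a)); last by ring.
  rewrite (le_trans (ler_normD _ _))// (le_trans (lerD (ler_normB _ _) (lexx _)))//.
  lra.
have mG : measurable_fun I G.
  apply: (@measurable_fun_cvg _ _ _ _ u); first by move=> n; exact: rAC_measurable.
  by move=> y yI; exact: cvu.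
apply: ae_I => a b a1 ab b1.
have mab := mitv `[a, b]; have ba : 0 < b - a by lra.
have [ig H] := ug a b a1 ab b1.
have mGab : measurable_fun `[a, b] G.
  by apply: measurable_funS mG => // t; rewrite inI /= in_itv/= => /andP[? ?]; lra.
have iG : mu.-integrable `[a, b] (EFin \o G).
  have [N1 H1] := unifG a b 1 a1 ab b1 ltr01; have [N2 H2] := H 1 ltr01.
  have [jn _] := H2 (maxn N1 N2) (leq_maxr _ _).
  apply: (rint_le mab mGab _ (rintD mab (rint_abs jn) (rint_cst_itv a b 1))).
  move=> t /=; rewrite in_itv/= => tab.
  have := H1 (maxn N1 N2) (leq_maxl _ _) t tab; rewrite /cst => h1.
  by rewrite -lerBlDl (le_trans (lerB_dist _ _))// distrC.
have z : \int[mu]_(t in `[a, b]) `|G t - g t| <= 0.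
  apply/ler_addgt0Pr => e e0; rewrite add0r.
  have e20 : 0 < e / 2 by rewrite divr_gt0.
  have e30 : 0 < e / 2 / (b - a) by rewrite divr_gt0.
  have [N1 H1] := unifG a b _ a1 ab b1 e30; have [N2 H2] := H _ e20.
  have [jn dn] := H2 (maxn N1 N2) (leq_maxr _ _).
  have jd := rint_abs (rintB mab jn ig).
  apply: (@le_trans _ _ (\int[mu]_(t in `[a, b]) (e / 2 / (b - a) + `|u (maxn N1 N2) t - g t|))).
    apply: (le_Rintegral mab (rint_abs (rintB mab iG ig)) (rintD mab (rint_cst_itv a b (e / 2 / (b - a))) jd)).
    move=> t /=; rewrite in_itv/= => tab.
    have := H1 (maxn N1 N2) (leq_maxl _ _) t tab => h1.
    rewrite (_ : G t - g t = (u (maxn N1 N2) t - g t) - (u (maxn N1 N2) t - G t)); last by ring.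
    by rewrite (le_trans (ler_normB _ _))// addrC lerD.
  rewrite RintegralD//; last exact: rint_cst_itv.
  rewrite (Rint_cst_itv _ (ltW ab)) divfK ?lt0r_neq0//.
  by rewrite [leRHS]splitr lerD.
have jz := rint_abs (rintB mab iG ig).
have z0 : (\int[mu]_(t in `[a, b]) `|(G t - g t)%:E| = 0)%E.
  have e0 : 0 <= \int[mu]_(t in `[a, b]) `|G t - g t| by apply: Rintegral_ge0.
  have : \int[mu]_(t in `[a, b]) `|G t - g t| = 0 by apply/eqP; rewrite eq_le z.
  rewrite /Rintegral => /eqP; rewrite fine_eq0; last exact: integrable_fin_num.
  by move=> /eqP.
have mf : measurable_fun `[a, b] (fun t => (G t - g t)%:E).
  by apply/measurable_EFinP; exact: rint_measurable (rintB mab iG ig).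
have := (ae_eq_integral_abs mu mab mf).1 z0.
apply: ae_imp => x /= hx xab; apply/eqP; rewrite -subr_eq0; apply/eqP.
have : (G x - g x)%:E = 0%:E by apply: hx; rewrite in_itv/=; lra.
by move=> [].
Qed.

End ClosedDerivative.

(** * Weighted spaces on (-1,1) *)

Section WeightedSpaces.
Variable R : realType.
Local Notation mu := (@lebesgue_measure R).
Local Notation I := (`]-1, 1[%classic : set R).
Local Notation rint f := (mu.-integrable I (EFin \o f)).
Implicit Types (f g h : R -> R) (w : int) (a b x y : R).

Let mI : @measurable _ (measurableTypeR R) I := @measI R.

Lemma one_sub_sqr_gt0 x : I x -> 0 < 1 - x ^+ 2.
Proof. by rewrite inI => /andP[? ?]; nra. Qed.

Lemma weight_gt0 w x : I x -> 0 < weight w x.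
Proof. by move=> Ix; rewrite /weight exprz_gt0// one_sub_sqr_gt0. Qed.

Lemma weight_continuous w x : I x -> {for x, continuous (weight w)}.
Proof.
move=> Ix; have c1 : {for x, continuous (fun y : R => 1 - y ^+ 2)}.
  by apply: cvgB; [exact: cvg_cst|exact: exprn_continuous].
have cX n : {for x, continuous (fun y : R => (1 - y ^+ 2) ^+ n)}.
  apply: (@continuous_comp _ _ _ (fun y : R => 1 - y ^+ 2) (fun y => y ^+ n)) => //.
  exact: exprn_continuous.
case: w => n; first exact: cX.
by apply: cvgV (cX n.+1); rewrite expf_neq0// lt0r_neq0// one_sub_sqr_gt0.
Qed.

Lemma weight_measurable w : measurable_fun I (weight w : R -> R).
Proof. by apply: continuous_measurable_I => x; exact: weight_continuous. Qed.

Lemma weightD w1 w2 x : I x -> weight (w1 + w2) x = weight w1 x * weight w2 x.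
Proof. by move=> Ix; rewrite /weight expfzDr// lt0r_neq0// one_sub_sqr_gt0. Qed.

Lemma weight1 x : weight 1 x = 1 - x ^+ 2.
Proof. by []. Qed.

Lemma weight_lb w a b : -1 < a -> a <= b -> b < 1 ->
  exists2 m : R, 0 < m & forall x, a <= x <= b -> m <= weight w x.
Proof.
move=> a1 ab b1; have sub x : x \in `[a, b] -> I x.
  by rewrite in_itv inI /= => /andP[? ?]; apply/andP; split; lra.
have cw : {within `[a, b], continuous (weight w : R -> R)}.
  apply: continuous_in_subspaceT => x; rewrite inE => xab.
  by apply: weight_continuous; exact: sub.
have [c cab cmin] := EVT_min ab cw.
exists (weight w c); first by apply: weight_gt0; exact: sub.
by move=> x xab; apply: cmin; rewrite in_itv.
Qed.

Definition lcomb a f g : R -> R := fun x => a * f x + g x.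

Lemma measurable_lcomb (D : set R) a f g : measurable_fun D f -> measurable_fun D g ->
  measurable_fun D (lcomb a f g).
Proof. by move=> mf mg; apply: measurable_funD => //; exact: measurable_funM. Qed.

Definition rL2 w f : Prop :=
  measurable_fun I f /\ rint (fun x => f x ^+ 2 * weight w x).

Definition rip w f g : R := \int[mu]_(x in I) (f x * g x * weight w x).

Lemma rL2_prod w f g : rL2 w f -> rL2 w g -> rint (fun x => f x * g x * weight w x).
Proof.
move=> [mf f2] [mg g2].
apply: (rint_le mI _ _ (rintD mI f2 g2)).
  by apply: measurable_funM; [exact: measurable_funM|exact: weight_measurable].
move=> x Ix; have w0 := weight_gt0 w Ix.
rewrite normrM (gtr0_norm w0) -mulrDl ler_pM2r// ler_norml.
by apply/andP; split; nra.
Qed.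

Lemma rL2_cross_measurable w f g : measurable_fun I f -> measurable_fun I g ->
  measurable_fun I (fun x => f x * g x * weight w x).
Proof.
by move=> mf mg; apply: measurable_funM; [exact: measurable_funM|exact: weight_measurable].
Qed.

Lemma rip_ae w f f' g g' :
  measurable_fun I f -> measurable_fun I g ->
  measurable_fun I f' -> measurable_fun I g' ->
  {ae mu, forall x, I x -> f x = f' x} -> {ae mu, forall x, I x -> g x = g' x} ->
  rip w f g = rip w f' g'.
Proof.
move=> mf mg mf' mg' ff gg; apply: ae_Rintegral => //; try exact: rL2_cross_measurable.
by apply: ae_imp2 ff gg => x h1 h2 Ix; rewrite h1// h2.
Qed.

Lemma rL2_ae w f f' : rL2 w f -> measurable_fun I f' ->
  {ae mu, forall x, I x -> f x = f' x} -> rL2 w f'.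
Proof.
move=> [mf f2] mf' ff; split => //.
apply: ae_integrable f2 => //.
  by apply: measurable_funM; [exact: measurable_funX|exact: weight_measurable].
by apply: ae_imp ff => x h Ix; rewrite h.
Qed.

Lemma rL2_0 w : rL2 w (fun=> 0).
Proof.
split; first exact: measurable_cst.
apply: eq_integrable (integrable0 mu I) => // x _ /=.
by rewrite expr0n mul0r.
Qed.

Lemma rL2_lcomb w a f g : rL2 w f -> rL2 w g -> rL2 w (lcomb a f g).
Proof.
move=> lf lg; have jfg := rL2_prod lf lg; have [[mf f2] [mg g2]] := (lf, lg).
split; first exact: measurable_lcomb.
have := rintD mI (rintZ mI (a ^+ 2) f2) (rintD mI (rintZ mI (a *+ 2) jfg) g2).
by apply: eq_integrable => // x _ /=; congr EFin; rewrite /lcomb; ring.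
Qed.

Lemma rip_lcomb w a f g h : rL2 w f -> rL2 w g -> rL2 w h ->
  rip w (lcomb a f g) h = a * rip w f h + rip w g h.
Proof.
move=> lf lg lh; have jfh := rL2_prod lf lh; have jgh := rL2_prod lg lh.
rewrite /rip -RintegralZl// -RintegralD//; last exact: rintZ.
by apply: eq_Rintegral => x _; rewrite /lcomb; ring.
Qed.

Lemma rip_sym w f g : rip w f g = rip w g f.
Proof. by apply: eq_Rintegral => x _; rewrite (mulrC (f x)). Qed.

Lemma rip_ge0 w f : 0 <= rip w f f.
Proof.
apply: Rintegral_ge0 => x Ix; rewrite -expr2 mulr_ge0 ?sqr_ge0//.
by rewrite ltW// weight_gt0.
Qed.

Lemma rip_eq0_ae w f : rL2 w f -> rip w f f = 0 -> {ae mu, forall x, I x -> f x = 0}.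
Proof.
move=> lf f0; have jff := rL2_prod lf lf.
have z0 : (\int[mu]_(x in I) `|(f x * f x * weight w x)%:E| = 0)%E.
  transitivity (\int[mu]_(x in I) (f x * f x * weight w x)%:E)%E.
    apply: eq_integral => x; rewrite inE => Ix /=; rewrite ger0_norm//.
    by rewrite -expr2 mulr_ge0 ?sqr_ge0// ltW// weight_gt0.
  apply/eqP; rewrite -fine_eq0; last exact: integrable_fin_num jff.
  by apply/eqP.
have mf : measurable_fun I (fun x => (f x * f x * weight w x)%:E).
  by apply/measurable_EFinP; exact: rint_measurable jff.
have := (ae_eq_integral_abs mu mI mf).1 z0.
apply: ae_imp => x /= hx Ix.
have : (f x * f x * weight w x)%:E = 0%:E by exact: hx.
by move=> [] /eqP; rewrite !mulf_eq0 orbb (gt_eqF (weight_gt0 w Ix)) orbF => /eqP.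
Qed.

Lemma rL2_rint_itv w f a b : rL2 w f -> -1 < a -> a <= b -> b < 1 ->
  mu.-integrable `[a, b] (EFin \o f).
Proof.
move=> [mf f2] a1 ab b1.
have sub : `[a, b]%classic `<=` I.
  by move=> t; rewrite inI /= in_itv/= => /andP[? ?]; apply/andP; split; lra.
have [m m0 mP] := weight_lb w a1 ab b1.
have mab : @measurable _ (measurableTypeR R) `[a, b]%classic by exact: measurable_itv.
have j2 : mu.-integrable `[a, b] (EFin \o (fun x => f x ^+ 2 * weight w x)).
  exact: integrable_sub_itv sub f2.
apply: (rint_le mab _ _ (rintD mab (rint_cst_itv a b 1) (rintZ mab m^-1 j2))).
  exact: measurable_funS sub mf.
move=> x /=; rewrite in_itv/= => xab; rewrite /cst.
have h : f x ^+ 2 <= m^-1 * (f x ^+ 2 * weight w x).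
  rewrite mulrCA ler_peMr ?sqr_ge0// ler_pdivlMl// mulr1; exact: mP.
by apply: le_trans (lerD (lexx _) h); rewrite ler_norml; apply/andP; split; nra.
Qed.

(** On [[a, b]] the weight is at least some [m > 0], and [|D| <= eta + D^2 / (4 eta)] bounds the L^1
    norm by a weighted square. The choice of [eta] spends [e / 2] on the constant, and [c] merges
    [1 / (4 eta)] with [1 / m]. *)
Lemma rL2_lcv w u g : (forall n, rL2 w (u n)) -> rL2 w g ->
  (forall e : R, 0 < e -> exists N, forall n, (N <= n)%N ->
     rip w (lcomb (-1) g (u n)) (lcomb (-1) g (u n)) <= e) -> lcv u g.
Proof.
move=> lu lg ug a b a1 ab b1; split; first by apply: rL2_rint_itv lg _ _ _ => //; exact: ltW.
move=> e e0; have [m m0 mP] := weight_lb w a1 (ltW ab) b1.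
have ba : 0 < b - a by lra.
pose eta := e / (2 * (b - a)); have eta0 : 0 < eta by rewrite divr_gt0// mulr_gt0.
have etaE : eta = e / (2 * (b - a)) by []; clearbody eta.
pose c := (4 * eta * m)^-1; have c0 : 0 < c.
  by rewrite invr_gt0; apply: mulr_gt0 => //; exact: mulr_gt0.
have cE : c = (4 * eta * m)^-1 by []; clearbody c.
have e2c : 0 < e / (2 * c) by apply: divr_gt0 => //; exact: mulr_gt0.
have [N NP] := ug _ e2c.
exists N => n Nn; have jn := rL2_rint_itv (lu n) a1 (ltW ab) b1.
split => //; have {NP}NP := NP n Nn.
have ld := rL2_lcomb (-1) lg (lu n); have jd := rL2_prod ld ld.
have mab : @measurable _ (measurableTypeR R) `[a, b]%classic by exact: measurable_itv.
have sub : `[a, b]%classic `<=` I.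
  by move=> t; rewrite inI /= in_itv/= => /andP[? ?]; apply/andP; split; lra.
set D := lcomb (-1) g (u n) in NP ld jd.
have jd' : mu.-integrable `[a, b] (EFin \o (fun x => D x * D x * weight w x)).
  exact: integrable_sub_itv sub jd.
have jD := rL2_rint_itv ld a1 (ltW ab) b1.
apply: (@le_trans _ _ (\int[mu]_(t in `[a, b]) (eta + c * (D t * D t * weight w t)))).
  have -> : \int[mu]_(t in `[a, b]) `|u n t - g t| = \int[mu]_(t in `[a, b]) `|D t|.
    by apply: eq_Rintegral => t _; rewrite /D /lcomb; congr `|_|; ring.
  apply: (le_Rintegral mab (rint_abs jD) (rintD mab (rint_cst_itv a b eta) (rintZ mab c jd'))).
  move=> t /=; rewrite in_itv/= => tab; rewrite /cst.
  have wt := mP t tab.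
  have h : (4 * eta)^-1 * (D t * D t) <= c * (D t * D t * weight w t).
    have -> : c * (D t * D t * weight w t) = (4 * eta)^-1 * (m^-1 * (D t * D t * weight w t)).
      by rewrite cE invfM mulrA.
    apply: ler_wpM2l; first by rewrite invr_ge0 mulr_ge0// ltW.
    by rewrite mulrCA ler_peMr -?expr2 ?sqr_ge0// ler_pdivlMl// mulr1.
  apply: le_trans (lerD (lexx _) h).
  rewrite -(@ler_pM2l _ (4 * eta)) ?mulr_gt0// mulrDr mulVKf ?gt_eqF ?mulr_gt0//.
  have -> : D t * D t = `|D t| ^+ 2 by rewrite real_normK ?num_real.
  by have := sqr_ge0 (`|D t| - 2 * eta); lra.
rewrite RintegralD//; [|exact: rint_cst_itv|exact: rintZ].
rewrite (Rint_cst_itv _ (ltW ab)) RintegralZl//.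
have -> : eta * (b - a) = e / 2 by rewrite etaE; field; rewrite gt_eqF.
have h1 : \int[mu]_(x in `[a, b]) (D x * D x * weight w x) <= rip w D D.
  apply: le_Rint_sub => // x Ix.
  by rewrite -expr2 mulr_ge0 ?sqr_ge0// ltW// weight_gt0.
have h2 : c * \int[mu]_(x in `[a, b]) (D x * D x * weight w x) <= c * (e / (2 * c)).
  by rewrite ler_pM2l// (le_trans h1).
have h3 : c * (e / (2 * c)) = e / 2 by field; rewrite gt_eqF.
by rewrite h3 in h2; rewrite [leRHS]splitr lerD2l.
Qed.

Lemma rip_pdist w f g : rL2 w f -> rL2 w g ->
  pdist mu I 2 (weight w) f g = (rip w (lcomb (-1) g f) (lcomb (-1) g f))%:E.
Proof.
move=> lf lg; have ld := rL2_lcomb (-1) lg lf; have jd := rL2_prod ld ld.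
rewrite /rip /Rintegral fineK; last exact: integrable_fin_num jd.
apply: eq_integral => x _; rewrite /pdens real_normK ?num_real// /lcomb.
by congr EFin; ring.
Qed.

Lemma rL2_complete w u : (forall n, rL2 w (u n)) ->
  (forall e : R, 0 < e -> exists N, forall m n, (N <= m)%N -> (N <= n)%N ->
     rip w (lcomb (-1) (u n) (u m)) (lcomb (-1) (u n) (u m)) <= e) ->
  exists2 g, rL2 w g & forall e : R, 0 < e -> exists N, forall n, (N <= n)%N ->
     rip w (lcomb (-1) g (u n)) (lcomb (-1) g (u n)) <= e.
Proof.
move=> lu cu.
have [||g mg gP] := @riesz_fischer _ _ _ mu I mI 2 isT (weight w) (weight_measurable w)
    (@weight_gt0 w) u.
- by move=> n; have [] := lu n.
- move=> e e0; have [N NP] := cu e e0; exists N => m n Nm Nn.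
  by rewrite rip_pdist// lee_fin NP.
(* Finite distance puts [u N - g] in the space, and [g = u N - (u N - g)]. *)
have lg : rL2 w g.
  have [N NP] := gP 1 ltr01; have h := NP N (leqnn N).
  have [mN _] := lu N.
  have ld : rL2 w (lcomb (-1) g (u N)).
    split; first exact: measurable_lcomb.
    apply/integrableP; split.
      apply/measurable_EFinP; apply: measurable_funM; last exact: weight_measurable.
      by apply: measurable_funX; exact: measurable_lcomb.
    apply: le_lt_trans (ltry 1); apply: le_trans h; rewrite le_eqVlt; apply/orP; left.
    apply/eqP; apply: eq_integral => x; rewrite inE => Ix.
    rewrite /= ger0_norm; last by rewrite mulr_ge0 ?sqr_ge0// ltW// weight_gt0.
    by rewrite /pdens real_normK ?num_real// /lcomb; congr EFin; ring.
  apply: rL2_ae (rL2_lcomb (-1) ld (lu N)) mg _.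
  by apply: aeW => x _; rewrite /lcomb; ring.
exists g => // e e0; have [N NP] := gP e e0; exists N => n Nn.
by rewrite -lee_fin -rip_pdist// NP.
Qed.

End WeightedSpaces.

(** * The real spaces of order n and their completeness *)

Section SobolevSpaces.
Variable R : realType.
Local Notation mu := (@lebesgue_measure R).
Local Notation I := (`]-1, 1[%classic : set R).
Implicit Types (f g h : R -> R) (w : int) (a b x y : R).

Lemma near_I f g x : (forall y, I y -> f y = g y) -> I x -> \forall y \near x, f y = g y.
Proof.
move=> fg Ix; have : nbhs x I by apply: open_nbhs_nbhs; split => //; exact: interval_open.
by apply: filterS => y; exact: fg.
Qed.

Lemma derivable_I f g x : (forall y, I y -> f y = g y) -> I x ->
  derivable f x 1 -> derivable g x 1.
Proof. by move=> fg Ix; apply: near_eq_derivable; exact: near_I. Qed.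

Lemma derive1_I f g x : (forall y, I y -> f y = g y) -> I x -> derive1 f x = derive1 g x.
Proof. by move=> fg Ix; rewrite !derive1E; apply: near_eq_derive; exact: near_I. Qed.

Lemma derive1n_I j f g x : (forall y, I y -> f y = g y) -> I x ->
  derive1n j f x = derive1n j g x.
Proof.
move=> fg; elim: j x => [|j IH] x Ix; first exact: fg.
exact: derive1_I IH Ix.
Qed.

Lemma rabs_cont_eq a b f g : (forall x, a <= x <= b -> f x = g x) ->
  rabs_cont a b f -> rabs_cont a b g.
Proof.
move=> fg fac e e0; have [d d0 H] := fac e e0; exists d => // N u v uv dis sd.
have := H N u v uv dis sd; congr (_ < _); apply: eq_bigr => i _.
by have [h1 h2 h3] := uv i; rewrite !fg//; apply/andP; split => //; lra.
Qed.

Lemma rAC_I f g : (forall y, I y -> f y = g y) -> rAC f -> rAC g.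
Proof.
move=> fg fac a b a1 ab b1; apply: rabs_cont_eq (fac a b a1 ab b1) => x /andP[ax xb].
by apply: fg; rewrite inI; apply/andP; split; lra.
Qed.

Lemma rAC_cst (c : R) : rAC (fun=> c).
Proof.
move=> a b _ _ _ e e0; exists 1 => // N u v _ _ _.
by rewrite big1// => i _; rewrite subrr normr0.
Qed.

Lemma rAC_id : rAC (fun x => x).
Proof.
move=> a b _ _ _ e e0; exists e => // N u v uv _.
by congr (_ < _); apply: eq_bigr => i _; have [_ h _] := uv i; rewrite ger0_norm// subr_ge0.
Qed.

Lemma rabs_contD a b f g : rabs_cont a b f -> rabs_cont a b g ->
  rabs_cont a b (fun x => f x + g x).
Proof.
move=> fac gac e e0; have e20 : 0 < e / 2 by rewrite divr_gt0.
have [d1 d10 H1] := fac _ e20; have [d2 d20 H2] := gac _ e20.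
exists (Num.min d1 d2); first by rewrite lt_min d10.
move=> N u v uv dis; rewrite lt_min => /andP[s1 s2].
apply: le_lt_trans (_ : \sum_(i < N) (`|f (v i) - f (u i)| + `|g (v i) - g (u i)|) < _).
  apply: ler_sum => i _; rewrite opprD addrACA; exact: ler_normD.
by rewrite big_split/= (splitr e) ltrD// ?H1 ?H2.
Qed.

Lemma rabs_contM a b f g (M : R) : (forall x, a <= x <= b -> `|f x| <= M) ->
  (forall x, a <= x <= b -> `|g x| <= M) -> rabs_cont a b f -> rabs_cont a b g ->
  rabs_cont a b (fun x => f x * g x).
Proof.
move=> fM gM fac gac e e0.
pose K := `|M| + 1; have K0 : 0 < K by rewrite ltr_wpDl.
have e20 : 0 < e / 2 / K by rewrite !divr_gt0.
have [d1 d10 H1] := fac _ e20; have [d2 d20 H2] := gac _ e20.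
exists (Num.min d1 d2); first by rewrite lt_min d10.
move=> N u v uv dis; rewrite lt_min => /andP[s1 s2].
apply: le_lt_trans (_ : \sum_(i < N) (K * `|f (v i) - f (u i)| + K * `|g (v i) - g (u i)|) < _).
  apply: ler_sum => i _; have [h1 h2 h3] := uv i.
  have MK : M <= K by rewrite (le_trans (ler_norm _))// lerDl.
  rewrite (_ : f (v i) * g (v i) - f (u i) * g (u i) =
    g (v i) * (f (v i) - f (u i)) + f (u i) * (g (v i) - g (u i))); last by ring.
  rewrite (le_trans (ler_normD _ _))// !normrM lerD// ler_wpM2r// (le_trans _ MK)//.
    by apply: gM; rewrite h3 (le_trans h1).
  by apply: fM; rewrite h1 (le_trans h2).
rewrite big_split/= -!mulr_sumr (splitr e).
by apply: ltrD; rewrite mulrC -ltr_pdivlMr//; [exact: H1|exact: H2].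
Qed.

Lemma rAC_bounded f a b : rAC f -> -1 < a -> a <= b -> b < 1 ->
  exists M : R, forall x, a <= x <= b -> `|f x| <= M.
Proof.
move=> fac a1 ab b1.
have cf : {within `[a, b], continuous (fun x => `|f x|)}.
  apply: continuous_in_subspaceT => x; rewrite inE /= in_itv/= => /andP[ax xb].
  apply: cvg_norm; apply: rAC_continuous => //.
  by rewrite inI; apply/andP; split; lra.
have [c cab cmax] := EVT_max ab cf.
by exists `|f c| => x xab; apply: cmax; rewrite in_itv.
Qed.

Lemma rACD f g : rAC f -> rAC g -> rAC (fun x => f x + g x).
Proof. by move=> fac gac a b a1 ab b1; apply: rabs_contD; [exact: fac|exact: gac]. Qed.

Lemma rACM f g : rAC f -> rAC g -> rAC (fun x => f x * g x).
Proof.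
move=> fac gac a b a1 ab b1.
have [M1 H1] := rAC_bounded fac a1 ab b1; have [M2 H2] := rAC_bounded gac a1 ab b1.
apply: (@rabs_contM a b f g (Num.max M1 M2)); [| |exact: fac|exact: gac].
- by move=> x /H1 h; rewrite le_max h.
- by move=> x /H2 h; rewrite le_max h orbT.
Qed.

Lemma rAC_poly (p : {poly R}) : rAC (horner p).
Proof.
elim/poly_ind: p => [|p c IH].
  by apply: rAC_I (rAC_cst 0) => x _; rewrite horner0.
apply: rAC_I (rACD (rACM IH rAC_id) (rAC_cst c)) => x _.
by rewrite hornerD hornerM hornerX hornerC.
Qed.

Lemma rAC_lcomb a f g : rAC f -> rAC g -> rAC (lcomb a f g).
Proof. by move=> fac gac; apply: rACD gac; apply: rACM fac; exact: rAC_cst. Qed.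

Lemma derive1_lcomb a f g x : derivable f x 1 -> derivable g x 1 ->
  derivable (lcomb a f g) x 1 /\
  derive1 (lcomb a f g) x = lcomb a (derive1 f) (derive1 g) x.
Proof.
move=> df dg; have d1 : is_derive x 1 (a *: f + g) (a *: 'D_1 f x + 'D_1 g x).
  exact: (is_deriveD (is_deriveZ a (derivableP df)) (derivableP dg)).
have -> : lcomb a f g = (a *: f + g) by apply/funext => y.
by split; [exact: ex_derive|rewrite /lcomb !derive1E derive_val].
Qed.

Definition rACn (n : nat) f : Prop :=
  (forall j : nat, (j.+1 < n)%N -> forall x, I x -> derivable (derive1n j f) x 1) /\
  (forall j : nat, (j < n)%N -> rAC (derive1n j f)).

Lemma rACn_I n f g : (forall y, I y -> f y = g y) -> rACn n f -> rACn n g.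
Proof.
move=> fg [d ac]; split.
- move=> j jn x Ix; apply: derivable_I Ix (d j jn x Ix) => y Iy.
  exact: derive1n_I.
- by move=> j jn; apply: rAC_I (ac j jn) => y Iy; exact: derive1n_I.
Qed.

Lemma rACn_le m n f : (m <= n)%N -> rACn n f -> rACn m f.
Proof.
move=> mn [d ac]; split.
- by move=> j jm; apply: d; exact: leq_trans mn.
- by move=> j jm; apply: ac; exact: leq_trans mn.
Qed.

Lemma derive1n_lcomb n a f g j x : rACn n f -> rACn n g -> (j < n)%N -> I x ->
  derive1n j (lcomb a f g) x = lcomb a (derive1n j f) (derive1n j g) x.
Proof.
move=> [df _] [dg _]; elim: j x => [//|j IH] x jn Ix.
have jn' := ltnW jn.
transitivity (derive1 (lcomb a (derive1n j f) (derive1n j g)) x).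
  by apply: derive1_I => // y Iy; exact: IH.
by have [|| //] := @derive1_lcomb a (derive1n j f) (derive1n j g) x; [exact: df|exact: dg].
Qed.

Lemma rACn_lcomb n a f g : rACn n f -> rACn n g -> rACn n (lcomb a f g).
Proof.
move=> fn gn; have [[df acf] [dg acg]] := (fn, gn); split.
- move=> j jn x Ix; have jn' := ltnW jn.
  apply: (@derivable_I (lcomb a (derive1n j f) (derive1n j g))) => //.
    by move=> y Iy; rewrite (derive1n_lcomb _ fn gn).
  by have [||] := @derive1_lcomb a (derive1n j f) (derive1n j g) x; [exact: df|exact: dg|].
- move=> j jn; apply: rAC_I (rAC_lcomb a (acf j jn) (acg j jn)) => y Iy.
  by rewrite (derive1n_lcomb _ fn gn).
Qed.

(** At the top order [j = n] linearity may fail on a null set: the derivative of order [n - 1] is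
    only locally absolutely continuous, hence derivable almost everywhere. *)
Lemma derive1n_lcomb_ae n a f g j : rACn n f -> rACn n g -> (j <= n)%N ->
  {ae mu, forall x, I x -> derive1n j (lcomb a f g) x = lcomb a (derive1n j f) (derive1n j g) x}.
Proof.
move=> fn gn; rewrite leq_eqVlt => /predU1P[->|jn]; last first.
  by apply: aeW => x Ix; exact: derive1n_lcomb fn gn jn Ix.
case: n fn gn => [|n] fn gn; first by apply: aeW.
have acf := fn.2 n (ltnSn n); have acg := gn.2 n (ltnSn n).
apply: ae_imp2 (rAC_ae_derivable acf) (rAC_ae_derivable acg) => x df dg Ix.
transitivity (derive1 (lcomb a (derive1n n f) (derive1n n g)) x).
  by apply: (@derive1_I (derive1n n (lcomb a f g))) => // y Iy; rewrite (derive1n_lcomb _ fn gn).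
by have [|| //] := @derive1_lcomb a (derive1n n f) (derive1n n g) x; [exact: df|exact: dg].
Qed.

Lemma rACn_measurable n f j : (0 < n)%N -> rACn n f -> (j <= n)%N ->
  measurable_fun I (derive1n j f).
Proof.
move=> n0 [_ ac]; rewrite leq_eqVlt => /predU1P[->|jn]; last exact: rAC_measurable (ac j jn).
by case: n n0 ac => // n _ ac; exact: rAC_derive1_measurable (ac n _).
Qed.

Definition rV (n : nat) f : Prop :=
  rACn n f /\ forall j : nat, (j <= n)%N -> rL2 (j%:Z - 1) (derive1n j f).

Definition ripn (n : nat) (k : R) f g : R :=
  \sum_(j < n.+1) coef n k j * rip (j%:Z - 1) (derive1n j f) (derive1n j g).

Lemma rV_I n f g : (forall y, I y -> f y = g y) -> rV n f -> rV n g.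
Proof.
move=> fg [fn lf]; split; first exact: rACn_I fn.
move=> j jn; have lj := lf j jn; apply: (rL2_ae lj).
  by apply: (eq_measurable_fun (derive1n j f)) lj.1 => y; rewrite inE => Iy; exact: derive1n_I.
by apply: aeW => y Iy; exact: derive1n_I.
Qed.

Lemma rV_0 n : rV n (fun=> 0).
Proof.
have z j : derive1n j (fun=> 0 : R) = (fun=> 0).
  by elim: j => [//|j IH]; rewrite /derive1n iterS -/(derive1n j _) IH; apply/funext => x; exact: derive1_cst.
split; last by move=> j _; rewrite z; exact: rL2_0.
by split=> j _; rewrite z; [move=> x _; exact: derivable_cst|exact: rAC_cst].
Qed.

Section Fixed.
Variables (n : nat) (n0 : (0 < n)%N) (k : R) (k0 : 0 < k).

Lemma rV_lcomb a f g : rV n f -> rV n g -> rV n (lcomb a f g).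
Proof.
move=> [fn lf] [gn lg]; split; first exact: rACn_lcomb.
move=> j jn; apply: rL2_ae (rL2_lcomb a (lf j jn) (lg j jn)) _ _.
  exact: rACn_measurable n0 (rACn_lcomb a fn gn) jn.
by apply: ae_imp (derive1n_lcomb_ae a fn gn jn) => x h Ix; rewrite h.
Qed.

Lemma rip_derive1n_lcomb a f g h j : rV n f -> rV n g -> (j <= n)%N ->
  measurable_fun I h ->
  rip (j%:Z - 1) (derive1n j (lcomb a f g)) h =
  rip (j%:Z - 1) (lcomb a (derive1n j f) (derive1n j g)) h.
Proof.
move=> fn gn jn mh; apply: rip_ae => //.
- exact: rACn_measurable n0 (rACn_lcomb a fn.1 gn.1) jn.
- by apply: measurable_lcomb; apply: rACn_measurable n0 _ jn; [exact: fn.1|exact: gn.1].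
- exact: derive1n_lcomb_ae fn.1 gn.1 jn.
- exact: aeW.
Qed.

Lemma ripn_lcomb a f g h : rV n f -> rV n g -> rV n h ->
  ripn n k (lcomb a f g) h = a * ripn n k f h + ripn n k g h.
Proof.
move=> fn gn hn; rewrite /ripn mulr_sumr -big_split/=; apply: eq_bigr => -[j /=].
rewrite ltnS => jn _; have lh := hn.2 j jn.
by rewrite (rip_derive1n_lcomb a fn gn jn lh.1) rip_lcomb//; [ring|exact: fn.2|exact: gn.2].
Qed.

Lemma ripn_sym f g : ripn n k f g = ripn n k g f.
Proof. by apply: eq_bigr => j _; rewrite rip_sym. Qed.

Lemma ripn_ge0 f : 0 <= ripn n k f f.
Proof.
apply: sumr_ge0 => -[j /=]; rewrite ltnS => jn _.
by rewrite mulr_ge0 ?rip_ge0// ltW// coef_gt0.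
Qed.

Lemma ripn_lcombE a f g : rV n f -> rV n g ->
  ripn n k (lcomb a f g) (lcomb a f g) =
  \sum_(j < n.+1) coef n k j *
    rip (j%:Z - 1) (lcomb a (derive1n j f) (derive1n j g))
                   (lcomb a (derive1n j f) (derive1n j g)).
Proof.
move=> fn gn; apply: eq_bigr => -[j /=]; rewrite ltnS => jn _.
have ml := (rV_lcomb a fn gn).2 j jn.
rewrite (rip_derive1n_lcomb a fn gn jn ml.1) rip_sym (rip_derive1n_lcomb a fn gn jn)//.
by apply: measurable_lcomb; apply: rACn_measurable n0 _ jn; [exact: fn.1|exact: gn.1].
Qed.

(** Each order of differentiation has a limit in its own weighted space; closedness of
    differentiation links consecutive limits and provides regular representatives below the top
    order. *)
Lemma rV_complete (u : nat -> R -> R) : (forall m, rV n (u m)) ->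
  (forall e : R, 0 < e -> exists N, forall m l, (N <= m)%N -> (N <= l)%N ->
     ripn n k (lcomb (-1) (u l) (u m)) (lcomb (-1) (u l) (u m)) <= e) ->
  exists2 g, rV n g & forall e : R, 0 < e -> exists N, forall m, (N <= m)%N ->
     ripn n k (lcomb (-1) g (u m)) (lcomb (-1) g (u m)) <= e.
Proof.
move=> un cu.
pose D j m := derive1n j (u m).
have /choice[h hP] (j : nat) : exists h, (j <= n)%N -> rL2 (j%:Z - 1) h /\
    forall e : R, 0 < e -> exists N, forall m, (N <= m)%N ->
      rip (j%:Z - 1) (lcomb (-1) h (D j m)) (lcomb (-1) h (D j m)) <= e.
  have [jn|] := leqP j n; last by exists (fun=> 0).
  (* Since every coefficient is positive, the norm of order [n] controls each weighted norm
     separately. *)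
  have c0 := coef_gt0 k0 jn.
  have [||h lh hP] := @rL2_complete R (j%:Z - 1) (D j).
  - by move=> m; exact: (un m).2.
  - move=> e e0; have [N NP] := cu (coef n k j * e) (mulr_gt0 c0 e0).
    exists N => m l Nm Nl; rewrite -(ler_pM2l c0); apply: le_trans (NP m l Nm Nl).
    rewrite ripn_lcombE//; have jn' : (j < n.+1)%N by [].
    rewrite (bigD1 (Ordinal jn'))//= lerDl; apply: sumr_ge0 => i _; have := ltn_ord i; rewrite ltnS => iN.
    by rewrite mulr_ge0 ?rip_ge0// ltW// coef_gt0.
  - by exists h.
have lcvD j : (j <= n)%N -> lcv (D j) (h j).
  move=> jn; have [lh cv] := hP j jn; apply: rL2_lcv lh cv => m.
  exact: (un m).2.
(* [G j] is the locally absolutely continuous representative of [h j], with density [h j.+1]. *)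
have /choice[G GP] (j : nat) : exists G, (j < n)%N ->
    (forall a b, -1 < a -> a <= b -> b < 1 -> mu.-integrable `[a, b] (EFin \o h j.+1) /\
       G b - G a = \int[mu]_(t in `[a, b]) h j.+1 t) /\
    {ae mu, forall x, I x -> G x = h j x}.
  have [jn|] := ltnP j n; last by exists (fun=> 0).
  have [||| G H] := @closed_derivative R (D j) (h j) (h j.+1).
  - by move=> m; exact: (un m).1.2.
  - exact: lcvD (ltnW jn).
  - exact: lcvD jn.
  - by exists G.
have acG j : (j < n)%N -> rAC (G j) by move=> jn; have [H _] := GP j jn; exact: primitive_rAC H.
(* Below the top order the density has the continuous representative [G j.+1], so [G j] is derivable
   at every point and not only almost everywhere. *)
have dG j x : (j.+1 < n)%N -> I x -> derivable (G j) x 1 /\ derive1 (G j) x = G j.+1 x.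
  move=> jn Ix; have [H _] := GP j (ltnW jn); have [_ Gh] := GP j.+1 jn.
  apply: primitive_I_continuous Ix (rAC_continuous (acG _ jn) Ix).
  move=> a b a1 ab b1; have [i1 e1] := H a b a1 ab b1.
  have sub : `[a, b]%classic `<=` I.
    by move=> t; rewrite inI /= in_itv/= => /andP[? ?]; apply/andP; split; lra.
  have mab : @measurable _ (measurableTypeR R) `[a, b]%classic by exact: measurable_itv.
  have mG : measurable_fun `[a, b] (G j.+1) by apply: measurable_funS sub (rAC_measurable (acG _ jn)).
  have aeq : {ae mu, forall x, `[a, b]%classic x -> h j.+1 x = G j.+1 x}.
    by apply: ae_imp Gh => t Ht tab; rewrite Ht//; exact: sub.
  split; first exact: ae_integrable aeq i1.
  by rewrite e1; apply: ae_Rintegral => //; exact: rint_measurable i1.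
have DG j x : (j < n)%N -> I x -> derive1n j (G 0%N) x = G j x.
  elim: j x => [//|j IH] x jn Ix.
  have [_ <-] := dG j x jn Ix.
  by apply: (@derive1_I (derive1n j (G 0%N))) => // y Iy; rewrite IH// ltnW.
have acn : rACn n (G 0%N).
  split=> [j jn x Ix|j jn].
    have [dj _] := dG j x jn Ix; apply: derivable_I Ix dj => y Iy.
    by rewrite DG// ltnW.
  by apply: rAC_I (acG j jn) => y Iy; rewrite DG.
have aeh j : (j <= n)%N -> {ae mu, forall x, I x -> h j x = derive1n j (G 0%N) x}.
  rewrite leq_eqVlt => /predU1P[->|jn]; last first.
    by have [_ Gh] := GP j jn; apply: ae_imp Gh => x Hx Ix; rewrite DG// Hx.
  (* For [j = n] there is no continuous representative; the derivative of [G n'] equals the last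
     limit almost everywhere, which is enough for the norm. *)
  case: n n0 GP DG => // n' _ GP' DG'; have [H _] := GP' n' (ltnSn _).
  apply: ae_imp (primitive_I_ae H) => x Hx Ix; have [_ <-] := Hx Ix.
  by apply: (@derive1_I (G n') (derive1n n' (G 0%N))) => // y Iy; rewrite DG'.
have VG : rV n (G 0%N).
  split=> // j jn; apply: rL2_ae (hP j jn).1 _ (aeh j jn).
  exact: rACn_measurable acn jn.
exists (G 0%N) => // e e0.
have n1 : 0 < n.+1%:R :> R by rewrite ltr0n.
have /choice[N NP] (j : 'I_n.+1) : exists N, forall m, (N <= m)%N ->
    coef n k j * rip (j%:Z - 1) (lcomb (-1) (h j) (D j m)) (lcomb (-1) (h j) (D j m))
      <= e / n.+1%:R.
  case: j => j /=; rewrite ltnS => jn; have c0 := coef_gt0 k0 jn.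
  have [_ /(_ (e / n.+1%:R / coef n k j))[|N NP]] := hP j jn; first by rewrite !divr_gt0.
  by exists N => m Nm; rewrite -ler_pdivlMl// mulrC NP.
exists (\max_j N j) => m Nm; rewrite ripn_lcombE//.
apply: (@le_trans _ _ (\sum_(j < n.+1) e / n.+1%:R)).
  apply: ler_sum => j _; apply: le_trans (NP j m (leq_trans (leq_bigmax j) Nm)).
  case: j => j /=; rewrite ltnS => jn; rewrite le_eqVlt; apply/orP; left; apply/eqP; congr (_ * _).
  have mG : measurable_fun I (derive1n j (G 0%N)) by exact: rACn_measurable acn jn.
  have mh : measurable_fun I (h j) by exact: (hP j jn).1.1.
  have mD : measurable_fun I (D j m) by exact: ((un m).2 j jn).1.
  have aed : {ae mu, forall x, I x -> lcomb (-1) (derive1n j (G 0%N)) (D j m) x =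
                                lcomb (-1) (h j) (D j m) x}.
    by apply: ae_imp (aeh j jn) => x Hx Ix; rewrite /lcomb Hx.
  by apply: rip_ae => //; exact: measurable_lcomb.
by rewrite sumr_const card_ord -(mulr_natr (e / _)) divfK// gt_eqF.
Qed.

End Fixed.

End SobolevSpaces.

(** * Integration by parts *)

Section BoundaryTerms.
Variable R : realType.
Local Notation mu := (@lebesgue_measure R).
Local Notation I := (`]-1, 1[%classic : set R).
Local Notation rint f := (mu.-integrable I (EFin \o f)).
Implicit Types (f g h : R -> R) (w : int) (a b x y : R).

Let mI : @measurable _ (measurableTypeR R) I := @measI R.

Lemma exh_le n m : (n <= m)%N -> exh R n <= exh R m.
Proof. by move=> nm; rewrite lerB// lef_pV2 ?posrE ?ltr0n// ler_nat !ltnS. Qed.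

Lemma exh_near (e : R) : 0 < e -> exists N, forall n, (N <= n)%N -> 1 - exh R n < e.
Proof.
move=> e0; have [N HN] := invS_lt e0; exists N => n Nn.
rewrite /exh opprB addrC subrK (le_lt_trans _ HN)// lef_pV2 ?posrE ?ltr0n//.
by rewrite ler_nat ltnS (leq_trans Nn).
Qed.

Lemma rint_tail f : rint f -> forall e : R, 0 < e -> exists N, forall B : set R,
  @measurable _ (measurableTypeR R) B -> B `<=` I ->
  (forall x, B x -> ~~ (- exh R N < x < exh R N)) -> `|\int[mu]_(x in B) f x| <= e.
Proof.
move=> jf e e0; have ja := rint_abs jf.
pose A n : set R := `] - exh R n, exh R n[%classic.
have mA n : @measurable _ (measurableTypeR R) (A n) by exact: measurable_itv.
have AI n : A n `<=` I by rewrite I_bigcup; exact: bigcup_sup.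
have jA n : mu.-integrable (A n) (EFin \o (fun x => `|f x|)) by exact: (integrableS mI (mA n) (AI n) ja).
have cv : (\int[mu]_(x in A n) `|f x|%:E)%E @[n --> \oo] --> (\int[mu]_(x in I) `|f x|)%:E.
  have -> : (\int[mu]_(x in I) `|f x|)%:E = (\int[mu]_(x in \bigcup_n A n) `|f x|%:E)%E.
    by rewrite -I_bigcup /Rintegral fineK//; exact: integrable_fin_num.
  apply: ge0_nondecreasing_set_cvg_integral => //.
  - move=> m n mn; apply/subsetPset => x; rewrite /A /= !in_itv/= => /andP[h1 h2].
    have := exh_le mn; move: h1 h2; set p := exh R m; set q := exh R n => h1 h2 h3.
    by apply/andP; split; lra.
  - move=> n; exact: (measurable_int mu (jA n)).
have /fine_cvg/cvgrPdist_le/(_ e e0)[N _ /(_ N (leqnn N)) NP] := cv.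
exists N => B mB BI BN.
have jB : mu.-integrable B (EFin \o f) by exact: (integrableS mI mB BI jf).
apply: le_trans (le_normr_Rintegral mB jB) _.
have UI : A N `|` B `<=` I by move=> x [/AI|/BI].
have mU : @measurable _ (measurableTypeR R) (A N `|` B) by exact: measurableU.
have dis : [disjoint A N & B].
  rewrite disj_set2E; apply/eqP; apply/seteqP; split => // x [/= Ax Bx].
  by have := BN x Bx; move: Ax; rewrite /A /= in_itv/= => ->.
have h1 : \int[mu]_(x in A N `|` B) `|f x| <= \int[mu]_(x in I) `|f x|.
  by apply: le_Rint_sub.
rewrite Rintegral_setU// in h1; last exact: (integrableS mI mU UI ja).
move: NP => /= /(le_trans (ler_norm _)); rewrite lerBlDr => h2.
have h3 := le_trans h1 h2; rewrite addrC lerD2r in h3; exact: h3.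
Qed.

Lemma exh_left a n : -1 < a -> a <= - exh R n -> I a /\ exh R n <= `|a|.
Proof.
have h := exh_gt0 R n; move=> a1 an; split; first by rewrite inI; apply/andP; split; lra.
by rewrite ler_normr lerNr an orbT.
Qed.

Lemma exh_right b n : exh R n <= b -> b < 1 -> I b /\ exh R n <= `|b|.
Proof.
have h := exh_gt0 R n; move=> bn b1; split; first by rewrite inI; apply/andP; split; lra.
by rewrite ler_normr bn.
Qed.

(** One pair of points close to the ends where [f] is small is enough: between them the integral is
    [f b - f a], and what remains is a tail of an integrable function. *)
Lemma boundary_Rintegral f :
  rAC f -> rint (derive1 f) ->
  (forall e : R, 0 < e -> forall n, exists a b, [/\ -1 < a, a <= - exh R n,
     exh R n <= b, b < 1 & `|f a| <= e /\ `|f b| <= e]) ->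
  \int[mu]_(x in I) derive1 f x = 0.
Proof.
move=> fac jf bd; apply/eqP; rewrite -normr_le0; apply/ler_addgt0Pr => e e0; rewrite add0r.
have e30 : 0 < e / 3 by rewrite divr_gt0.
have [N NP] := rint_tail jf e30.
have [a [b [a1 aN bN b1 [fa fb]]]] := bd _ e30 N.
have N0 := exh_gt0 R N; have ab : a <= b by lra.
have [_ ftc] := rAC_FTC fac a1 ab b1.
have mab : @measurable _ (measurableTypeR R) `[a, b]%classic by exact: measurable_itv.
have sub : `[a, b]%classic `<=` I.
  by move=> t; rewrite inI /= in_itv/= => /andP[? ?]; apply/andP; split; lra.
have mB : @measurable _ (measurableTypeR R) (I `\` `[a, b]) by exact: measurableD.
have hB := NP (I `\` `[a, b]) mB (@subDsetl _ _ _).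
have IE : I = `[a, b]%classic `|` (I `\` `[a, b]) by rewrite setDUK.
have dis : [disjoint `[a, b]%classic & I `\` `[a, b]].
  by rewrite disj_set2E setDIK.
rewrite IE Rintegral_setU//; last by rewrite -IE.
have {}hB : `|\int[mu]_(x in I `\` `[a, b]) derive1 f x| <= e / 3.
  apply: hB => x [_ /= /negP]; apply: contra; rewrite in_itv/= => /andP[h1 h2].
  by apply/andP; split; lra.
rewrite -ftc (le_trans (ler_normD _ _))// (le_trans (lerD (ler_normB _ _) hB))//.
by lra.
Qed.

(* The weight [(1-x^2)^-1] is not integrable near the endpoints. *)
Lemma rL2_small_point f e (s : R) n : rL2 (-1) f -> (s == 1) || (s == -1) -> 0 < e ->
  exists b, [/\ exh R n <= b, b < 1 & `|f (s * b)| <= e].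
Proof.
move=> lf s1 e0; apply: contrapT => /forallNP H.
have big b : exh R n <= b -> b < 1 -> e < `|f (s * b)|.
  by move=> h1 h2; rewrite ltNge; apply/negP => h3; apply: (H b); split.
have e20 : 0 < e ^+ 2 / 8 by rewrite divr_gt0// exprn_gt0.
have jf := lf.2; have [N NP] := rint_tail jf e20.
pose p := maxn n N; pose h := 1 - exh R p.
have h0 : 0 < h by rewrite subr_gt0 exh_lt1.
have h1 : h < 1 by rewrite ltrBlDr ltrDl exh_gt0.
have hn : exh R n <= 1 - h by rewrite /h opprB addrC subrK exh_le// leq_maxl.
have hN : exh R N <= 1 - h by rewrite /h opprB addrC subrK exh_le// leq_maxr.
clearbody h.
(* The interval has length [h / 2], and on it [1 - x^2 <= 2 h]. If [|f|] stayed above [e], the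
   weighted integral would be at least [e^2 / 4] however small [h] is, against the tail bound
   [e^2 / 8]. *)
have [lo [hi [loh ab]]] : exists lo hi, hi = lo + h / 2 /\
    forall x, lo <= x <= hi -> 1 - h <= s * x <= 1 - h / 2.
  case/orP: s1 => /eqP ->.
    by exists (1 - h), (1 - h / 2); split=> [|x /andP[? ?]]; [lra|apply/andP; split; lra].
  by exists (-1 + h / 2), (-1 + h); split=> [|x /andP[? ?]]; [lra|apply/andP; split; lra].
have lohi : lo <= hi by lra.
have mB : @measurable _ (measurableTypeR R) `[lo, hi]%classic by exact: measurable_itv.
have ss : s * s = 1 by case/orP: s1 => /eqP ->; rewrite ?mulrNN mulr1.
have BI : `[lo, hi]%classic `<=` I.
  move=> x; rewrite inI /= in_itv/= => /ab /andP[h2 h3].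
  by case/orP: s1 h2 h3 => /eqP -> h2 h3; apply/andP; split; lra.
have jB : mu.-integrable `[lo, hi] (EFin \o (fun x => f x ^+ 2 * weight (-1) x)).
  exact: (integrableS mI mB BI jf).
have small : \int[mu]_(x in `[lo, hi]) (f x ^+ 2 * weight (-1) x) <= e ^+ 2 / 8.
  apply: le_trans (ler_norm _) (NP _ mB BI _) => x; rewrite /= in_itv/= => /ab /andP[h2 h3].
  by case/orP: s1 h2 h3 => /eqP -> h2 h3; apply/negP => /andP[h4 h5]; lra.
have lb : \int[mu]_(x in `[lo, hi]) (e ^+ 2 / (2 * h)) <= \int[mu]_(x in `[lo, hi]) (f x ^+ 2 * weight (-1) x).
  apply: (le_Rintegral mB (rint_cst_itv lo hi _) jB) => x xB.
  have Ix := BI _ xB; move: xB; rewrite /= in_itv/= => /ab /andP[h2 h3].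
  have fx : e <= `|f x|.
    by rewrite -[x in f x]mul1r -ss -mulrA ltW// big//; lra.
  have w2 : (2 * h)^-1 <= weight (-1) x.
    rewrite /weight exprN1 lef_pV2 ?posrE ?mulr_gt0 ?one_sub_sqr_gt0//.
    have -> : x ^+ 2 = (s * x) ^+ 2 by rewrite exprMn (expr2 s) ss mul1r.
    by nra.
  apply: ler_pM => //; [exact: sqr_ge0|by rewrite invr_ge0 mulr_ge0// ltW|].
  by rewrite -(real_normK (num_real (f x))) lerXn2r// nnegrE ltW.
rewrite (Rint_cst_itv _ lohi) in lb.
have e8 : e ^+ 2 / (2 * h) * (hi - lo) = e ^+ 2 / 4 by rewrite loh; field; rewrite gt_eqF.
have := le_trans lb small; rewrite e8.
by have := exprn_gt0 2 e0; lra.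
Qed.

Lemma rL2_small_points f (e : R) n : rL2 (-1) f -> 0 < e -> exists a b,
  [/\ -1 < a, a <= - exh R n, exh R n <= b, b < 1 & `|f a| <= e /\ `|f b| <= e].
Proof.
move=> lf e0.
have [|b [nb b1 fb]] := @rL2_small_point f e 1 n lf _ e0; first by rewrite eqxx.
have [|a [na a1 fa]] := @rL2_small_point f e (-1) n lf _ e0; first by rewrite eqxx orbT.
rewrite mul1r in fb; rewrite mulN1r in fa.
by exists (- a), b; split => //; rewrite ?ltrN2 ?lerN2.
Qed.

(* The lower limit of [|f|] at the endpoints is 0, which suffices for the
   boundary terms of an integrable derivative. *)
Lemma rL2_boundary_Rintegral f : rAC f -> rint (derive1 f) -> rL2 (-1) f ->
  \int[mu]_(x in I) derive1 f x = 0.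
Proof.
by move=> fac jf lf; apply: boundary_Rintegral => // e e0 n; exact: rL2_small_points.
Qed.

Lemma poly_bounded (p : {poly R}) : exists M : R, forall x, I x -> `|p.[x]| <= M.
Proof.
have cp : {within `[-1, 1], continuous (fun x : R => `|p.[x]|)}.
  apply: continuous_in_subspaceT => x _.
  by apply: cvg_norm; exact: continuous_horner.
have [|c _ cmax] := EVT_max _ cp; first lra.
exists `|p.[c]| => x; rewrite inI => /andP[? ?]; apply: cmax.
by rewrite in_itv/=; apply/andP; split; lra.
Qed.

Lemma rint_bounded f (M : R) : measurable_fun I f -> (forall x, I x -> `|f x| <= M) -> rint f.
Proof.
move=> mf fM; apply: measurable_bounded_integrable => //.
- by rewrite /= lebesgue_measure_itv /= lte_fin; case: ifP => _; rewrite -?EFinB ltry.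
- by exists M; split; [exact: num_real|] => N MN x Ix /=; rewrite (le_trans (fM x Ix))// ltW.
Qed.

Lemma measurable_horner (p : {poly R}) : measurable_fun I (horner p).
Proof. exact: rAC_measurable (rAC_poly p). Qed.

Lemma rL2_poly (n : nat) (p : {poly R}) : rL2 n (horner p).
Proof.
split; first exact: measurable_horner.
have [M HM] := poly_bounded (p ^+ 2 * (1 - 'X^2) ^+ n).
apply: (@rint_bounded _ M).
  apply: measurable_funM; last exact: weight_measurable.
  by apply: measurable_funX; exact: measurable_horner.
by move=> x Ix; have := HM x Ix; rewrite !hornerE.
Qed.

Lemma jac_hornerE m x : (1 < m)%N -> (jac R m).[x] = (1 - x ^+ 2) * (jacq R m).[x].
Proof. by move=> m1; rewrite jac_jacq// hornerM hornerD hornerN hornerXn hornerC. Qed.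

(** Since [jac m] is [1 - X^2] times [jacq m], the weighted square is the bounded polynomial
    [q^2 (1 - x^2)] with [q] the cofactor; one factor absorbs the singular weight. *)
Lemma rL2_jac m : (1 < m)%N -> rL2 (-1) (horner (jac R m)).
Proof.
move=> m1; split; first exact: measurable_horner.
have [M HM] := poly_bounded (jacq R m ^+ 2 * (1 - 'X^2)).
apply: (@rint_bounded _ M).
  apply: measurable_funM; last exact: weight_measurable.
  by apply: measurable_funX; exact: measurable_horner.
move=> x Ix; have := HM x Ix; congr (`|_| <= _).
rewrite jac_hornerE// hornerM horner_exp hornerD hornerN hornerXn hornerC /weight exprN1.
field.
by rewrite gt_eqF// one_sub_sqr_gt0.
Qed.

Lemma derive1n_poly j (p : {poly R}) : derive1n j (horner p) = horner (p^`(j)).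
Proof.
elim: j => [//|j IH].
by rewrite /derive1n iterS -/(derive1n j _) IH -derivE derivnS.
Qed.

Lemma rACn_poly n (p : {poly R}) : rACn n (horner p).
Proof.
split=> j _; rewrite derive1n_poly; last exact: rAC_poly.
by move=> x _; exact: derivable_horner.
Qed.

Lemma rV_jac n m : (1 < m)%N -> rV n (horner (jac R m)).
Proof.
move=> m1; split; first exact: rACn_poly.
case=> [|j] _; first exact: rL2_jac.
rewrite derive1n_poly (_ : j.+1%:Z - 1 = j%:Z); first exact: rL2_poly.
by rewrite -addn1 PoszD addrK.
Qed.

Lemma derive1M f g x : derivable f x 1 -> derivable g x 1 ->
  derive1 (fun y => f y * g y) x = derive1 f x * g x + f x * derive1 g x.
Proof.
move=> df dg; rewrite !derive1E (deriveM df dg).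
by rewrite /GRing.scale/= addrC (mulrC (g x)).
Qed.

(** Meant for the derivative of a function in the domain of A, where only the second derivative is
    controlled. The Jacobi polynomial in the boundary term supplies the factor [1 - b^2]. *)
Lemma rAC_growth f (e : R) : rAC f -> rint (fun x => derive1 f x ^+ 2 * (1 - x ^+ 2)) ->
  0 < e -> exists N, forall b, I b -> exh R N <= `|b| -> (1 - b ^+ 2) * `|f b| <= e.
Proof.
move=> fac jf e0; pose M := \int[mu]_(x in I) (derive1 f x ^+ 2 * (1 - x ^+ 2)).
(* With [V = 1 - b^2] the estimate reached is [V |f b| <= V K + e / 2]. As [V <= 2 (1 - |b|)], the
   distance [e / (4 (K + 1))] to the endpoint makes the first term at most [e / 2]. *)
pose K := `|f 0| + M / e.
have F0 x : I x -> 0 <= derive1 f x ^+ 2 * (1 - x ^+ 2).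
  by move=> Ix; rewrite mulr_ge0 ?sqr_ge0// ltW// one_sub_sqr_gt0.
have M0 : 0 <= M by apply: Rintegral_ge0.
have K0 : 0 <= K by rewrite addr_ge0// divr_ge0// ltW.
have e4 : 0 < e / (4 * (K + 1)) by rewrite divr_gt0// mulr_gt0// ltr_wpDl.
have [N NP] := exh_near e4; exists N => b Ib Nb.
have bN := NP N (leqnn N).
pose c := `|b|; pose V := 1 - b ^+ 2; have V0 : 0 < V by exact: one_sub_sqr_gt0.
rewrite -/V.
have VE : V = 1 - c ^+ 2 by rewrite /V /c real_normK ?num_real.
have c0 : 0 <= c by exact: normr_ge0.
have c1 : c < 1 by rewrite ltr_norml -inI.
have cb : - c <= b <= c by rewrite -ler_norml.
have Nc : 1 - c < e / (4 * (K + 1)) by clear -bN Nb mI; rewrite /c; lra.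
have KE : K = `|f 0| + M / e by [].
have ME : M = \int[mu]_(x in I) (derive1 f x ^+ 2 * (1 - x ^+ 2)) by [].
clearbody V c K M; clear NP bN Nb.
have VK : V * (K + 1) <= e / 2.
  have h := ltW Nc.
  have h2 : V <= 2 * (1 - c).
    rewrite VE (_ : 1 - c ^+ 2 = (1 + c) * (1 - c)); last by ring.
    by apply: ler_wpM2r; clear -c1 mI; lra.
  have h3 : V <= 2 * (e / (4 * (K + 1))) by lra.
  have := ler_wpM2r (_ : 0 <= K + 1) h3; rewrite addr_ge0// => /(_ isT) h4.
  apply: le_trans h4 _; rewrite le_eqVlt; apply/orP; left; apply/eqP.
  by field; rewrite gt_eqF// ltr_wpDl.
have mc : -1 < - c by rewrite ltrN2.
have ncc : - c <= c by rewrite ge0_cp.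
have [jc _] := rAC_FTC fac mc ncc c1.
have mcc : @measurable _ (measurableTypeR R) `[- c, c]%classic by exact: measurable_itv.
have cI : `[- c, c]%classic `<=` I.
  move=> t; rewrite inI /= in_itv/= => /andP[h1 h2].
  by rewrite (lt_le_trans mc)//= (le_lt_trans h2).
have dist x y : - c <= x -> x <= y -> y <= c ->
    `|f y - f x| <= \int[mu]_(t in `[- c, c]) `|derive1 f t|.
  move=> cx xy yc; have [||jxy ->] := @rAC_FTC _ f x y fac _ xy; [exact: lt_le_trans cx|exact: le_lt_trans c1|].
  have mxy : @measurable _ (measurableTypeR R) `[x, y]%classic by exact: measurable_itv.
  apply: le_trans (le_normr_Rintegral mxy jxy) _.
  apply: le_Rint_sub => //; last exact: rint_abs.
  by move=> t /=; rewrite !in_itv/= => /andP[/(le_trans cx) -> /le_trans]; exact.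
have fb : `|f b| <= `|f 0| + \int[mu]_(t in `[- c, c]) `|derive1 f t|.
  rewrite -lerBlDl (le_trans (lerB_dist _ _))//.
  have /andP[cb1 cb2] := cb.
  have nc0 : - c <= 0 by rewrite oppr_le0.
  by have [b0|/ltW b0] := leP 0 b; [apply: dist|rewrite distrC; apply: dist].
have jF : mu.-integrable `[- c, c] (EFin \o (fun x => derive1 f x ^+ 2 * (1 - x ^+ 2))).
  exact: (integrableS mI mcc cI jf).
have VI : V * \int[mu]_(t in `[- c, c]) `|derive1 f t| <= V * (M / e) + e / 2.
  rewrite -RintegralZl//; last exact: rint_abs.
  (* Young's inequality [V y <= e / 4 + (V y)^2 / e], where one factor [V] is then enlarged to
     [1 - t^2], so that the hypothesis on the derivative applies. *)
  apply: (@le_trans _ _ (\int[mu]_(t in `[- c, c]) (e / 4 + V / e * (derive1 f t ^+ 2 * (1 - t ^+ 2))))).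
    apply: (le_Rintegral mcc (rintZ mcc V (rint_abs jc)) (rintD mcc (rint_cst_itv _ _ _) (rintZ mcc (V / e) jF))).
    move=> t /=; rewrite in_itv/= => tc; rewrite /cst.
    have tV : V <= 1 - t ^+ 2 by rewrite VE lerB// -(real_normK (num_real t)) lerXn2r ?nnegrE// ler_norml.
    rewrite -(real_normK (num_real (derive1 f t))).
    set y := `|derive1 f t|; have y0 : 0 <= y by exact: normr_ge0.
    have h1 : V / e * (y ^+ 2 * V) <= V / e * (y ^+ 2 * (1 - t ^+ 2)).
      apply: ler_wpM2l; first by rewrite divr_ge0// ltW.
      by apply: ler_wpM2l => //; exact: sqr_ge0.
    apply: le_trans (lerD (lexx _) h1); rewrite -(ler_pM2l e0).
    have -> : e * (e / 4 + V / e * (y ^+ 2 * V)) = e ^+ 2 / 4 + (V * y) ^+ 2.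
      by field; rewrite gt_eqF.
    by have := sqr_ge0 (V * y - e / 2); clear -mI; lra.
  rewrite RintegralD//; [|exact: rint_cst_itv|exact: rintZ].
  rewrite (Rint_cst_itv _ ncc) RintegralZl//.
  have h1 : \int[mu]_(x in `[- c, c]) (derive1 f x ^+ 2 * (1 - x ^+ 2)) <= M.
    by rewrite ME; exact: le_Rint_sub.
  rewrite addrC; apply: lerD.
    rewrite [leRHS]mulrA [leRHS]mulrAC; apply: ler_wpM2l h1.
    by rewrite divr_ge0// ltW.
  by have := ler_wpM2l (ltW e0) (ltW c1); clear -mI; lra.
have := ler_wpM2l (ltW V0) fb; rewrite mulrDr => h.
have h2 : V * `|f 0| + V * (M / e) <= V * (K + 1) by rewrite -mulrDr ler_pM2l// KE lerDl.
apply: (le_trans h); apply: (le_trans (lerD (lexx _) VI)); rewrite addrA.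
by apply: (le_trans (lerD h2 (lexx _))); rewrite [leRHS]splitr; exact: lerD VK (lexx _).
Qed.

Definition rell (k : R) f : R -> R := fun x => - (1 - x ^+ 2) * derive1n 2 f x + k * f x.

(** * Green's formulas against a Jacobi polynomial *)

Section ByParts.
Variables (m : nat) (m1 : (1 < m)%N).
Let P := jac R m.
Let lam : R := (m * (m - 1))%N%:R.

(** In Sturm-Liouville form the differentiated equation says that [Q = (1 - x^2)^j P^(j+1)] has
    derivative [- (lam - j (j - 1)) (1 - x^2)^(j-1) P^(j)]; the identity is the vanishing of the
    integral of the derivative of [f^(j) Q]. *)
Lemma rip_jac_step n f j : rV n f -> (j < n)%N ->
  rip j%:Z (derive1n j.+1 f) (derive1n j.+1 (horner P)) =
  (lam - (j * j.-1)%N%:R) * rip (j%:Z - 1) (derive1n j f) (derive1n j (horner P)).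
Proof.
move=> [fn lf] jn.
pose Q : {poly R} := P^`(j.+1) * (1 - 'X^2) ^+ j.
have Q' x : I x -> (Q^`()).[x] = - (lam - (j * j.-1)%N%:R) * ((P^`(j)).[x] * weight (j%:Z - 1) x).
  move=> Ix; have v0 := one_sub_sqr_gt0 Ix.
  have := congr1 (horner^~ x) (@jac_derivn_ode R m j (ltnW m1)).
  rewrite /= hornerD hornerN hornerMn !hornerM hornerX hornerZ hornerD hornerN hornerXn hornerC -/P.
  rewrite -/lam => ode.
  have wj : weight (j%:Z - 1) x * (1 - x ^+ 2) = (1 - x ^+ 2) ^+ j.
    by rewrite -weight1 -weightD// subrK.
  apply: (mulIf (lt0r_neq0 v0)); have -> : - (lam - (j * j.-1)%N%:R) * ((P^`(j)).[x] * weight (j%:Z - 1) x) * (1 - x ^+ 2) =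
    - (lam - (j * j.-1)%N%:R) * (P^`(j)).[x] * (weight (j%:Z - 1) x * (1 - x ^+ 2)) by ring.
  rewrite wj -ode /Q derivM deriv_exp derivB derivC derivXn !hornerD !hornerM -derivnS.
  rewrite !hornerMn horner_exp hornerD hornerN hornerXn hornerC.
  rewrite hornerM horner_exp hornerD !hornerN hornerMn !hornerXn !hornerC expr1.
  have e : (1 - x ^+ 2) * ((1 - x ^+ 2) ^+ j.-1 *+ j) = (1 - x ^+ 2) ^+ j *+ j.
    by case: (j) => [|i]; [rewrite !mulr0n mulr0|rewrite mulrnAr -exprS].
  rewrite hornerD hornerN hornerXn hornerC -derivnS.
  move: e; set v := 1 - x ^+ 2; set p := v ^+ j.-1; set q := v ^+ j => e.
  transitivity ((P^`(j.+2)).[x] * q * v - (P^`(j.+1)).[x] * (x *+ 2) * (v * (p *+ j))); first by ring.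
  rewrite e; ring.
pose B x := derive1n j f x * Q.[x].
have acB : rAC B by apply: rACM; [exact: fn.2|exact: rAC_poly].
have ej : j.+1%:Z - 1 = j%:Z by rewrite -addn1 PoszD addrK.
have lj := lf j (ltnW jn); have := lf j.+1 jn; rewrite ej => lj1.
have lP : rL2 (j%:Z - 1) (derive1n j (horner P)) by apply: (rV_jac n m1).2; exact: ltnW.
have := (rV_jac n m1).2 j.+1 jn; rewrite ej => lP1.
have j1 := rL2_prod lj1 lP1; have j0 := rL2_prod lj lP.
pose Th x := derive1n j.+1 f x * derive1n j.+1 (horner P) x * weight j x +
  - (lam - (j * j.-1)%N%:R) * (derive1n j f x * derive1n j (horner P) x * weight (j%:Z - 1) x).
have dB : {ae mu, forall x, I x -> Th x = derive1 B x}.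
  apply: ae_imp (rAC_ae_derivable (fn.2 j jn)) => x dx Ix.
  rewrite derive1M; [|exact: dx|exact: derivable_horner].
  rewrite -[derive1 (derive1n j f) x]/(derive1n j.+1 f x) -derivE Q'// /Th !derive1n_poly /Q.
  rewrite hornerM horner_exp hornerD hornerN hornerXn hornerC.
  have -> : weight j x = (1 - x ^+ 2) ^+ j by [].
  ring.
have jT : rint Th by exact: (rintD mI j1 (rintZ mI _ j0)).
have mB : measurable_fun I (derive1 B) by exact: rAC_derive1_measurable.
have jB : rint (derive1 B) by exact: ae_integrable dB jT.
(* [B^2 / (1 - x^2)] is the bounded polynomial [(P^(j+1))^2 (1 - x^2)^j] times
   [(f^(j))^2 (1 - x^2)^(j-1)], so the boundary argument for [rL2 (-1)] applies to [B]. *)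
have lB : rL2 (-1) B.
  split; first exact: rAC_measurable.
  have [M HM] := poly_bounded (P^`(j.+1) ^+ 2 * (1 - 'X^2) ^+ j).
  apply: (rint_le mI _ _ (rintZ mI M lj.2)).
    apply: measurable_funM; last exact: weight_measurable.
    by apply: measurable_funX; exact: rAC_measurable.
  move=> x Ix; have := HM x Ix.
  rewrite hornerM !horner_exp hornerD hornerN hornerXn hornerC => hM.
  have -> : B x ^+ 2 * weight (-1) x = (P^`(j.+1).[x] ^+ 2 * (1 - x ^+ 2) ^+ j) *
      (derive1n j f x ^+ 2 * weight (j%:Z - 1) x).
    rewrite weightD// /B /Q hornerM horner_exp hornerD hornerN hornerXn hornerC.
    have -> : weight j x = (1 - x ^+ 2) ^+ j by [].
    ring.
  have h0 : 0 <= derive1n j f x ^+ 2 * weight (j%:Z - 1) x.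
    by rewrite mulr_ge0 ?sqr_ge0// ltW// weight_gt0.
  by rewrite normrM (ger0_norm h0) ler_wpM2r.
have := rL2_boundary_Rintegral acB jB lB.
rewrite -(ae_Rintegral mI (rint_measurable jT) mB dB) RintegralD//; last exact: rintZ.
by rewrite RintegralZl// mulNr => /eqP; rewrite subr_eq0 => /eqP.
Qed.

Lemma rip_jac n f j : rV n f -> (j <= n)%N ->
  rip (j%:Z - 1) (derive1n j f) (derive1n j (horner P)) =
  jfact lam j * rip (-1) f (horner P).
Proof.
move=> fn; elim: j => [|j IH] jn; first by rewrite /jfact big_ord0 mul1r.
rewrite (_ : j.+1%:Z - 1 = j%:Z); last by rewrite -addn1 PoszD addrK.
by rewrite (rip_jac_step fn jn) IH ?(ltnW jn)// jfactS mulrCA mulrA.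
Qed.

Lemma ripn_jac n k f : (0 < n)%N -> rV n f ->
  ripn n k f (horner P) = (lam + k) ^+ n * rip (-1) f (horner P).
Proof.
move=> n0 fn; rewrite -sum_coef_jfact// mulr_suml; apply: eq_bigr => -[j /=].
by rewrite ltnS => jn _; rewrite (rip_jac fn jn) mulrA.
Qed.

(** Lagrange's identity: the integrands differ by the derivative of the Wronskian [f' P - f P'].
    Here [f'] is not known to lie in a weighted space, so its boundary term needs [rAC_growth]. *)
Lemma rip_rell k f : rACn 2 f -> rL2 (-1) f -> rL2 (-1) (rell k f) ->
  rip (-1) (rell k f) (horner P) = (lam + k) * rip (-1) f (horner P).
Proof.
move=> f2 lf lg.
have acf : rAC f by exact: (f2.2 0%N _).
have acf' : rAC (derive1 f) by exact: (f2.2 1%N _).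
have mf2 : measurable_fun I (derive1n 2 f) by exact: rACn_measurable f2 _.
have v0 x : I x -> 1 - x ^+ 2 != 0 by move=> /one_sub_sqr_gt0/lt0r_neq0.
(* [(1 - x^2) f''] equals [k f - rell k f] and so lies in [rL2 (-1)]. *)
have jf2 : rint (fun x => derive1n 2 f x ^+ 2 * (1 - x ^+ 2)).
  have [_ jh] := rL2_lcomb (-1) lg (rL2_lcomb k lf (@rL2_0 R (-1))).
  apply: eq_integrable jh => // x; rewrite inE => Ix; apply: (congr1 EFin).
  by rewrite /lcomb /rell /weight exprN1; field; exact: v0.
pose B := lcomb (-1) (fun x => f x * (P^`()).[x]) (fun x => derive1 f x * P.[x]).
have acB : rAC B by apply: rAC_lcomb; apply: rACM => //; exact: rAC_poly.
have lP : rL2 (-1) (horner P) by exact: rL2_jac.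
have jg := rL2_prod lg lP; have jf := rL2_prod lf lP.
pose Th x := (lam + k) * (f x * P.[x] * weight (-1) x) + (-1) * (rell k f x * P.[x] * weight (-1) x).
have dB : {ae mu, forall x, I x -> Th x = derive1 B x}.
  apply: ae_imp (rAC_ae_derivable acf') => x dx Ix.
  have df : derivable f x 1 by exact: (f2.1 0%N _ x Ix).
  have dp (p : {poly R}) : derivable (horner p) x 1 by exact: derivable_horner.
  have [_ ->] := derive1_lcomb (-1) (derivableM df (dp P^`())) (derivableM (dx Ix) (dp P)).
  rewrite /lcomb (derive1M df (dp _)) (derive1M (dx Ix) (dp _)) -!derivE.
  have := congr1 (horner^~ x) (@jac_derivn_ode R m 0 (ltnW m1)).
  rewrite /= hornerD hornerN hornerMn !hornerM hornerX hornerZ hornerD hornerN hornerXn hornerC.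
  rewrite !muln0 !mulr0n !subr0 -/P -/lam => ode.
  have {ode} -> : ((P^`())^`()).[x] = - lam * P.[x] / (1 - x ^+ 2).
    by rewrite -ode mulrAC mulfV ?mul1r// v0.
  rewrite -[derive1 (derive1 f) x]/(derive1n 2 f x) /Th /rell /weight exprN1.
  by field; exact: v0.
have jT : rint Th by exact: (rintD mI (rintZ mI _ jf) (rintZ mI _ jg)).
have mB : measurable_fun I (derive1 B) by exact: rAC_derive1_measurable.
have jB : rint (derive1 B) by exact: ae_integrable dB jT.
have : \int[mu]_(x in I) derive1 B x = 0.
  apply: boundary_Rintegral => // e e0 n.
  have [M HM] := poly_bounded P^`(); have [Q HQ] := poly_bounded (jacq R m).
  pose M' := `|M| + 1; pose Q' := `|Q| + 1.
  have M'0 : 0 < M' by rewrite ltr_wpDl.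
  have Q'0 : 0 < Q' by rewrite ltr_wpDl.
  have eQ : 0 < e / 2 / Q' by rewrite !divr_gt0.
  have eM : 0 < e / 2 / M' by rewrite !divr_gt0.
  have [N NP] := rAC_growth acf' jf2 eQ.
  have [a [b [a1 aN bN b1 [fa fb]]]] := rL2_small_points (maxn n N) lf eM.
  have hn : exh R n <= exh R (maxn n N) by rewrite exh_le// leq_maxl.
  have hN : exh R N <= exh R (maxn n N) by rewrite exh_le// leq_maxr.
  (* The term [f' P] is small at all points near the ends, [f P'] only where [f] is small; the
     selected points satisfy both. *)
  have Bx x : I x -> exh R (maxn n N) <= `|x| -> `|f x| <= e / 2 / M' -> `|B x| <= e.
    move=> Ix xN fx; have h1 := NP x Ix (le_trans hN xN).
    have Mx : `|P^`().[x]| <= M' by rewrite (le_trans (HM x Ix))// (le_trans (ler_norm _))// lerDl.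
    have Qx : `|(jacq R m).[x]| <= Q' by rewrite (le_trans (HQ x Ix))// (le_trans (ler_norm _))// lerDl.
    rewrite /B /lcomb mulN1r (le_trans (ler_normD _ _))// normrN !normrM.
    rewrite (splitr e) lerD//.
      by rewrite -[leRHS](divfK (lt0r_neq0 M'0)) ler_pM.
    rewrite jac_hornerE// normrM (gtr0_norm (one_sub_sqr_gt0 Ix)).
    rewrite -[leRHS](divfK (lt0r_neq0 Q'0)) mulrA [_ * (1 - _)]mulrC.
    by apply: ler_pM => //; rewrite mulr_ge0// ltW// one_sub_sqr_gt0.
  have [[Ia na] [Ib nb]] := (exh_left a1 aN, exh_right bN b1).
  exists a, b; split => //; first by rewrite (le_trans aN)// lerN2.
    exact: le_trans bN.
  by split; exact: Bx.
rewrite -(ae_Rintegral mI (rint_measurable jT) mB dB) RintegralD//; try exact: rintZ.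
by rewrite !RintegralZl// mulN1r => /eqP; rewrite subr_eq0 => /eqP.
Qed.

End ByParts.

End BoundaryTerms.

(** * Totality of the Jacobi polynomials *)

Section Totality.
Variable R : realType.
Local Notation mu := (@lebesgue_measure R).
Local Notation I := (`]-1, 1[%classic : set R).
Local Notation rint f := (mu.-integrable I (EFin \o f)).
Implicit Types (f g h : R -> R) (w : int) (a b c x y : R).

Let mI : @measurable _ (measurableTypeR R) I := @measI R.

Lemma sub_I a b : -1 < a -> b < 1 -> `[a, b]%classic `<=` I.
Proof.
move=> a1 b1 t; rewrite inI /= in_itv/= => /andP[h1 h2].
by rewrite (lt_le_trans a1)//= (le_lt_trans h2).
Qed.

(** The zero function is then a primitive of [f], and at a point of continuity its derivative is
    [f x]. *)
Lemma ae_continuous_eq0 f : (forall x, I x -> {for x, continuous f}) ->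
  {ae mu, forall x, I x -> f x = 0} -> forall x, I x -> f x = 0.
Proof.
move=> cf f0 x Ix.
have [|_ <-] := @primitive_I_continuous R (fun=> 0) f x _ Ix (cf x Ix); last exact: derive1_cst.
move=> a b a1 ab b1; have sub := sub_I a1 b1.
have mab : @measurable _ (measurableTypeR R) `[a, b]%classic by exact: measurable_itv.
have mf : measurable_fun `[a, b] f by apply: measurable_funS sub (continuous_measurable_I cf).
have aeq : {ae mu, forall x, `[a, b]%classic x -> (fun=> 0 : R) x = f x}.
  by apply: ae_imp f0 => t ft tab; rewrite ft//; exact: sub.
split; first exact: ae_integrable aeq (rint_cst_itv a b 0).
by rewrite -(ae_Rintegral mab _ mf aeq)// Rint_cst_itv// mul0r subrr.
Qed.

Lemma Rintegral_eq0 (D : set R) f : (forall x, D x -> f x = 0) -> \int[mu]_(x in D) f x = 0.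
Proof.
move=> f0; have -> : \int[mu]_(x in D) f x = \int[mu]_(x in D) (cst 0 x).
  by apply: eq_Rintegral => x; rewrite inE => /f0.
by rewrite /Rintegral integral0.
Qed.

Lemma poly_eq0_I (p : {poly R}) : (forall x, I x -> p.[x] = 0) -> p = 0.
Proof.
move=> p0; apply/eqP/negPn/negP => pn0.
have := @max_poly_roots _ p [seq exh R n | n <- iota 0 (size p)] pn0.
rewrite size_map size_iota ltnn => H; apply: notF; apply: H.
  apply/allP => x /mapP[n _ ->]; apply/rootP; apply: p0.
  by rewrite inI exh_lt1 (lt_trans _ (exh_gt0 R n)).
rewrite map_inj_uniq ?iota_uniq// => m n.
move=> /(congr1 (fun z => 1 - z)); rewrite /exh !opprB !(addrC 1) !subrK.
by move=> /invr_inj/eqP; rewrite eqr_nat => /eqP[].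
Qed.

Definition jlam m : R := (m * (m - 1))%N%:R.

Lemma jlam_inj m l : (1 < m)%N -> (1 < l)%N -> jlam m = jlam l -> m = l.
Proof. by move=> m1 l1 /eqP; rewrite eqr_nat => /eqP h; nia. Qed.

Lemma rell_jac k m x : (1 < m)%N ->
  rell k (horner (jac R m)) x = (jlam m + k) * (jac R m).[x].
Proof.
move=> m1; rewrite /rell derive1n_poly /jlam.
have := congr1 (horner^~ x) (@jac_derivn_ode R m 0 (ltnW m1)).
rewrite /= hornerD hornerN hornerMn !hornerM hornerX hornerZ hornerD hornerN hornerXn hornerC.
rewrite !muln0 !mulr0n !subr0 => ode.
by rewrite mulNr ode; ring.
Qed.

(** Taking [rip_rell] for [jac m] with parameter 0 multiplies the same inner product by [jlam m] on
    one side and by [jlam l] on the other, and these differ. *)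
Lemma rip_jac_orth m l : (1 < m)%N -> (1 < l)%N -> m != l ->
  rip (-1) (horner (jac R m)) (horner (jac R l)) = 0.
Proof.
move=> m1 l1 ml; have lm := @rL2_jac R m m1.
have e : rell 0 (horner (jac R m)) = lcomb (jlam m) (horner (jac R m)) (fun=> 0).
  by apply/funext => x; rewrite rell_jac// /lcomb !addr0.
have lr : rL2 (-1) (rell 0 (horner (jac R m))) by rewrite e; apply: rL2_lcomb => //; exact: rL2_0.
have := rip_rell l1 (rACn_poly 2 (jac R m)) lm lr.
rewrite e rip_lcomb ?addr0//; [|exact: rL2_0|exact: rL2_jac].
rewrite [X in _ + X](_ : _ = 0); last first.
  by apply: Rintegral_eq0 => x _; rewrite !mul0r.
rewrite addr0 => /eqP; rewrite -subr_eq0 -mulrBl mulf_eq0 => /orP[|/eqP//].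
by rewrite subr_eq0 => /eqP /(jlam_inj m1 l1) mle; rewrite mle eqxx in ml.
Qed.

Lemma rip_jac_gt0 m : (1 < m)%N -> 0 < rip (-1) (horner (jac R m)) (horner (jac R m)).
Proof.
move=> m1; rewrite lt_neqAle rip_ge0 andbT eq_sym; apply/negP => /eqP h.
have := rip_eq0_ae (@rL2_jac R m m1) h => /ae_continuous_eq0 z.
have := jac_neq0 R m1; rewrite (@poly_eq0_I (jac R m)) ?eqxx// => x Ix; apply: z => // y _.
exact: continuous_horner.
Qed.

Lemma bernoulli_le (y : R) n : 0 <= y -> y <= 1 -> 1 - n%:R * y <= (1 - y) ^+ n.
Proof.
move=> y0 y1; elim: n => [|n IH]; first by rewrite mul0r subr0 expr0.
rewrite exprS; apply: le_trans (ler_wpM2l _ IH); last by rewrite subr_ge0.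
rewrite -natr1; have n0 : 0 <= n%:R * y * y by rewrite !mulr_ge0.
by clear IH; nra.
Qed.

Lemma bernoulli_ge (y : R) n : 0 <= y -> y <= 1 -> (1 - y) ^+ n * (n%:R * y) <= 1.
Proof.
move=> y0 y1; apply: (@le_trans _ _ ((1 - y) ^+ n * (1 + n%:R * y))).
  by rewrite ler_wpM2l ?exprn_ge0 ?subr_ge0// lerDr.
elim: n => [|n IH]; first by rewrite mul0r addr0 mulr1 expr0.
apply: le_trans IH; rewrite exprSr -mulrA ler_wpM2l ?exprn_ge0 ?subr_ge0//.
rewrite -natr1; have n0 : 0 <= n%:R * y * y by rewrite !mulr_ge0.
by nra.
Qed.

(** Bernoulli's inequality compares the power with [2^n t^n = (2 t)^n]; the exponent [2^n] thus puts
    the jump at [t = 1/2]. *)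
Lemma step_cvg1 (t : R) : 0 <= t -> t < 1 / 2 ->
  (1 - t ^+ n) ^+ (2 ^ n)%N @[n --> \oo] --> (1 : R).
Proof.
move=> t0 t2; apply: (@squeeze_cvgr _ _ _ _ (fun n => 1 - (2 * t) ^+ n) (fun=> 1)).
- apply: nearW => n; have tn0 : 0 <= t ^+ n by exact: exprn_ge0.
  have tn1 : t ^+ n <= 1 by rewrite exprn_ile1// ltW// (lt_trans t2)//; lra.
  apply/andP; split; last by rewrite exprn_ile1 ?subr_ge0// gerBl.
  by have := bernoulli_le (2 ^ n)%N tn0 tn1; rewrite natrX -exprMn.
- rewrite -[X in _ --> X]subr0; apply: cvgB; first exact: cvg_cst.
  by apply: cvg_expr; rewrite ger0_norm ?mulr_ge0//; lra.
- exact: cvg_cst.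
Qed.

Lemma step_cvg0 (t : R) : 1 / 2 < t -> t <= 1 ->
  (1 - t ^+ n) ^+ (2 ^ n)%N @[n --> \oo] --> (0 : R).
Proof.
move=> t2 t1; have t0 : 0 < t by lra.
apply: (@squeeze_cvgr _ _ _ _ (fun=> 0) (fun n => ((2 * t)^-1) ^+ n)).
- apply: nearW => n; have tn0 : 0 < t ^+ n by exact: exprn_gt0.
  have tn1 : t ^+ n <= 1 by rewrite exprn_ile1// ltW.
  apply/andP; split; first by rewrite exprn_ge0// subr_ge0.
  have := bernoulli_ge (2 ^ n)%N (ltW tn0) tn1; rewrite natrX -exprMn exprVn.
  by rewrite -ler_pdivlMr ?mul1r// exprn_gt0// mulr_gt0.
- exact: cvg_cst.
- apply: cvg_expr; rewrite ger0_norm ?invr_ge0 ?mulr_ge0// ?ltW//.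
  by rewrite invf_lt1 ?mulr_gt0//; lra.
Qed.

Lemma rL2_rint f : rL2 (-1) f -> rint f.
Proof.
move=> [mf jf]; have j1 : rint (cst 1) by apply: (@rint_bounded R _ 1) => // x _; rewrite normr1.
apply: (rint_le mI mf _ (rintD mI j1 jf)) => x Ix; rewrite /cst.
have h : f x ^+ 2 <= f x ^+ 2 * weight (-1) x.
  rewrite ler_peMr ?sqr_ge0// /weight exprN1 invf_ge1 ?one_sub_sqr_gt0//.
  by rewrite gerBl sqr_ge0.
apply: le_trans (lerD (lexx _) h); rewrite -(real_normK (num_real (f x))).
by have := sqr_ge0 (`|f x| - 1); have := normr_ge0 (f x); nra.
Qed.

Section Orthogonal.
Variables (f : R -> R) (lf : rL2 (-1) f).
Hypothesis f_jac : forall m, (1 < m)%N -> rip (-1) f (horner (jac R m)) = 0.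

Let rint_mul_poly (q : {poly R}) : rint (fun x => f x * q.[x]).
Proof.
have [M HM] := poly_bounded q; have jf := rL2_rint lf.
apply: (rint_le mI _ _ (rintZ mI M (rint_abs jf))).
  by apply: measurable_funM; [exact: lf.1|exact: measurable_horner].
by move=> x Ix; rewrite normrM mulrC ler_wpM2r// HM.
Qed.

(** The weight cancels the factor [1 - x^2] of [jac m]: weighted orthogonality to the [jac m] is
    unweighted orthogonality to the [jacq m], which span all polynomials. *)
Lemma Rintegral_mul_poly_eq0 (q : {poly R}) : \int[mu]_(x in I) (f x * q.[x]) = 0.
Proof.
have [c ->] := poly_jacq_span q.
elim/big_ind: _ => [|p1 p2 h1 h2|i _].
- by apply: Rintegral_eq0 => x _; rewrite horner0 mulr0.
- have -> : \int[mu]_(x in I) (f x * (p1 + p2).[x]) =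
            \int[mu]_(x in I) (f x * p1.[x] + f x * p2.[x]).
    by apply: eq_Rintegral => x _; rewrite hornerD mulrDr.
  by rewrite RintegralD// h1 h2 addr0.
- have -> : \int[mu]_(x in I) (f x * (c i *: jacq R i.+2).[x]) =
            \int[mu]_(x in I) (c i * (f x * (jacq R i.+2).[x])).
    by apply: eq_Rintegral => x _; rewrite hornerZ mulrCA.
  rewrite RintegralZl// (_ : \int[mu]_(x in I) _ = 0) ?mulr0//.
  rewrite -[RHS](@f_jac i.+2 isT); apply: eq_Rintegral => x; rewrite inE => Ix.
  rewrite jac_hornerE// /weight exprN1; field.
  by rewrite lt0r_neq0// one_sub_sqr_gt0.
Qed.

(* The polynomials [(1 - T^n)^(2^n)], with [T] affine, increasing from (-1,1) into
   (0,1) and equal to 1/2 at [c], tend to the indicator function of [x < c]. *)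
Lemma Rintegral_left_eq0 c : I c -> \int[mu]_(x in I) (f x * \1_(`]-oo, c[%classic) x) = 0.
Proof.
rewrite inI => /andP[c1 c2].
(* As [|x - c| < 2] on (-1,1), the slope 1/4 keeps the values of [T] strictly between 0 and 1. *)
pose T : {poly R} := 2^-1%:P + 4^-1 *: ('X - c%:P).
pose q n : {poly R} := (1 - T ^+ n) ^+ (2 ^ n)%N.
have TE x : T.[x] = 2^-1 + 4^-1 * (x - c) by rewrite /T hornerD hornerZ hornerXsubC hornerC.
have qE n x : (q n).[x] = (1 - T.[x] ^+ n) ^+ (2 ^ n)%N.
  by rewrite /q horner_exp hornerD hornerN horner_exp hornerC.
pose h x := f x * \1_(`]-oo, c[%classic) x.
have mh : measurable_fun I h by apply: measurable_funM; [exact: lf.1|exact: measurable_indic].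
have T01 x : I x -> 0 < T.[x] < 1.
  by rewrite inI TE => /andP[? ?]; apply/andP; split; lra.
(* The point [c] is excluded: there the polynomials tend to 1/e, which is not a value of the
   indicator. *)
have nc : {ae mu, forall x, x != c}.
  exists [set c]; split => //; first exact: lebesgue_measure_set1.
  by move=> x /= /negP; rewrite negbK => /eqP.
have [|||||jh _] := @dominated_convergence _ (measurableTypeR R) R mu I mI
  (fun n x => (f x * (q n).[x])%:E) (EFin \o h) (fun x => `|f x|%:E).
- by move=> n; exact: (measurable_int mu (rint_mul_poly (q n))).
- exact/measurable_EFinP.
- apply: ae_imp nc => x xc Ix; apply: cvg_EFin; first exact: nearW.
  apply: cvgM; first exact: cvg_cst.
  have /andP[/ltW T0 T1] := T01 x Ix.
  have -> : (fun n => (q n).[x]) = (fun n => (1 - T.[x] ^+ n) ^+ (2 ^ n)%N) by apply/funext => n.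
  rewrite indicE mem_setE in_itv/=; case: ltP => cx.
    by apply: step_cvg1 => //; rewrite TE; lra.
  have {}cx : c < x by rewrite lt_neqAle eq_sym xc.
  by apply: step_cvg0; [rewrite TE; lra|exact: ltW].
- exact: rint_abs (rL2_rint lf).
- apply: aeW => x n Ix; rewrite lee_fin normrM ler_piMr//.
  have /andP[/ltW T0 /ltW T1] := T01 x Ix.
  have h1 : T.[x] ^+ n <= 1 by exact: exprn_ile1.
  have h0 : 0 <= 1 - T.[x] ^+ n by rewrite subr_ge0.
  rewrite qE ger0_norm ?exprn_ge0// exprn_ile1// gerBl; exact: exprn_ge0.
have z n : (\int[mu]_(x in I) (f x * (q n).[x])%:E)%E = 0%E.
  apply/eqP; rewrite -fine_eq0; last exact: integrable_fin_num (rint_mul_poly (q n)).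
  by apply/eqP; exact: Rintegral_mul_poly_eq0.
have -> : [sequence (\int[mu]_(x in I) (f x * (q n).[x])%:E)%E]_n = cst 0%E.
  by apply/funext => n; exact: z.
move=> H; have := cvg_lim (@ereal_hausdorff R) H; rewrite lim_cst//.
by rewrite /Rintegral => <-.
Qed.

(** Subtracting two half-line indicators shows that the integral of [f] over every compact
    subinterval is 0. The zero function is then a primitive of [f], so [f] is its derivative almost
    everywhere. *)
Lemma orthogonal_jac_eq0 : {ae mu, forall x, I x -> f x = 0}.
Proof.
have jf := rL2_rint lf.
have jh c : rint (fun x => f x * \1_(`]-oo, c[%classic) x).
  apply: (rint_le mI _ _ (rint_abs jf)).
    by apply: measurable_funM; [exact: lf.1|exact: measurable_indic].
  by move=> x _; rewrite normrM ler_piMr// indicE; case: (_ \in _); rewrite /= ?normr1 ?normr0.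
have key a b : -1 < a -> a <= b -> b < 1 -> \int[mu]_(t in `[a, b]) f t = 0.
  move=> a1 ab b1.
  have Ia : I a by rewrite inI a1 (le_lt_trans ab).
  have Ib : I b by rewrite inI b1 (lt_le_trans a1).
  have mab : @measurable _ (measurableTypeR R) `[a, b[%classic by exact: measurable_itv.
  have sub : `[a, b[%classic `<=` I.
    by move=> t; rewrite inI /= in_itv/= => /andP[h1 h2]; rewrite (lt_le_trans a1)//= (lt_trans h2).
  have jab : mu.-integrable `[a, b[ (EFin \o f) by exact: (integrableS mI mab sub jf).
  rewrite -(Rintegral_itv_bndo_bndc jab).
  have := RintegralB mI (jh b) (jh a); rewrite !Rintegral_left_eq0// subrr.
  have IE : I = `[a, b[%classic `|` (I `\` `[a, b[) by rewrite setDUK.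
  have mB : @measurable _ (measurableTypeR R) (I `\` `[a, b[) by exact: measurableD.
  have dis : [disjoint `[a, b[%classic & I `\` `[a, b[] by rewrite disj_set2E setDIK.
  rewrite [in LHS]IE Rintegral_setU//; last by rewrite -IE; exact: rintB (jh b) (jh a).
  rewrite [X in _ + X]Rintegral_eq0 ?addr0 => [<-|t [_ /= /negP tab]].
    apply: eq_Rintegral => t; rewrite inE /= in_itv/= => /andP[at_ tb].
    by rewrite !indicE !mem_setE !in_itv/= tb ltNge at_ mulr1 mulr0 subr0.
  rewrite in_itv/= negb_and -!ltNge -leNgt in tab.
  rewrite !indicE !mem_setE !in_itv/= -mulrBr.
  case/orP: tab => [ta|bt]; first by rewrite ta (lt_le_trans ta ab) subrr mulr0.
  by rewrite !ltNge bt (le_trans ab bt) subrr mulr0.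
have prim a b : -1 < a -> a <= b -> b < 1 ->
    mu.-integrable `[a, b] (EFin \o f) /\ (fun=> 0 : R) b - (fun=> 0 : R) a = \int[mu]_(t in `[a, b]) f t.
  move=> a1 ab b1; split; last by rewrite key// subrr.
  have mab : @measurable _ (measurableTypeR R) `[a, b]%classic by exact: measurable_itv.
  exact: (integrableS mI mab (sub_I a1 b1) jf).
apply: ae_imp (primitive_I_ae prim) => x Hx Ix; have [_ <-] := Hx Ix.
exact: derive1_cst.
Qed.

End Orthogonal.

End Totality.

Local Open Scope complex_scope.

(** * Orthonormal bases of complex Hilbert spaces *)

Section ComplexNumbers.
Variable R : realType.
Implicit Types (z w : R[i]).

(** The squared modulus as a real number, so that sums and bounds of coefficients stay in [R]. *)
Definition csq z : R := complex.Re z ^+ 2 + complex.Im z ^+ 2.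

Lemma csq_ge0 z : 0 <= csq z.
Proof. by rewrite addr_ge0 ?sqr_ge0. Qed.

Lemma mulcJ_csq z : z * z^* = (csq z)%:C.
Proof. by case: z => a b; rewrite /csq; simpc; congr (_ +i* _); ring. Qed.

Lemma csqM z w : csq (z * w) = csq z * csq w.
Proof. by case: z w => [a b] [c d]; rewrite /csq; simpc => /=; ring. Qed.

Lemma csqR (x : R) : csq x%:C = x ^+ 2.
Proof. by rewrite /csq /= expr0n addr0. Qed.

Lemma csq_eq0 z : csq z = 0 -> z = 0.
Proof.
case: z => a b /eqP; rewrite /csq /= paddr_eq0 ?sqr_ge0// !sqrf_eq0 => /andP[/eqP -> /eqP ->].
by [].
Qed.

Lemma csqN z : csq (- z) = csq z.
Proof. by case: z => a b; rewrite /csq /= !sqrrN. Qed.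

Lemma conjCRM (x : R) z : ((x%:C * z)^*)%R = x%:C * z^*.
Proof. by rewrite rmorphM; congr (_ * _); exact: conjc_real. Qed.

Lemma ReD z w : complex.Re (z + w) = complex.Re z + complex.Re w.
Proof. by case: z w => [a b] [c d]. Qed.

Lemma ImD z w : complex.Im (z + w) = complex.Im z + complex.Im w.
Proof. by case: z w => [a b] [c d]. Qed.

Lemma ReN z : complex.Re (- z) = - complex.Re z. Proof. by case: z. Qed.
Lemma ImN z : complex.Im (- z) = - complex.Im z. Proof. by case: z. Qed.

Lemma ReZ (x : R) z : complex.Re (x%:C * z) = x * complex.Re z.
Proof. by case: z => a b; simpc. Qed.

Lemma ImZ (x : R) z : complex.Im (x%:C * z) = x * complex.Im z.
Proof. by case: z => a b; simpc. Qed.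

Lemma Re_sum (I : Type) (r : seq I) (P : pred I) (F : I -> R[i]) :
  complex.Re (\sum_(i <- r | P i) F i) = \sum_(i <- r | P i) complex.Re (F i).
Proof. exact: (big_morph _ ReD erefl). Qed.

Lemma Im_sum (I : Type) (r : seq I) (P : pred I) (F : I -> R[i]) :
  complex.Im (\sum_(i <- r | P i) F i) = \sum_(i <- r | P i) complex.Im (F i).
Proof. exact: (big_morph _ ImD erefl). Qed.

Lemma Re_csq z : `|complex.Re z| <= Num.sqrt (csq z).
Proof. by rewrite -sqrtr_sqr ler_wsqrtr// lerDl sqr_ge0. Qed.

Lemma Im_csq z : `|complex.Im z| <= Num.sqrt (csq z).
Proof. by rewrite -sqrtr_sqr ler_wsqrtr// lerDr sqr_ge0. Qed.

End ComplexNumbers.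

(** * Hilbert spaces of representatives *)

Section Hilbert.
Variables (R : realType) (T : lmodType R[i]) (H : Defs.space T) (hH : hilbert H).
Local Notation X := (carrier H).
Implicit Types (x y z : T) (a : R[i]).

Definition nsq x : R := complex.Re (ip H x x).

Lemma carrier0 : X 0. Proof. by have [[]] := hH. Qed.

Lemma carrier_lin a x y : X x -> X y -> X (a *: x + y).
Proof. by have [[_ h] _ _] := hH => hx hy; exact: h. Qed.

Lemma carrierD x y : X x -> X y -> X (x + y).
Proof. by move=> hx hy; rewrite -[x]scale1r; exact: carrier_lin. Qed.

Lemma carrierZ a x : X x -> X (a *: x).
Proof. by move=> hx; rewrite -[_ *: _]addr0; apply: carrier_lin => //; exact: carrier0. Qed.

Lemma carrierB x y : X x -> X y -> X (x - y).
Proof. by move=> hx hy; rewrite -scaleN1r; apply: carrierD => //; exact: carrierZ. Qed.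

Lemma carrier_sum n (F : nat -> T) : (forall i, X (F i)) -> X (\sum_(i < n) F i).
Proof.
move=> hF; elim: n => [|n IH]; first by rewrite big_ord0; exact: carrier0.
by rewrite big_ord_recr; exact: carrierD.
Qed.

Lemma ip_lin a x y z : X x -> X y -> X z -> ip H (a *: x + y) z = a * ip H x z + ip H y z.
Proof. by have [_ [h _ _] _] := hH; exact: h. Qed.

Lemma ip_conj x y : X x -> X y -> ip H y x = ((ip H x y)^*)%R.
Proof. by have [_ [_ h _] _] := hH; exact: h. Qed.

Lemma ipDl x y z : X x -> X y -> X z -> ip H (x + y) z = ip H x z + ip H y z.
Proof. by move=> hx hy hz; rewrite -[x in x + y]scale1r ip_lin// mul1r. Qed.

Lemma ip0l z : X z -> ip H 0 z = 0.
Proof.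
move=> hz; have := ipDl carrier0 carrier0 hz; rewrite addr0 => /eqP.
by rewrite -subr_eq subrr => /eqP.
Qed.

Lemma ipZl a x z : X x -> X z -> ip H (a *: x) z = a * ip H x z.
Proof.
by move=> hx hz; rewrite -[_ *: _]addr0 ip_lin ?ip0l ?addr0//; exact: carrier0.
Qed.

Lemma ipZr a x z : X x -> X z -> ip H z (a *: x) = ((a^*)%R) * ip H z x.
Proof.
move=> hx hz; have hax := carrierZ a hx.
by rewrite (ip_conj hax hz) ipZl// rmorphM (ip_conj hx hz).
Qed.

Lemma ipBl x y z : X x -> X y -> X z -> ip H (x - y) z = ip H x z - ip H y z.
Proof.
move=> hx hy hz; rewrite -scaleN1r ipDl//; last exact: carrierZ.
by rewrite ipZl// mulN1r.
Qed.

Lemma ip_suml n (F : nat -> T) z : (forall i, X (F i)) -> X z ->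
  ip H (\sum_(i < n) F i) z = \sum_(i < n) ip H (F i) z.
Proof.
move=> hF hz; elim: n => [|n IH]; first by rewrite !big_ord0 ip0l.
by rewrite !big_ord_recr/= ipDl ?IH//; exact: carrier_sum.
Qed.

Lemma ip_nsq x : X x -> ip H x x = (nsq x)%:C.
Proof.
have [_ [_ _ h] _] := hH => /h; rewrite lecE /nsq => /andP[/= /eqP i0 _].
by case: (ip H x x) i0 => p q /= ->.
Qed.

Lemma nsq_ge0 x : X x -> 0 <= nsq x.
Proof. by have [_ [_ _ h] _] := hH => /h; rewrite lecE => /andP[]. Qed.

Lemma hnorm_sqr x : X x -> hnorm H x ^+ 2 = nsq x.
Proof. by move=> hx; rewrite sqr_sqrtr// nsq_ge0. Qed.

Lemma hnorm_eq0 x : X x -> hnorm H x = 0 <-> nsq x = 0.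
Proof.
move=> hx; split=> [h|h]; first by rewrite -hnorm_sqr// h expr0n.
by rewrite /hnorm -/(nsq x) h sqrtr0.
Qed.

Lemma hnorm_lt x (e : R) : X x -> 0 < e -> (hnorm H x < e) = (nsq x < e ^+ 2).
Proof.
move=> hx e0; rewrite -hnorm_sqr// ltr_pXn2r// nnegrE ?sqrtr_ge0// ltW//.
Qed.

Lemma nsq_lin a x y : X x -> X y ->
  nsq (a *: x + y) = csq a * nsq x + 2 * complex.Re (a * ip H x y) + nsq y.
Proof.
move=> hx hy; have hxy := carrier_lin a hx hy; have hax := carrierZ a hx.
rewrite /nsq ip_lin// (ip_conj hxy hx) (ip_conj hxy hy) !ip_lin// (ip_conj hx hy) !ip_nsq//.
case: (ip H x y) => p q; case: (a) => c d; rewrite /csq; simpc => /=; ring.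
Qed.

Lemma nsqZ a x : X x -> nsq (a *: x) = csq a * nsq x.
Proof.
move=> hx; rewrite -[_ *: _]addr0 nsq_lin//; last exact: carrier0.
rewrite (ip_conj carrier0 hx) ip0l// rmorph0 mulr0 /nsq ip0l; last exact: carrier0.
by rewrite /= mulr0 !addr0.
Qed.

Lemma nsqN x : X x -> nsq (- x) = nsq x.
Proof. by move=> hx; rewrite -scaleN1r nsqZ// /csq /= oppr0 expr0n addr0 sqrrN expr1n mul1r. Qed.

(** The form is only semidefinite, so [z] may have norm 0 without being 0. The norm of
    [x - t (x, z) z] gives a polynomial in [t], quadratic or affine accordingly, that covers both
    cases. *)
Lemma cauchy_schwarz x z : X x -> X z -> csq (ip H x z) <= nsq x * nsq z.
Proof.
move=> hx hz; set c := csq _; have c0 : 0 <= c by exact: csq_ge0.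
have key (t : R) : 0 <= t ^+ 2 * c * nsq z - 2 * t * c + nsq x.
  have := nsq_ge0 (carrier_lin (- (t%:C * ip H x z)) hz hx).
  rewrite nsq_lin// (ip_conj hx hz) mulNr -[t%:C * _ * _]mulrA mulcJ_csq -/c ReN ReZ /=.
  have -> : csq (- (t%:C * ip H x z)) = t ^+ 2 * c.
    by rewrite -mulN1r !csqM csqR /csq /= oppr0 expr0n addr0 sqrrN expr1n mul1r.
  by rewrite mulrN mulrA.
have [z0|z0] := eqVneq (nsq z) 0.
  rewrite z0 mulr0; rewrite leNgt; apply/negP => cp.
  (* If [nsq z] is 0 the polynomial is affine with slope [- 2 c]; at this [t] it takes the value
     -1. *)
  have := key ((nsq x + 1) / (2 * c)); rewrite z0 mulr0 add0r.
  have -> : 2 * ((nsq x + 1) / (2 * c)) * c = nsq x + 1 by field; rewrite gt_eqF.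
  by lra.
have zp : 0 < nsq z by rewrite lt_neqAle eq_sym z0 nsq_ge0.
have := key (nsq z)^-1.
have -> : (nsq z)^-1 ^+ 2 * c * nsq z - 2 * (nsq z)^-1 * c + nsq x = (nsq x * nsq z - c) / nsq z.
  by field.
by rewrite pmulr_lge0 ?invr_gt0// subr_ge0.
Qed.

(** This makes the inner product well defined on classes for [hsame]. *)
Lemma nsq0_ip x z : X x -> X z -> nsq x = 0 -> ip H x z = 0.
Proof.
move=> hx hz x0; apply: csq_eq0; apply/eqP; rewrite eq_le csq_ge0 andbT.
by have := cauchy_schwarz hx hz; rewrite x0 mul0r.
Qed.

Lemma hsameP x y : X x -> X y -> hsame H x y <-> nsq (x - y) = 0.
Proof.
move=> hx hy; have hxy := carrierB hx hy; split=> [[_ _ /hnorm_eq0]|]; first exact.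
by move=> /(hnorm_eq0 hxy).
Qed.

Lemma hsame_ipl x y z : hsame H x y -> X z -> ip H x z = ip H y z.
Proof.
move=> /[dup] [[hx hy _]] /(hsameP hx hy) xy hz.
by apply/eqP; rewrite -subr_eq0 -ipBl// nsq0_ip//; exact: carrierB.
Qed.

Lemma hsame_ipr x y z : hsame H x y -> X z -> ip H z x = ip H z y.
Proof.
move=> xy hz; have [hx hy _] := xy.
by rewrite (ip_conj hx hz) (ip_conj hy hz) (hsame_ipl xy).
Qed.

Lemma hsame_refl x : X x -> hsame H x x.
Proof. by move=> hx; apply/hsameP => //; rewrite subrr /nsq ip0l//; exact: carrier0. Qed.

Lemma nsq_complete (u : nat -> T) : (forall n, X (u n)) ->
  (forall e : R, 0 < e -> exists N, forall m n, (N <= n)%N -> (n <= m)%N ->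
     nsq (u m - u n) <= e) ->
  exists2 x, X x & forall e : R, 0 < e -> exists N, forall n, (N <= n)%N ->
     nsq (u n - x) <= e.
Proof.
move=> hu cu; have [_ _ hc] := hH; have hB m n : X (u m - u n) by exact: carrierB.
have [|x hx cx] := hc u hu.
  move=> e e0; have e20 : 0 < e ^+ 2 / 2 by rewrite divr_gt0// exprn_gt0.
  have [N NP] := cu _ e20; exists N => m n Nm Nn.
  have lt2 : e ^+ 2 / 2 < e ^+ 2 by lra.
  rewrite hnorm_lt// (le_lt_trans _ lt2)//.
  have [nm|/ltnW mn] := leqP n m; first exact: NP.
  by rewrite -opprB nsqN// NP.
exists x => // e e0; have s0 : 0 < Num.sqrt e by rewrite sqrtr_gt0.
have /cvgrPdist_lt/(_ _ s0)[N _ NP] := cx; exists N => n Nn.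
have := NP n Nn; rewrite sub0r normrN ger0_norm ?sqrtr_ge0//.
rewrite hnorm_lt//; last exact: carrierB.
by rewrite sqr_sqrtr ?(ltW e0)// => /ltW.
Qed.

End Hilbert.

(** * Orthonormal bases, expansions and Parseval's identity *)

Section OrthonormalBasis.
Variables (R : realType) (T : lmodType R[i]).
Implicit Types (H : Defs.space T) (x y z : T).

(** Totality can only conclude that the norm is 0, because vectors are representatives of
    classes. *)
Definition onb H (e : nat -> T) : Prop :=
  [/\ forall i, carrier H (e i),
      forall i j, ip H (e i) (e j) = (i == j)%:R &
      forall x, carrier H x -> (forall i, ip H x (e i) = 0) -> nsq H x = 0].

Section OneBasis.
Variables (H : Defs.space T) (hH : hilbert H) (e : nat -> T) (he : onb H e).
Local Notation X := (carrier H).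

Definition psum (a : nat -> R[i]) n : T := \sum_(i < n) a i *: e i.

Let Xe i : X (e i). Proof. by have [] := he. Qed.

Lemma carrier_psum a n : X (psum a n).
Proof. by apply: (carrier_sum hH n (F := fun i => a i *: e i)) => i; exact: carrierZ. Qed.

Lemma ip_psum a n y : X y -> ip H (psum a n) y = \sum_(i < n) a i * (ip H y (e i))^*.
Proof.
move=> hy; rewrite (ip_suml hH n (F := fun i => a i *: e i))//; last first.
  by move=> i; exact: carrierZ.
by apply: eq_bigr => i _; rewrite (ipZl hH)// (ip_conj hH hy).
Qed.

Lemma ip_psum_e a n j : ip H (psum a n) (e j) = if (j < n)%N then a j else 0.
Proof.
have [_ oe _] := he; rewrite ip_psum//.
under eq_bigr => i _ do rewrite oe rmorph_nat.
case: ltnP => jn.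
  rewrite (bigD1 (Ordinal jn))//= eqxx mulr1 big1 ?addr0// => i.
  by rewrite -val_eqE /= eq_sym => /negPf ->; rewrite mulr0.
by rewrite big1// => i _; rewrite gtn_eqF ?mulr0// (leq_trans _ jn).
Qed.

Lemma nsq_psum a n : nsq H (psum a n) = \sum_(i < n) csq (a i).
Proof.
rewrite /nsq ip_psum; last exact: carrier_psum.
rewrite Re_sum; apply: eq_bigr => i _.
by rewrite ip_psum_e ltn_ord mulcJ_csq.
Qed.

Lemma nsq_sub_psum x n : X x ->
  nsq H (x - psum (fun i => ip H x (e i)) n) = nsq H x - \sum_(i < n) csq (ip H x (e i)).
Proof.
move=> hx; set s := psum _ n; have hs : X s by exact: carrier_psum.
rewrite addrC -scaleN1r (nsq_lin hH)// /s nsq_psum -/s /csq /= oppr0 expr0n addr0 sqrrN expr1n mul1r.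
rewrite mulN1r ReN ip_psum// Re_sum.
under [X in 2 * - X]eq_bigr => i _ do rewrite mulcJ_csq.
rewrite /csq /=; ring.
Qed.

Lemma bessel x n : X x -> \sum_(i < n) csq (ip H x (e i)) <= nsq H x.
Proof.
move=> hx; rewrite -subr_ge0 -nsq_sub_psum//; apply: (nsq_ge0 hH).
by apply: carrierB => //; exact: carrier_psum.
Qed.

Lemma coef_hsame x y : X x -> X y -> (forall i, ip H x (e i) = ip H y (e i)) -> hsame H x y.
Proof.
move=> hx hy xy; apply/(hsameP hH) => //; have [_ _ tot] := he.
by apply: tot => [|i]; [exact: carrierB|rewrite (ipBl hH)// xy subrr].
Qed.

Lemma sum_ordB (V : zmodType) (F : nat -> V) m n : (n <= m)%N ->
  \sum_(i < m) F i - \sum_(i < n) F i = \sum_(i < m) (if (n <= i)%N then F i else 0).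
Proof.
move=> nm; rewrite -(big_mkord xpredT F) -(big_mkord xpredT (fun i => if (n <= i)%N then F i else 0)).
rewrite [X in X - _](@big_cat_nat _ _ _ n)//= big_mkord [LHS]addrC addKr.
rewrite [RHS](@big_cat_nat _ _ _ n)//=.
rewrite [X in _ = X + _]big1_seq ?add0r => [|i]; last first.
  by rewrite mem_index_iota /= => ni; rewrite leqNgt ni.
by rewrite !big_nat; apply: eq_bigr => i /andP[-> _].
Qed.

(** The sums of [csq (a i)] are monotone and bounded, so the partial sums of the series are Cauchy;
    Cauchy-Schwarz against [e i] carries the coefficients to the limit. *)
Lemma riesz_fischer_coef (a : nat -> R[i]) (M : R) : (forall n, \sum_(i < n) csq (a i) <= M) ->
  exists x, [/\ X x, forall i, ip H x (e i) = a i &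
    forall eps : R, 0 < eps -> exists N, forall n, (N <= n)%N ->
      nsq H (x - psum a n) <= eps].
Proof.
move=> aM; pose A n := \sum_(i < n) csq (a i).
have Ai : {homo A : n m / (n <= m)%N >-> n <= m}.
  apply: homo_leq => //; first exact: le_trans.
  by move=> n; rewrite /A big_ord_recr/= lerDl csq_ge0.
have cA : cvgn A by apply: nondecreasing_is_cvgn => //; exists M => _ [n _ <-]; exact: aM.
have [||x hx cx] := nsq_complete hH (u := psum a).
- exact: carrier_psum.
- move=> eps e0; have /cvgrPdist_lt/(_ _ e0)[N _ NP] := cA.
  exists N => m n Nn nm.
  pose b i := if (n <= i)%N then a i else 0.
  have -> : psum a m - psum a n = psum b m.
    rewrite /psum (sum_ordB (fun i => a i *: e i))//; apply: eq_bigr => i _.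
    by rewrite /b; case: ifP => //; rewrite scale0r.
  rewrite nsq_psum (_ : \sum_(i < m) _ = A m - A n); last first.
    rewrite /A (sum_ordB (fun i => csq (a i)))//; apply: eq_bigr => i _.
    by rewrite /b; case: ifP => //; rewrite csqR expr0n.
  have := NP n Nn; have := nondecreasing_cvgn_le Ai cA m => h1 h2.
  have := le_lt_trans (ler_norm _) h2; lra.
have cf i : ip H x (e i) = a i.
  apply/eqP; rewrite -subr_eq0; apply/eqP/csq_eq0/eqP; rewrite eq_le csq_ge0 andbT.
  apply/ler_addgt0Pr => eps e0; rewrite add0r; have [N NP] := cx eps e0.
  have := NP (maxn N i.+1) (leq_maxl _ _); set n := maxn N i.+1.
  have hs : X (psum a n) by exact: carrier_psum.
  have hd : X (psum a n - x) by exact: carrierB.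
  apply: le_trans; rewrite -[leRHS]mulr1.
  have e1 : nsq H (e i) = 1 by have [_ oe _] := he; rewrite /nsq oe eqxx.
  have := cauchy_schwarz hH hd (Xe i); rewrite e1 (ipBl hH)// ip_psum_e leq_maxr.
  by rewrite -csqN opprB.
exists x; split => // eps e0; have [N NP] := cx eps e0; exists N => n Nn.
rewrite -opprB (nsqN hH) ?NP//; by apply: carrierB => //; exact: carrier_psum.
Qed.

(** The vector rebuilt by Riesz-Fischer from the coefficients of [x] is in the class of [x] by
    totality, so the partial sums are equally far from both. *)
Lemma expansion x : X x -> forall eps : R, 0 < eps -> exists N, forall n, (N <= n)%N ->
  nsq H (x - psum (fun i => ip H x (e i)) n) <= eps.
Proof.
move=> hx eps e0.
have [y [hy cy yP]] := @riesz_fischer_coef (fun i => ip H x (e i)) _ (fun n => bessel n hx).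
have xy := coef_hsame hx hy (fun i => esym (cy i)).
have [N NP] := yP eps e0; exists N => n Nn; apply: le_trans (NP n Nn).
rewrite nsq_sub_psum//.
have -> : psum (fun i => ip H x (e i)) n = psum (fun i => ip H y (e i)) n.
  by apply: eq_bigr => i _; rewrite cy.
rewrite nsq_sub_psum// /nsq (hsame_ipl hH xy hx) (hsame_ipr hH xy hy).
by rewrite lerD2l lerN2; apply: ler_sum => i _; rewrite cy.
Qed.

Lemma parseval x y : X x -> X y -> forall eps : R, 0 < eps -> exists N, forall n, (N <= n)%N ->
  csq (ip H x y - \sum_(i < n) ip H x (e i) * (ip H y (e i))^*) <= eps.
Proof.
move=> hx hy eps e0; have y0 : 0 <= nsq H y by exact: nsq_ge0.
have e1 : 0 < eps / (nsq H y + 1) by rewrite divr_gt0// ltr_wpDl.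
have [N NP] := expansion hx e1; exists N => n Nn.
rewrite -(ip_psum (fun i => ip H x (e i)) n hy) -(ipBl hH)//; last exact: carrier_psum.
have hs : X (x - psum (fun i => ip H x (e i)) n).
  by apply: carrierB => //; exact: carrier_psum.
apply: le_trans (cauchy_schwarz hH hs hy) _.
apply: le_trans (ler_wpM2r y0 (NP n Nn)) _.
rewrite mulrAC ler_pdivrMr ?ltr_wpDl//.
by rewrite ler_pM2l// lerDl.
Qed.

Lemma parseval_Re x y : X x -> X y ->
  (fun n => complex.Re (\sum_(i < n) ip H x (e i) * (ip H y (e i))^*)) @ \oo
    --> complex.Re (ip H x y).
Proof.
move=> hx hy; apply/cvgrPdist_le => eps e0.
have [N NP] := parseval hx hy (exprn_gt0 2 e0); exists N => // n /= Nn.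
rewrite -ReN -ReD (le_trans (Re_csq _))//.
by rewrite -[leRHS](ger0_norm (ltW e0)) -sqrtr_sqr ler_wsqrtr// NP.
Qed.

Lemma parseval_Im x y : X x -> X y ->
  (fun n => complex.Im (\sum_(i < n) ip H x (e i) * (ip H y (e i))^*)) @ \oo
    --> complex.Im (ip H x y).
Proof.
move=> hx hy; apply/cvgrPdist_le => eps e0.
have [N NP] := parseval hx hy (exprn_gt0 2 e0); exists N => // n /= Nn.
rewrite -ImN -ImD (le_trans (Im_csq _))//.
by rewrite -[leRHS](ger0_norm (ltW e0)) -sqrtr_sqr ler_wsqrtr// NP.
Qed.

End OneBasis.

(** Two Parseval series, possibly in different spaces, are compared term by term. In [R[i]] an
    inequality includes equality of imaginary parts, so these pass to the limit as equalities and
    the real parts as inequalities. *)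
Lemma ip_le_coef H1 e1 H2 e2 x1 y1 x2 y2 : hilbert H1 -> onb H1 e1 -> hilbert H2 -> onb H2 e2 ->
  carrier H1 x1 -> carrier H1 y1 -> carrier H2 x2 -> carrier H2 y2 ->
  (forall i, ip H1 x1 (e1 i) * (ip H1 y1 (e1 i))^* <= ip H2 x2 (e2 i) * (ip H2 y2 (e2 i))^*) ->
  ip H1 x1 y1 <= ip H2 x2 y2.
Proof.
move=> h1 b1 h2 b2 c1 d1 c2 d2 le12; rewrite lecE; apply/andP; split.
  have i1 := parseval_Im h1 b1 c1 d1; have i2 := parseval_Im h2 b2 c2 d2.
  apply/eqP; apply: (cvg_unique _ i2); first exact: Rhausdorff.
  move: i1; apply: cvg_trans; apply: near_eq_cvg; apply: nearW => n.
  rewrite !Im_sum.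
  by apply: eq_bigr => i _; have := le12 i; rewrite lecE => /andP[/eqP].
apply: ler_cvg_to (parseval_Re h1 b1 c1 d1) (parseval_Re h2 b2 c2 d2) _.
apply: nearW => n.
rewrite !Re_sum.
by apply: ler_sum => i _; have := le12 i; rewrite lecE => /andP[].
Qed.

Lemma ip_eq_coef H1 e1 H2 e2 x1 y1 x2 y2 : hilbert H1 -> onb H1 e1 -> hilbert H2 -> onb H2 e2 ->
  carrier H1 x1 -> carrier H1 y1 -> carrier H2 x2 -> carrier H2 y2 ->
  (forall i, ip H1 x1 (e1 i) * (ip H1 y1 (e1 i))^* = ip H2 x2 (e2 i) * (ip H2 y2 (e2 i))^*) ->
  ip H1 x1 y1 = ip H2 x2 y2.
Proof.
move=> h1 b1 h2 b2 c1 d1 c2 d2 e12; apply: le_anti; apply/andP; split.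
  by apply: (ip_le_coef h1 b1 h2 b2) => // i; rewrite e12.
by apply: (ip_le_coef h2 b2 h1 b1) => // i; rewrite e12.
Qed.

End OrthonormalBasis.

(** * Diagonal operators *)

Section DiagonalOperator.
Variables (R : realType) (T : lmodType R[i]) (H : Defs.space T) (hH : hilbert H).
Variables (e : nat -> T) (he : onb H e) (l : nat -> R) (rho : R).
Hypotheses (rho_gt0 : 0 < rho) (l_ge : forall i, rho <= l i).
Variable S : Defs.operator T.
Local Notation X := (carrier H).
Local Notation cf x i := (ip H x (e i)).
Implicit Types (x y z : T).

Hypotheses (domS : Defs.subspace (odom S))
  (carS : forall x, odom S x -> X x /\ X (oact S x))
  (coefS : forall x, odom S x -> forall i, cf (oact S x) i = (l i)%:C * cf x i)
  (surjS : forall x z, X x -> X z -> (forall i, cf z i = (l i)%:C * cf x i) ->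
     exists2 x', odom S x' & hsame H x x')
  (eS : forall i, odom S (e i)).

Let Xe i : X (e i). Proof. by have [] := he. Qed.

(** The hypothesis [surjS] says that the domain is maximal up to [hsame]; with it the graph is a
    condition on coefficients alone. *)
Lemma diag_graph x z : graph H S x z <->
  [/\ X x, X z & forall i, cf z i = (l i)%:C * cf x i].
Proof.
split=> [[x' dx' [xx' zx']]|[hx hz xz]].
  have [hx _ _] := xx'; have [hz _ _] := zx'; split => // i.
  by rewrite (hsame_ipl hH zx')// coefS// (hsame_ipl hH xx').
have [x' dx' xx'] := surjS hx hz xz; exists x' => //; split => //.
have [hx' hSx'] := carS dx'; apply: (coef_hsame hH he) => // i.
by rewrite xz coefS// (hsame_ipl hH xx').
Qed.

Lemma diag_linear : linear_operator H S.
Proof.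
split=> //.
- move=> x y dx dy xy; have [_ hSx] := carS dx; have [_ hSy] := carS dy.
  by apply: (coef_hsame hH he) => // i; rewrite !coefS// (hsame_ipl hH xy).
- move=> a x y dx dy; have dxy : odom S (a *: x + y) by apply: domS.2.
  have [hx hSx] := carS dx; have [hy hSy] := carS dy; have [_ hSxy] := carS dxy.
  apply: (coef_hsame hH he) => //; first exact: (carrier_lin hH).
  by move=> i; rewrite coefS// !(ip_lin hH)// !coefS//; ring.
Qed.

Lemma psum_dom a n : odom S (psum e a n).
Proof.
rewrite /psum; elim: n => [|n IH]; first by rewrite big_ord0; exact: domS.1.
by rewrite big_ord_recr/= addrC; apply: domS.2.
Qed.

Lemma psum_dense (D : set T) : (forall a n, D (psum e a n)) -> dense_in H D.
Proof.
move=> hD y hy eps e0; have e20 : 0 < eps ^+ 2 / 2 by rewrite divr_gt0// exprn_gt0.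
have [N NP] := expansion hH he hy e20.
have hs : X (psum e (fun i => cf y i) N) by exact: carrier_psum.
exists (psum e (fun i => cf y i) N); split => //.
rewrite (hnorm_lt hH)//; last exact: carrierB.
by apply: le_lt_trans (NP N (leqnn N)) _; have := exprn_gt0 2 e0; lra.
Qed.

(** Symmetry is Parseval's identity for real [l]. Conversely, testing the adjoint relation on each
    [e i] yields the diagonal relation, and [diag_graph] returns to the operator. *)
Lemma diag_selfadjoint : selfadjoint H S.
Proof.
split; [exact: diag_linear|by apply: psum_dense => a n; exact: psum_dom|].
move=> y z; split=> [/diag_graph[hy hz yz]|[hy hz yz]].
  split => // x dx; have [hx hSx] := carS dx.
  apply: (ip_eq_coef hH he hH he) => // i.
  by rewrite coefS// yz conjCRM mulrCA mulrA.
apply/diag_graph; split => // i.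
have := yz _ (eS i); have [_ hSe] := carS (eS i).
have see : hsame H (oact S (e i)) ((l i)%:C *: e i).
  apply: (coef_hsame hH he) => //; first exact: (carrierZ hH).
  move=> j; have [_ oe _] := he; rewrite coefS// (ipZl hH)// oe.
  by case: eqVneq => [->//|_]; rewrite !mulr0.
rewrite (hsame_ipl hH see)// (ipZl hH)// (ip_conj hH hy (Xe i)) (ip_conj hH hz (Xe i)).
move=> /(congr1 (fun c => (c^*)%R)); by rewrite conjCRM !conjCK => <-.
Qed.

Lemma diag_bounded_below : bounded_below H S rho.
Proof.
move=> x dx; have [hx hSx] := carS dx.
rewrite -(ipZl hH)//; apply: (ip_le_coef hH he hH he) => //; first exact: (carrierZ hH).
move=> i; rewrite (ipZl hH)// coefS// -!mulrA mulcJ_csq -!rmorphM lecR.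
by rewrite ler_wpM2r// csq_ge0.
Qed.

Lemma diag_graph_pow n x z : graph_pow H S n x z <->
  [/\ X x, X z & forall i, cf z i = (l i ^+ n)%:C * cf x i].
Proof.
have l0 i : 0 < l i by exact: lt_le_trans (l_ge i).
elim: n z => [|n IH] z /=.
  split=> [xz|[hx hz xz]].
    by have [hx hz _] := xz; split => // i; rewrite mul1r (hsame_ipl hH xz).
  by apply: (coef_hsame hH he) => // i; rewrite xz mul1r.
split=> [[y /IH[hx hy xy] /diag_graph[_ hz yz]]|[hx hz xz]].
  by split => // i; rewrite yz xy exprS rmorphM mulrA.
(* The intermediate vector has the coefficients [l^n c]. They are square summable because [l >= rho]
   bounds [l^n] by [rho^-1 l^(n+1)], and the coefficients [l^(n+1) c] belong to [z]. *)
have [M] : exists M : R, forall n', \sum_(i < n') csq ((l i ^+ n)%:C * cf x i) <= M.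
  exists (rho ^- 2 * nsq H z) => n'.
  apply: le_trans (ler_wpM2l _ (bessel hH he n' hz)); last by rewrite invr_ge0 exprn_ge0// ltW.
  rewrite mulr_sumr; apply: ler_sum => i _.
  rewrite xz !csqM mulrA ler_wpM2r ?csq_ge0// !csqR [l i ^+ n.+1]exprS exprMn mulrA ler_peMl ?sqr_ge0//.
  by rewrite mulrC ler_pdivlMr ?exprn_gt0// mul1r lerXn2r// nnegrE ltW.
move=> /(@riesz_fischer_coef _ _ _ hH _ he (fun i => (l i ^+ n)%:C * cf x i))[y [hy cy _]].
exists y; first by apply/IH.
by apply/diag_graph; split => // i; rewrite xz cy exprS rmorphM mulrA.
Qed.

(** The resolvent divides coefficients by [l i - c], a bounded operation once [c] has positive
    distance to all the [l i]; the hypothesis excludes accumulation points. *)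
Lemma diag_spectrum :
  (forall c : R[i], (forall i, (l i)%:C != c) ->
     exists2 d : R, 0 < d & forall i, d <= csq ((l i)%:C - c)) ->
  Defs.spectrum H S = [set (l i)%:C | i in [set: nat]].
Proof.
move=> sep; apply/seteqP; split=> [c|_ [i _ <-]]; last first.
  move=> [h1 _ _]; have [hei hSei] := carS (eS i).
  have z : hsame H (oact S (e i) - (l i)%:C *: e i) 0.
    apply: (coef_hsame hH he); [|exact: (carrier0 hH)|].
      by apply: (carrierB hH) => //; exact: (carrierZ hH).
    move=> j; rewrite (ip0l hH)// (ipBl hH)//; last exact: (carrierZ hH).
    have [_ oe _] := he; rewrite coefS// (ipZl hH)// oe.
    by case: eqVneq => [->|_]; rewrite ?subrr// !mulr0 subrr.
  have := h1 _ (eS i) z => /(hsame_ipl hH)/(_ (Xe i)); rewrite (ip0l hH)//.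
  have [_ -> _] := he; rewrite eqxx => /eqP; by rewrite oner_eq0.
move=> nres; apply: contrapT => nl; apply: nres.
have [i|d d0 dP] := sep c; first by apply/negP => /eqP lc; apply: nl; exists i.
have sub0 i : (l i)%:C - c != 0.
  by apply/negP => /eqP h; have := dP i; rewrite h csqR expr0n leNgt d0.
have coefSc x i : odom S x -> cf (oact S x - c *: x) i = ((l i)%:C - c) * cf x i.
  move=> dx; have [hx hSx] := carS dx.
  by rewrite (ipBl hH)//; [rewrite coefS// (ipZl hH)// mulrBl|exact: (carrierZ hH)].
have carSc x : odom S x -> X (oact S x - c *: x).
  by move=> /carS[hx hSx]; apply: (carrierB hH) => //; exact: (carrierZ hH).
split.
- move=> x dx /(hsame_ipl hH) h; have [hx _] := carS dx.
  apply: (coef_hsame hH he) => //; first exact: (carrier0 hH).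
  move=> i; have := h _ (Xe i); rewrite coefSc// !(ip0l hH)// => /eqP.
  by rewrite mulf_eq0 (negPf (sub0 i)) => /eqP.
- move=> z hz.
  have [M] : exists M : R, forall n, \sum_(i < n) csq (cf z i / ((l i)%:C - c)) <= M.
    exists (d^-1 * nsq H z) => n.
    apply: le_trans (ler_wpM2l _ (bessel hH he n hz)); last by rewrite invr_ge0 ltW.
    rewrite mulr_sumr; apply: ler_sum => i _.
    have -> : csq (cf z i) = csq (cf z i / ((l i)%:C - c)) * csq ((l i)%:C - c).
      by rewrite -csqM divfK.
    by rewrite mulrCA ler_peMr ?csq_ge0// ler_pdivlMl// mulr1.
  move=> /(@riesz_fischer_coef _ _ _ hH _ he (fun i => cf z i / ((l i)%:C - c)))[x [hx cx _]].
  (* The coefficients of [z + c x] are [l i] times those of [x], so this pair is the one to which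
     maximality of the domain applies. *)
  have hzx : X (z + c *: x) by apply: (carrierD hH) => //; exact: (carrierZ hH).
  have [|x' dx' xx'] := surjS hx hzx.
    move=> i; rewrite (ipDl hH)//; last exact: (carrierZ hH).
    by rewrite (ipZl hH)// cx; field; exact: sub0.
  exists x' => //; apply: (coef_hsame hH he) => //; first exact: carSc.
  by move=> i; rewrite coefSc// -(hsame_ipl hH xx')// cx mulrC divfK.
- exists (Num.sqrt d^-1) => x dx; have [hx _] := carS dx; have hS := carSc x dx.
  rewrite /hnorm -sqrtrM; last by rewrite invr_ge0 ltW.
  apply: ler_wsqrtr.
  suff : ip H x x <= (d^-1)%:C * ip H (oact S x - c *: x) (oact S x - c *: x).
    by rewrite lecE ReZ => /andP[].
  have hdS : X ((d^-1)%:C *: (oact S x - c *: x)) by exact: (carrierZ hH).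
  rewrite -(ipZl hH)//; apply: (ip_le_coef hH he hH he) => // i.
  rewrite (ipZl hH)// coefSc// mulcJ_csq -mulrA mulcJ_csq -rmorphM lecR csqM.
  by rewrite mulrA ler_peMl ?csq_ge0// ler_pdivlMl// mulr1.
Qed.

End DiagonalOperator.

(** * Left-definite spaces of a diagonal operator *)

Section LeftDefinite.
Variables (R : realType) (T : lmodType R[i]) (H : Defs.space T) (hH : hilbert H).
Variables (e : nat -> T) (he : onb H e) (l : nat -> R) (rho : R).
Hypotheses (rho_gt0 : 0 < rho) (l_ge : forall i, rho <= l i).
Variables (s : nat) (K : Defs.space T) (hK : hilbert K).
Hypotheses (carK : carrier K `<=` carrier H) (eK : forall i, carrier K (e i))
  (ipK : forall x i, carrier K x -> ip K x (e i) = (l i ^+ s)%:C * ip H x (e i))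
  (idK : forall x, carrier K x -> nsq H x = 0 -> nsq K x = 0).
Implicit Types (x y z : T).

Let l_gt0 i : 0 < l i. Proof. exact: lt_le_trans (l_ge i). Qed.

Definition lsqrt i : R := Num.sqrt (l i ^+ s).

(** By [ipK] the squared norm of [e i] in [K] is [l i ^+ s], whence the normalising factor. *)
Definition scaled_basis i : T := ((lsqrt i)^-1)%:C *: e i.

Lemma lsqrt_gt0 i : 0 < lsqrt i.
Proof. by rewrite sqrtr_gt0 exprn_gt0. Qed.

Lemma lsqrt_sqr i : lsqrt i ^+ 2 = l i ^+ s.
Proof. by rewrite sqr_sqrtr// exprn_ge0// ltW. Qed.

Lemma scaled_coef x i : carrier K x -> ip K x (scaled_basis i) = (lsqrt i)%:C * ip H x (e i).
Proof.
move=> hx; rewrite (ipZr hK)// ipK// -lsqrt_sqr mulrA; congr (_ * _).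
transitivity (((lsqrt i)^-1)%:C * (lsqrt i ^+ 2)%:C); first by congr (_ * _); exact: conjc_real.
by rewrite -rmorphM expr2 mulKf// gt_eqF// lsqrt_gt0.
Qed.

(** Totality is inherited from [H]: by [ipK], orthogonality to [e i] means the same in [K] and in
    [H], and [idK] brings the null norm back to [K]. *)
Lemma scaled_onb : onb K scaled_basis.
Proof.
have [hei oe tot] := he; split.
- by move=> i; exact: carrierZ.
- move=> i j; rewrite scaled_coef; last exact: carrierZ.
  rewrite (ipZl hH)// oe; case: eqVneq => [<-|_]; last by rewrite !mulr0.
  by rewrite mulr1 -rmorphM mulfV// gt_eqF// lsqrt_gt0.
- move=> x hx x0; apply: idK => //; apply: tot => [|i]; first exact: carK.
  have := x0 i; rewrite scaled_coef// => /eqP; rewrite mulf_eq0 => /orP[|/eqP//].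
  by move=> /eqP[] /eqP; rewrite gt_eqF// lsqrt_gt0.
Qed.

Lemma csq_lsqrt i (c : R[i]) : csq ((lsqrt i)%:C * c) = l i ^+ s * csq c.
Proof. by rewrite csqM csqR lsqrt_sqr. Qed.

(** Riesz-Fischer in the complete space [K] builds a vector with the prescribed coefficients, and
    coefficients in [H] determine the class. *)
Lemma regular_representative x (M : R) : carrier H x ->
  (forall n, \sum_(i < n) l i ^+ s * csq (ip H x (e i)) <= M) ->
  exists2 x', carrier K x' & hsame H x x'.
Proof.
move=> hx hM.
have [|y [hy cy _]] := @riesz_fischer_coef _ _ _ hK _ scaled_onb
    (fun i => (lsqrt i)%:C * ip H x (e i)) M.
  by move=> n; under eq_bigr => i _ do rewrite csq_lsqrt; exact: hM.
exists y => //; apply: (coef_hsame hH he) => //; first exact: carK.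
move=> i; have := cy i; rewrite scaled_coef// => /mulfI -> //.
by apply/negP => /eqP[] /eqP; rewrite gt_eqF// lsqrt_gt0.
Qed.

Lemma regular_bessel x n : carrier K x ->
  \sum_(i < n) l i ^+ s * csq (ip H x (e i)) <= nsq K x.
Proof.
move=> hx; have := bessel hK scaled_onb n hx; congr (_ <= _).
by apply: eq_bigr => i _; rewrite scaled_coef// csq_lsqrt.
Qed.

Lemma psum_scaled (b : nat -> R[i]) n :
  psum scaled_basis b n = psum e (fun i => b i * ((lsqrt i)^-1)%:C) n.
Proof. by apply: eq_bigr => i _; rewrite /scaled_basis scalerA. Qed.

Lemma basis_complete_orthogonal : complete_orthogonal K e.
Proof.
have [hei oe _] := he; split=> // [i j ij|x hx eps e0].
  by rewrite ipK// oe (negPf ij) mulr0.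
have e20 : 0 < eps ^+ 2 / 2 by rewrite divr_gt0// exprn_gt0.
have [N NP] := expansion hK scaled_onb hx e20.
exists N, (fun i => ip K x (scaled_basis i) * ((lsqrt i)^-1)%:C).
have hs : carrier K (psum scaled_basis (fun i => ip K x (scaled_basis i)) N).
  by apply: (carrier_psum hK scaled_onb).
rewrite -[\sum_(i < N) _](psum_scaled (fun i => ip K x (scaled_basis i))).
rewrite (hnorm_lt hK)//; last exact: carrierB.
by apply: le_lt_trans (NP N (leqnn N)) _; have := exprn_gt0 2 e0; lra.
Qed.

Variables (S : Defs.operator T) (s_gt0 : (0 < s)%N).
Hypotheses (saS : selfadjoint H S) (bbS : bounded_below H S rho)
  (powS : forall n x z, graph_pow H S n x z <->
  [/\ carrier H x, carrier H z & forall i, ip H z (e i) = (l i ^+ n)%:C * ip H x (e i)]).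

Lemma left_definite : left_definite_space H S rho s K.
Proof.
have [subK _ _] := hK; have hb := scaled_onb; have [hei _ _] := he.
split; split => //.
- move=> x y hx hy /(hsameP hH (carK hx) (carK hy)) xy; apply/(hsameP hK) => //.
  by apply: idK => //; exact: carrierB.
- move=> x [z /powS[hx hz xz]].
  (* From [t <= 1 + t^2] with [t = l i ^+ s], the weighted sum is bounded by the norms of [x] and of
     [S^s x]. *)
  apply: (@regular_representative x (nsq H x + nsq H z)) => // n.
  apply: le_trans (lerD (bessel hH he n hx) (bessel hH he n hz)).
  rewrite -big_split/=; apply: ler_sum => i _.
  rewrite xz csqM csqR; set c := csq _; have c0 : 0 <= c by exact: csq_ge0.
  rewrite -[X in X + _]mul1r -mulrDl ler_wpM2r//.
  by have := sqr_ge0 (l i ^+ s - 2^-1); nra.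
- apply: (psum_dense hK hb) => a n.
  exists (psum scaled_basis (fun i => (l i ^+ s)%:C * a i) n); apply/powS; rewrite !psum_scaled.
  split; [exact: carrier_psum|exact: carrier_psum|].
  move=> i; rewrite !(ip_psum_e hH he); case: ifP => _; last by rewrite mulr0.
  by rewrite mulrA.
- move=> x hx; have hxH := carK hx.
  rewrite -(ipZl hH)//; apply: (ip_le_coef hH he hK hb) => //; first exact: (carrierZ hH).
  move=> i; rewrite (ipZl hH)// scaled_coef// -mulrA !mulcJ_csq csq_lsqrt -rmorphM lecR.
  by rewrite ler_wpM2r ?csq_ge0// lerXn2r// nnegrE ltW.
- move=> x y z hx hy /powS[hxH hz xz].
  apply: (ip_eq_coef hK hb hH he) => //; first exact: carK.
  move=> i; rewrite !scaled_coef// conjCRM xz -lsqrt_sqr rmorphXn/= expr2; ring.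
Qed.

End LeftDefinite.

(** * Complexification *)

Section Complexification.
Variable R : realType.
Implicit Types (f g h : R -> R[i]) (V : set (R -> R)) (b : (R -> R) -> (R -> R) -> R).

Definition repart f : R -> R := @complex.Re R \o f.
Definition impart f : R -> R := @complex.Im R \o f.

(** The real counterpart of [hilbert], phrased with squared distances as in the completeness results
    for [rL2] and [rV]. *)
Definition rhilbert V b : Prop :=
  [/\ [/\ V (fun=> 0) & forall a u v, V u -> V v -> V (lcomb a u v)],
      [/\ forall a u v t, V u -> V v -> V t -> b (lcomb a u v) t = a * b u t + b v t,
          forall u v, V u -> V v -> b u v = b v u &
          forall u, V u -> 0 <= b u u] &
      forall u : nat -> R -> R, (forall n, V (u n)) ->
        (forall e : R, 0 < e -> exists N, forall m n, (N <= m)%N -> (N <= n)%N ->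
           b (lcomb (-1) (u n) (u m)) (lcomb (-1) (u n) (u m)) <= e) ->
        exists2 v, V v & forall e : R, 0 < e -> exists N, forall n, (N <= n)%N ->
           b (lcomb (-1) v (u n)) (lcomb (-1) v (u n)) <= e].

(** The sesquilinear extension of a real bilinear form, conjugate linear in [g]. *)
Definition cform b f g : R[i] :=
  (b (repart f) (repart g) + b (impart f) (impart g)) +i*
  (b (impart f) (repart g) - b (repart f) (impart g)).

Lemma repart_lin (a : R[i]) f g : repart (a *: f + g) =
  lcomb (complex.Re a) (repart f) (lcomb (- complex.Im a) (impart f) (repart g)).
Proof.
apply/funext => x; rewrite /repart /impart /lcomb -[LHS]/(complex.Re (a * f x + g x)) ReD /=.
by case: (f x) a => [p q] [c d]; simpc => /=; ring.
Qed.

Lemma impart_lin (a : R[i]) f g : impart (a *: f + g) =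
  lcomb (complex.Re a) (impart f) (lcomb (complex.Im a) (repart f) (impart g)).
Proof.
apply/funext => x; rewrite /repart /impart /lcomb -[LHS]/(complex.Im (a * f x + g x)) ImD /=.
by case: (f x) a => [p q] [c d]; simpc => /=; ring.
Qed.

Lemma repartB f g : repart (f - g) = lcomb (-1) (repart g) (repart f).
Proof.
by apply/funext => x; rewrite /repart /lcomb -[LHS]/(complex.Re (f x - g x)) ReD ReN mulN1r addrC.
Qed.

Lemma impartB f g : impart (f - g) = lcomb (-1) (impart g) (impart f).
Proof.
by apply/funext => x; rewrite /impart /lcomb -[LHS]/(complex.Im (f x - g x)) ImD ImN mulN1r addrC.
Qed.

Section Hilbert.
Variables (V : set (R -> R)) (b : (R -> R) -> (R -> R) -> R) (hV : rhilbert V b).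
Variable K : Defs.space (R -> R[i]).
Hypotheses (carK : forall f, carrier K f <-> V (repart f) /\ V (impart f))
  (ipK : forall f g, carrier K f -> carrier K g -> ip K f g = cform b f g).

Lemma rhilbert0 u : V u -> b u (fun=> 0) = 0.
Proof.
move=> hu; have [[h0 _] [bl bs _] _] := hV.
have := bl 1 _ _ _ h0 h0 hu; rewrite (_ : lcomb _ _ _ = fun=> 0); last first.
  by apply/funext => x; rewrite /lcomb mulr0 addr0.
by rewrite mul1r => /eqP; rewrite eq_sym -subr_eq0 addrK => /eqP; rewrite bs.
Qed.

Lemma cform_real f g : V (repart f) -> V (impart f) -> impart g = (fun=> 0) ->
  cform b f g = b (repart f) (repart g) +i* b (impart f) (repart g).
Proof. by move=> h1 h2 g0; rewrite /cform g0 !rhilbert0// addr0 subr0. Qed.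

(** The squared norm is the sum of those of the real and imaginary parts, so both parts of a Cauchy
    sequence are Cauchy and their limits are combined. *)
Lemma hilbert_complexify : hilbert K.
Proof.
have [[h0 hl] [bl bs bp] bc] := hV; split.
- split.
    have z1 : repart 0 = (fun=> 0) by apply/funext.
    have z2 : impart 0 = (fun=> 0) by apply/funext.
    by apply/carK; rewrite z1 z2.
  move=> a x y /carK[x1 x2] /carK[y1 y2]; apply/carK.
  by rewrite repart_lin impart_lin; split; apply: (hl) => //; exact: (hl).
- have sub a x y : carrier K x -> carrier K y -> carrier K (a *: x + y).
    move=> /carK[x1 x2] /carK[y1 y2]; apply/carK.
    by rewrite repart_lin impart_lin; split; apply: (hl) => //; exact: (hl).
  split.
  + move=> a x y z hx hy hz; rewrite !ipK//; last exact: sub.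
    have [x1 x2] := (carK x).1 hx; have [y1 y2] := (carK y).1 hy.
    have [z1 z2] := (carK z).1 hz.
    rewrite /cform repart_lin impart_lin !bl//; try exact: hl.
    case: a => c d; simpc; congr (_ +i* _) => /=; ring.
  + move=> x y hx hy; have [x1 x2] := (carK x).1 hx; have [y1 y2] := (carK y).1 hy.
    rewrite !ipK// /cform (bs (repart y))// (bs (impart y))// (bs (impart y) (repart x))//.
    by rewrite (bs (repart y) (impart x))//= opprB.
  + move=> x hx; have [x1 x2] := (carK x).1 hx.
    rewrite ipK// /cform lecE /= (bs (repart x) (impart x))// subrr eqxx /=.
    by rewrite addr_ge0 ?bp.
- move=> u hu cu.
  have hB f g : carrier K f -> carrier K g -> carrier K (f - g).
    move=> /carK[x1 x2] /carK[y1 y2]; apply/carK.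
    by rewrite repartB impartB; split; exact: hl.
  have nE f g : carrier K f -> carrier K g -> complex.Re (ip K (f - g) (f - g)) =
      b (lcomb (-1) (repart g) (repart f)) (lcomb (-1) (repart g) (repart f)) +
      b (lcomb (-1) (impart g) (impart f)) (lcomb (-1) (impart g) (impart f)).
    by move=> hf hg; rewrite ipK; [rewrite /cform repartB impartB|exact: hB|exact: hB].
  have re n : V (repart (u n)) by have [] := (carK _).1 (hu n).
  have im n : V (impart (u n)) by have [] := (carK _).1 (hu n).
  have cau e : 0 < e -> exists N, forall m n, (N <= m)%N -> (N <= n)%N ->
      complex.Re (ip K (u m - u n) (u m - u n)) <= e.
    move=> e0; have s0 : 0 < Num.sqrt e by rewrite sqrtr_gt0.
    have [N NP] := cu _ s0; exists N => m n Nm Nn.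
    by have := NP m n Nm Nn; rewrite /hnorm ltr_sqrt// => /ltW.
  have [||v1 hv1 c1] := bc (fun n => repart (u n)).
  - exact: re.
  - move=> e e0; have [N NP] := cau e e0; exists N => m n Nm Nn.
    apply: le_trans (NP m n Nm Nn); rewrite nE// lerDl bp//; exact: hl.
  have [||v2 hv2 c2] := bc (fun n => impart (u n)).
  - exact: im.
  - move=> e e0; have [N NP] := cau e e0; exists N => m n Nm Nn.
    apply: le_trans (NP m n Nm Nn); rewrite nE// lerDr bp//; exact: hl.
  have hx : carrier K (fun t => v1 t +i* v2 t) by apply/carK.
  exists (fun t => v1 t +i* v2 t) => //.
  apply/cvgrPdist_lt => e e0; have e30 : 0 < e ^+ 2 / 3 by rewrite divr_gt0// exprn_gt0.
  have [N1 H1] := c1 _ e30; have [N2 H2] := c2 _ e30.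
  exists (maxn N1 N2) => // n /=; rewrite geq_max => /andP[n1 n2].
  rewrite sub0r normrN ger0_norm ?sqrtr_ge0// /hnorm.
  rewrite -[ltRHS](ger0_norm (ltW e0)) -sqrtr_sqr ltr_sqrt ?exprn_gt0// nE//.
  have := H1 n n1; have := H2 n n2; rewrite /repart /impart /=.
  by have := exprn_gt0 2 e0; lra.
Qed.

End Hilbert.

Lemma rhilbert_rL2 w : rhilbert (rL2 w : set (R -> R)) (rip w).
Proof.
split.
- by split; [exact: rL2_0|exact: rL2_lcomb].
- by split; [exact: rip_lcomb|move=> u v _ _; exact: rip_sym|move=> u _; exact: rip_ge0].
- exact: rL2_complete.
Qed.

Lemma rhilbert_rV n k : (0 < n)%N -> 0 < k -> rhilbert (rV n : set (R -> R)) (ripn n k).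
Proof.
move=> n0 k0; split.
- by split; [exact: rV_0|move=> a u v; exact: rV_lcomb].
- split; [by move=> a u v t; exact: ripn_lcomb|by move=> u v _ _; exact: ripn_sym|].
  by move=> u _; exact: ripn_ge0.
- exact: rV_complete.
Qed.

Local Notation I := (`]-1, 1[%classic : set R).

Lemma normc_sqr (z : R[i]) : Normc.normc z ^+ 2 = complex.Re z ^+ 2 + complex.Im z ^+ 2.
Proof. by case: z => p q /=; rewrite sqr_sqrtr// addr_ge0 ?sqr_ge0. Qed.

Lemma L2wP w f : L2w w f <-> rL2 w (repart f) /\ rL2 w (impart f).
Proof.
have mI : @measurable _ (measurableTypeR R) I := @measI R.
split=> [[m1 m2 fin]|[[m1 i1] [m2 i2]]].
  have part (p : R -> R) : measurable_fun I p ->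
      (forall x, p x ^+ 2 <= Normc.normc (f x) ^+ 2) -> rL2 w p.
    move=> mp hp; split => //; apply/integrableP; split.
      apply/measurable_EFinP; apply: measurable_funM; last exact: weight_measurable.
      exact: measurable_funX.
    apply: le_lt_trans fin; apply: ge0_le_integral => //.
    - apply: measurableT_comp => //; apply/measurable_EFinP.
      by apply: measurable_funM; [exact: measurable_funX|exact: weight_measurable].
    - apply/measurable_EFinP; apply: measurable_funM; last exact: weight_measurable.
      have -> : (fun x => Normc.normc (f x) ^+ 2) = (fun x => repart f x ^+ 2 + impart f x ^+ 2).
        by apply/funext => x; rewrite normc_sqr.
      by apply: measurable_funD; exact: measurable_funX.
    - move=> x Ix; have w0 := ltW (weight_gt0 w Ix).
      rewrite /= lee_fin ger0_norm; last by rewrite mulr_ge0 ?sqr_ge0.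
      exact: ler_wpM2r.
  by split; apply: part => // x; rewrite normc_sqr ?lerDl ?lerDr sqr_ge0.
split => //; have := rintD mI i1 i2 => /integrableP[_]; apply: le_lt_trans.
rewrite le_eqVlt; apply/orP; left; apply/eqP; apply: eq_integral => x; rewrite inE => Ix.
have w0 := ltW (weight_gt0 w Ix).
by rewrite normc_sqr /= -mulrDl ger0_norm// mulr_ge0// addr_ge0 ?sqr_ge0.
Qed.

Lemma wipE w f g : L2w w f -> L2w w g -> wip w f g = cform (rip w) f g.
Proof.
have mI : @measurable _ (measurableTypeR R) I := @measI R.
move=> /L2wP[f1 f2] /L2wP[g1 g2]; rewrite /wip /cintegral /cform /rip.
have j11 := rL2_prod f1 g1; have j22 := rL2_prod f2 g2.
have j21 := rL2_prod f2 g1; have j12 := rL2_prod f1 g2.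
rewrite -RintegralD// -RintegralB//; congr (_ +i* _); apply: eq_Rintegral => x _;
  rewrite /repart /impart /=; case: (f x) (g x) => [p q] [r s]; simpc => /=; ring.
Qed.

Lemma AC_locP f : AC_loc f <-> rAC (repart f) /\ rAC (impart f).
Proof.
split=> [ac|[ac1 ac2] a b a1 ab b1 e e0].
  split=> a b a1 ab b1 e e0; have [d d0 H] := ac a b a1 ab b1 e e0;
    exists d => // N u v uv dis sd; apply: le_lt_trans (H N u v uv dis sd);
    apply: ler_sum => i _; rewrite /repart /impart /=.
  - case: (f (v i)) (f (u i)) => [p q] [r s] /=.
    by rewrite -sqrtr_sqr ler_wsqrtr// lerDl sqr_ge0.
  - case: (f (v i)) (f (u i)) => [p q] [r s] /=.
    by rewrite -sqrtr_sqr ler_wsqrtr// lerDr sqr_ge0.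
have e20 : 0 < e / 2 by rewrite divr_gt0.
have [d1 d10 H1] := ac1 a b a1 ab b1 _ e20; have [d2 d20 H2] := ac2 a b a1 ab b1 _ e20.
exists (Num.min d1 d2); first by rewrite lt_min d10.
move=> N u v uv dis; rewrite lt_min => /andP[s1 s2].
apply: le_lt_trans (_ : \sum_(i < N) (`|repart f (v i) - repart f (u i)| +
   `|impart f (v i) - impart f (u i)|) < _).
  apply: ler_sum => i _; rewrite /repart /impart /=.
  case: (f (v i)) (f (u i)) => [p q] [r s] /=.
  rewrite -[leRHS]ger0_norm ?addr_ge0// -sqrtr_sqr ler_wsqrtr//.
  rewrite [leRHS]sqrrD !real_normK ?num_real// addrAC lerDl mulrn_wge0// mulr_ge0//.
by rewrite big_split/= (splitr e) ltrD// ?H1 ?H2.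
Qed.

Lemma AC_loc_uptoP n f : AC_loc_upto n f <-> rACn n (repart f) /\ rACn n (impart f).
Proof.
split=> [[d ac]|[[d1 ac1] [d2 ac2]]].
  by split; split=> j jn; [move=> x Ix; exact: (d j jn x Ix).1|exact: ((AC_locP _).1 (ac j jn)).1|
    move=> x Ix; exact: (d j jn x Ix).2|exact: ((AC_locP _).1 (ac j jn)).2].
split=> j jn; first by move=> x Ix; split; [exact: d1|exact: d2].
by apply/AC_locP; split; [exact: ac1|exact: ac2].
Qed.

Lemma VnP n f : Vn n f <-> rV n (repart f) /\ rV n (impart f).
Proof.
split=> [[/AC_loc_uptoP[a1 a2] l]|[[a1 l1] [a2 l2]]].
  by split; split=> // j jn; have /L2wP[] := l j jn.
split; first exact/AC_loc_uptoP.
by move=> j jn; apply/L2wP; split; [exact: l1|exact: l2].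
Qed.

Lemma ipnE n k f g : Vn n f -> Vn n g -> ipn n k f g = cform (ripn n k) f g.
Proof.
move=> [_ lf] [_ lg].
have -> : ipn n k f g = \sum_(j < n.+1) (coef n k j)%:C *
    cform (rip (j%:Z - 1)) (cderiv j f) (cderiv j g).
  by apply: eq_bigr => j _; rewrite wipE//; [apply: lf|apply: lg]; rewrite -ltnS.
apply/eqP; rewrite eq_complex Re_sum Im_sum; apply/andP; split; apply/eqP.
  rewrite [RHS]/= /ripn -big_split; apply: eq_bigr => j _.
  by rewrite ReZ mulrDr.
rewrite [RHS]/= /ripn -sumrB; apply: eq_bigr => j _.
by rewrite ImZ mulrBr.
Qed.

Lemma L2_hilbert : hilbert (@L2 R).
Proof.
apply: (hilbert_complexify (rhilbert_rL2 (-1))); first by move=> f; exact: L2wP.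
by move=> f g; exact: wipE.
Qed.

Lemma Hn_hilbert n (k : R) : (0 < n)%N -> 0 < k -> hilbert (Hn n k).
Proof.
move=> n0 k0; apply: (hilbert_complexify (rhilbert_rV n0 k0)); first by move=> f; exact: VnP.
by move=> f g; exact: ipnE.
Qed.

End Complexification.

(** * The operators A and B_n *)

Section JacobiOperator.
Variables (R : realType) (k : R) (k_gt0 : 0 < k).
Local Notation mu := (@lebesgue_measure R).
Local Notation I := (`]-1, 1[%classic : set R).
Implicit Types (f g : R -> R[i]) (u v : R -> R).

Definition rdom u : Prop := [/\ rACn 2 u, rL2 (-1) u & rL2 (-1) (rell k u)].

Lemma rell_lcomb_ae a u v : rACn 2 u -> rACn 2 v ->
  {ae mu, forall x, I x -> rell k (lcomb a u v) x = lcomb a (rell k u) (rell k v) x}.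
Proof.
move=> u2 v2; apply: ae_imp (derive1n_lcomb_ae a u2 v2 (leqnn 2)) => x h Ix.
rewrite /rell h// /lcomb.
by move: (derive1n 2 u x) (derive1n 2 v x) => p q; ring.
Qed.

Lemma rell_measurable u : rACn 2 u -> measurable_fun I (rell k u).
Proof.
move=> u2; apply: measurable_funD.
  apply: measurable_funM; last exact: (@rACn_measurable _ 2).
  apply: continuous_measurable_I => x _; apply: cvgN.
  by apply: cvgB; [exact: cvg_cst|exact: exprn_continuous].
apply: measurable_funM; first exact: measurable_cst.
exact: (rAC_measurable (u2.2 0%N _)).
Qed.

Lemma rdom_lcomb a u v : rdom u -> rdom v -> rdom (lcomb a u v).
Proof.
move=> [u2 lu eu] [v2 lv ev]; split; [exact: rACn_lcomb|exact: rL2_lcomb|].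
apply: (rL2_ae (rL2_lcomb a eu ev)).
  exact: (rell_measurable (rACn_lcomb a u2 v2)).
by apply: ae_imp (rell_lcomb_ae a u2 v2) => x h Ix; rewrite h.
Qed.

Lemma rV_le m n u : (m <= n)%N -> rV n u -> rV m u.
Proof.
move=> mn [un lu]; split; first exact: rACn_le un.
by move=> j jm; apply: lu; exact: leq_trans mn.
Qed.

(** Square integrability of [u''] for the weight [1 - x^2] is that of [(1 - x^2) u''] for the
    inverse weight. *)
Lemma rV2_rdom u : rV 2 u -> rdom u.
Proof.
move=> [u2 lu]; have l0 : rL2 (-1) u by exact: (lu 0%N).
split=> //; have l2 : rL2 1 (derive1n 2 u) by exact: (lu 2%N).
have mu2 : measurable_fun I (fun x => (1 - x ^+ 2) * derive1n 2 u x).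
  apply: measurable_funM; last exact: l2.1.
  apply: continuous_measurable_I => x _.
  by apply: cvgB; [exact: cvg_cst|exact: exprn_continuous].
have lw : rL2 (-1) (fun x => (1 - x ^+ 2) * derive1n 2 u x).
  split => //; apply: eq_integrable l2.2 => // x; rewrite inE => Ix; apply: (congr1 EFin).
  by rewrite weight1 /weight exprN1; field; rewrite gt_eqF// one_sub_sqr_gt0.
apply: (rL2_ae (rL2_lcomb (-1) lw (rL2_lcomb k l0 (@rL2_0 R (-1))))).
  exact: rell_measurable.
by apply: aeW => x _; rewrite /lcomb /rell; move: (derive1n 2 u x) => p; ring.
Qed.

Lemma repart_ell f : repart (ell k f) = rell k (repart f).
Proof.
apply/funext => x; rewrite -[LHS]/(complex.Re (ell k f x)) /ell -rmorphN ReD !ReZ.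
by [].
Qed.

Lemma impart_ell f : impart (ell k f) = rell k (impart f).
Proof.
apply/funext => x; rewrite -[LHS]/(complex.Im (ell k f x)) /ell -rmorphN ImD !ImZ.
by [].
Qed.

Lemma DeltaP f : Delta k f <-> rdom (repart f) /\ rdom (impart f).
Proof.
split=> [[/AC_loc_uptoP[a1 a2] /L2wP[l1 l2] /L2wP[e1 e2]]|[[a1 l1 e1] [a2 l2 e2]]].
  by rewrite repart_ell in e1; rewrite impart_ell in e2.
split; [exact/AC_loc_uptoP|exact/L2wP|apply/L2wP].
by rewrite repart_ell impart_ell.
Qed.

Lemma Vn_le m n f : (m <= n)%N -> Vn n f -> Vn m f.
Proof. by move=> mn /VnP[h1 h2]; apply/VnP; split; exact: rV_le mn _. Qed.

Lemma Vn_L2w n f : Vn n f -> L2w (-1) f.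
Proof.
move=> /VnP[[_ l1] [_ l2]]; apply/L2wP.
by split; [exact: (l1 0%N)|exact: (l2 0%N)].
Qed.

Lemma Vn_Delta n f : (2 <= n)%N -> Vn n f -> Delta k f.
Proof. by move=> n2 /(Vn_le n2)/VnP[h1 h2]; apply/DeltaP; split; exact: rV2_rdom. Qed.

Lemma Delta_subspace : Defs.subspace (Delta k).
Proof.
split=> [|a f g /DeltaP[f1 f2] /DeltaP[g1 g2]].
  by apply: (@Vn_Delta 2) => //; have [[]] := @Hn_hilbert R 2 k isT k_gt0.
by apply/DeltaP; rewrite repart_lin impart_lin; split; do !apply: rdom_lcomb => //.
Qed.

(** * Normalised Jacobi polynomials as eigenvectors *)

Section Basis.
Variables (m : nat) (m1 : (1 < m)%N).

Definition jnorm : R := (hnorm L2 (jacobi_sum m))^-1.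

Lemma repart_jacobi_sum : repart (jacobi_sum m) = horner (jac R m).
Proof. by apply/funext => x; rewrite -[LHS]/(complex.Re (jacobi_sum m x)) jacobi_sumE. Qed.

Lemma impart_jacobi_sum : impart (jacobi_sum m) = (fun=> 0 : R).
Proof. by apply/funext => x; rewrite -[LHS]/(complex.Im (jacobi_sum m x)) jacobi_sumE. Qed.

Lemma repart_jacobiP : repart (jacobiP m) = lcomb jnorm (horner (jac R m)) (fun=> 0).
Proof.
apply/funext => x; rewrite -repart_jacobi_sum /lcomb addr0 /repart /=.
by rewrite -[LHS]/(complex.Re (jnorm%:C * jacobi_sum m x)) ReZ.
Qed.

Lemma impart_jacobiP : impart (jacobiP m) = (fun=> 0 : R).
Proof.
apply/funext => x; rewrite /impart /=.
rewrite -[LHS]/(complex.Im (jnorm%:C * jacobi_sum m x)) ImZ.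
by rewrite -[complex.Im _]/(impart (jacobi_sum m) x) impart_jacobi_sum mulr0.
Qed.

Lemma jacobi_sum_L2w : L2w (-1) (jacobi_sum m : R -> R[i]).
Proof.
by apply/L2wP; rewrite repart_jacobi_sum impart_jacobi_sum; split; [exact: rL2_jac|exact: rL2_0].
Qed.

Lemma jnorm_sqr : jnorm ^+ 2 * rip (-1) (horner (jac R m)) (horner (jac R m)) = 1.
Proof.
rewrite /jnorm exprVn (hnorm_sqr (@L2_hilbert R))//; last exact: jacobi_sum_L2w.
have hj := jacobi_sum_L2w; have [h1 h2] := (L2wP _ _).1 hj.
rewrite /nsq -[ip _ _ _]/(wip (-1) _ _) wipE//.
rewrite (cform_real (@rhilbert_rL2 R (-1)) h1 h2 impart_jacobi_sum).
by rewrite repart_jacobi_sum /= mulVf// gt_eqF// rip_jac_gt0.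
Qed.

Lemma jacobiP_Vn n : (0 < n)%N -> Vn n (jacobiP m : R -> R[i]).
Proof.
move=> n0; apply/VnP; rewrite repart_jacobiP impart_jacobiP; split; last exact: rV_0.
by apply: rV_lcomb => //; [exact: rV_jac|exact: rV_0].
Qed.

Lemma wip_jacobiP f : L2w (-1) f -> wip (-1) f (jacobiP m) =
  (jnorm * rip (-1) (repart f) (horner (jac R m))) +i*
  (jnorm * rip (-1) (impart f) (horner (jac R m))).
Proof.
move=> hf; have hj : L2w (-1) (jacobiP m : R -> R[i]) by apply: (@Vn_L2w 1); exact: jacobiP_Vn.
have [f1 f2] := (L2wP _ _).1 hf; have lj := @rL2_jac R m m1.
have l0 := @rL2_0 R (-1).
rewrite wipE// (cform_real (@rhilbert_rL2 R (-1)) f1 f2 impart_jacobiP).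
rewrite repart_jacobiP; congr (_ +i* _); rewrite rip_sym rip_lcomb// rip_sym;
  by rewrite (rip_sym (-1) (fun=> 0)) (rhilbert0 (@rhilbert_rL2 R (-1))) ?addr0.
Qed.

Lemma ipn_jacobiP n f : (0 < n)%N -> Vn n f -> ipn n k f (jacobiP m) =
  (jacobi_eigenvalue k m ^+ n)%:C * wip (-1) f (jacobiP m).
Proof.
move=> n0 hf; rewrite wip_jacobiP; last exact: (Vn_L2w hf).
have hj := jacobiP_Vn n0; have [f1 f2] := (VnP _ _).1 hf.
have vj := @rV_jac R n m m1; have v0 := @rV_0 R n.
rewrite ipnE// (cform_real (rhilbert_rV n0 k_gt0) f1 f2 impart_jacobiP).
rewrite repart_jacobiP; simpc; congr (_ +i* _);
  rewrite ripn_sym ripn_lcomb// ripn_sym ripn_jac//;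
  rewrite (ripn_sym n k (fun=> 0)) (rhilbert0 (rhilbert_rV n0 k_gt0))// addr0;
  by rewrite mulrCA.
Qed.

Lemma wip_ell f : Delta k f ->
  wip (-1) (ell k f) (jacobiP m) = (jacobi_eigenvalue k m)%:C * wip (-1) f (jacobiP m).
Proof.
move=> /[dup] [[_ lf le]] /DeltaP[[f1 l1 e1] [f2 l2 e2]].
rewrite !wip_jacobiP// repart_ell impart_ell !(rip_rell m1)//; simpc.
by congr (_ +i* _); rewrite mulrCA.
Qed.

(** The differential equation is an identity of polynomials, so equality holds as functions on the
    whole line and not merely up to [hsame]. *)
Lemma ell_jacobiP : ell k (jacobiP m) = (jacobi_eigenvalue k m)%:C *: jacobiP m.
Proof.
have h x : rell k (repart (jacobiP m)) x = jacobi_eigenvalue k m * repart (jacobiP m) x.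
  have e : lcomb jnorm (horner (jac R m)) (fun=> 0) = horner (jnorm *: jac R m).
    by apply/funext => y; rewrite hornerZ; exact: addr0.
  rewrite repart_jacobiP e hornerZ mulrCA -[jacobi_eigenvalue k m]/(jlam R m + k) -rell_jac//.
  rewrite /rell !derive1n_poly derivnZ !hornerZ; ring.
have h' x : rell k (impart (jacobiP m)) x = jacobi_eigenvalue k m * impart (jacobiP m) x.
  have e : (fun=> 0 : R) = horner (0 : {poly R}) by apply/funext => y; rewrite horner0.
  by rewrite impart_jacobiP mulr0 e /rell derive1n_poly derivnS derivn1 !deriv0 horner0 !mulr0 addr0.
apply/funext => x; apply/eqP; rewrite eq_complex; apply/andP; split; apply/eqP.
  rewrite -[LHS]/(repart (ell k (jacobiP m)) x) repart_ell h.
  by rewrite -[RHS]/(complex.Re ((jacobi_eigenvalue k m)%:C * jacobiP m x)) ReZ.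
rewrite -[LHS]/(impart (ell k (jacobiP m)) x) impart_ell h'.
by rewrite -[RHS]/(complex.Im ((jacobi_eigenvalue k m)%:C * jacobiP m x)) ImZ.
Qed.

End Basis.

Definition jbasis (i : nat) : R -> R[i] := jacobiP i.+2.

Definition jeigen (i : nat) : R := jacobi_eigenvalue k i.+2.

Lemma jeigen_ge i : k <= jeigen i.
Proof. by rewrite lerDr. Qed.

Lemma cst0_eq0 (w : int) u : {ae mu, forall x, I x -> u x = 0} -> rL2 w u -> rip w u u = 0.
Proof.
move=> u0 lu; have l0 := @rL2_0 R w.
rewrite (rip_ae w lu.1 lu.1 l0.1 l0.1 u0 u0).
by apply: Rintegral_eq0 => x _; rewrite !mul0r.
Qed.

Lemma jbasis_onb : onb L2 jbasis.
Proof.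
have c0 i : jnorm i.+2 != 0.
  apply/eqP => c0; have := @jnorm_sqr i.+2 isT; rewrite c0 expr0n mul0r => /eqP.
  by rewrite eq_sym oner_eq0.
have Lj i : L2w (-1) (jbasis i) by apply: (@Vn_L2w 1); exact: jacobiP_Vn.
split=> //.
- move=> i j; rewrite -[ip _ _ _]/(wip (-1) (jbasis i) (jacobiP j.+2)) wip_jacobiP//.
  rewrite impart_jacobiP repart_jacobiP.
  have lP l : rL2 (-1) (horner (jac R l.+2)) by exact: rL2_jac.
  rewrite rip_lcomb//; last exact: rL2_0.
  have z l : rip (-1) (fun=> 0) (horner (jac R l.+2)) = 0.
    by apply: Rintegral_eq0 => x _; rewrite !mul0r.
  rewrite !z mulr0 addr0; case: eqVneq => [->|ij].
    by rewrite mulrA -expr2 jnorm_sqr.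
  by rewrite rip_jac_orth ?mulr0// eqSS eqSS.
- move=> f hf f0; have [h1 h2] := (L2wP _ _).1 hf.
  have key i : rip (-1) (repart f) (horner (jac R i.+2)) = 0 /\
               rip (-1) (impart f) (horner (jac R i.+2)) = 0.
    have := f0 i; rewrite -[ip _ _ _]/(wip (-1) f (jacobiP i.+2)) wip_jacobiP//.
    by move=> [] /eqP; rewrite mulf_eq0 (negPf (c0 i)) => /eqP ? /eqP; rewrite mulf_eq0 (negPf (c0 i)) => /eqP ?.
  have z1 : {ae mu, forall x, I x -> repart f x = 0}.
    by apply: orthogonal_jac_eq0 => // -[|[|m]] // _; have [] := key m.
  have z2 : {ae mu, forall x, I x -> impart f x = 0}.
    by apply: orthogonal_jac_eq0 => // -[|[|m]] // _; have [] := key m.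
  by rewrite /nsq -[ip _ _ _]/(wip (-1) f f) wipE//= !cst0_eq0// addr0.
Qed.

Lemma L2_nsq0 f : L2w (-1) f -> nsq L2 f = 0 ->
  {ae mu, forall x, I x -> repart f x = 0} /\ {ae mu, forall x, I x -> impart f x = 0}.
Proof.
move=> hf; have [h1 h2] := (L2wP _ _).1 hf.
rewrite /nsq -[ip _ _ _]/(wip (-1) f f) wipE//= => /eqP.
rewrite paddr_eq0 ?rip_ge0// => /andP[/eqP z1 /eqP z2].
by split; [exact: rip_eq0_ae h1 z1|exact: rip_eq0_ae h2 z2].
Qed.

(** * The space of order n seen through Jacobi coefficients *)

Section Level.
Variables (n : nat) (n_gt0 : (0 < n)%N).

Lemma Vn_ae_eq0 f : Vn n f -> nsq L2 f = 0 ->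
  forall x, I x -> repart f x = 0 /\ impart f x = 0.
Proof.
move=> hf /(L2_nsq0 (Vn_L2w hf))[z1 z2] x Ix; have [[[_ a1] _] [[_ a2] _]] := (VnP _ _).1 hf.
split; [apply: (ae_continuous_eq0 _ z1 Ix)|apply: (ae_continuous_eq0 _ z2 Ix)] => y Iy.
  by apply: rAC_continuous Iy; apply: (a1 0%N).
by apply: rAC_continuous Iy; apply: (a2 0%N).
Qed.

Lemma ripn_eq0 u : (forall x, I x -> u x = 0) -> ripn n k u u = 0.
Proof.
move=> u0; apply: big1 => j _; rewrite [rip _ _ _](_ : _ = 0) ?mulr0//.
apply: Rintegral_eq0 => x Ix.
rewrite (@derive1n_I R j u (horner (0 : {poly R})) x _ Ix); last by move=> y Iy; rewrite horner0 u0.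
by rewrite derive1n_poly (_ : 0^`(j) = 0) ?horner0 ?mul0r//; elim: (val j) => [//|i IH]; rewrite derivnS IH deriv0.
Qed.

(** An element of [Vn] that is 0 almost everywhere is 0 on all of (-1,1) by continuity, and so are
    its derivatives. Hence [Hn] and [L2] identify the same representatives. *)
Lemma Vn_nsq0 f : Vn n f -> nsq L2 f = 0 -> nsq (Hn n k) f = 0.
Proof.
move=> hf f0; have z := Vn_ae_eq0 hf f0.
rewrite /nsq -[ip _ _ _]/(ipn n k f f) ipnE//=.
by rewrite !ripn_eq0 ?addr0// => x /z[].
Qed.

Lemma ipn_jbasis f i : Vn n f -> ip (Hn n k) f (jbasis i) = (jeigen i ^+ n)%:C * ip L2 f (jbasis i).
Proof. by move=> hf; exact: ipn_jacobiP. Qed.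

Lemma jbasis_Vn i : Vn n (jbasis i).
Proof. exact: jacobiP_Vn. Qed.

Definition jscaled := scaled_basis jbasis jeigen n.

Lemma jscaled_onb : onb (Hn n k) jscaled.
Proof.
apply: (scaled_onb (@L2_hilbert R) jbasis_onb k_gt0 jeigen_ge (Hn_hilbert n_gt0 k_gt0)).
- by move=> f; exact: Vn_L2w.
- exact: jbasis_Vn.
- by move=> f i; exact: ipn_jbasis.
- exact: Vn_nsq0.
Qed.

Lemma Vn_representative f (M : R) : L2w (-1) f ->
  (forall N, \sum_(i < N) jeigen i ^+ n * csq (ip L2 f (jbasis i)) <= M) ->
  exists2 g, Vn n g & hsame L2 f g.
Proof.
apply: (regular_representative (@L2_hilbert R) jbasis_onb k_gt0 jeigen_ge (Hn_hilbert n_gt0 k_gt0)).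
- by move=> g; exact: Vn_L2w.
- exact: jbasis_Vn.
- by move=> g i; exact: ipn_jbasis.
- exact: Vn_nsq0.
Qed.

Lemma Vn_bessel f N : Vn n f ->
  \sum_(i < N) jeigen i ^+ n * csq (ip L2 f (jbasis i)) <= nsq (Hn n k) f.
Proof.
apply: (regular_bessel (@L2_hilbert R) jbasis_onb k_gt0 jeigen_ge (Hn_hilbert n_gt0 k_gt0)).
- by move=> g; exact: Vn_L2w.
- exact: jbasis_Vn.
- by move=> g i; exact: ipn_jbasis.
- exact: Vn_nsq0.
Qed.

End Level.

Lemma ell_coef f i : Delta k f ->
  ip L2 (ell k f) (jbasis i) = (jeigen i)%:C * ip L2 f (jbasis i).
Proof. by move=> hf; exact: wip_ell. Qed.

Lemma jbasis_Delta i : Delta k (jbasis i).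
Proof. by apply: (@Vn_Delta 2) => //; exact: jbasis_Vn. Qed.

Lemma Delta_car f : odom (jacobiA k) f -> carrier L2 f /\ carrier L2 (oact (jacobiA k) f).
Proof. by move=> [_ h1 h2]. Qed.

(** The norm of [g] bounds the sum of [mu_m^2 |(f, e_m)|^2], which yields a representative in
    [Vn 2], a subset of [Delta]. *)
Lemma Delta_surj f g : carrier L2 f -> carrier L2 g ->
  (forall i, ip L2 g (jbasis i) = (jeigen i)%:C * ip L2 f (jbasis i)) ->
  exists2 f', odom (jacobiA k) f' & hsame L2 f f'.
Proof.
move=> hf hg fg; have [|f' hf' ff'] := @Vn_representative 2 isT f (nsq L2 g) hf.
  move=> N; apply: (le_trans _ (bessel (@L2_hilbert R) jbasis_onb N hg)).
  by apply: ler_sum => i _; rewrite fg csqM csqR.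
by exists f' => //; apply: Vn_Delta hf'.
Qed.

Lemma jacobiA_graph_pow n f g : graph_pow L2 (jacobiA k) n f g <->
  [/\ carrier L2 f, carrier L2 g &
      forall i, ip L2 g (jbasis i) = (jeigen i ^+ n)%:C * ip L2 f (jbasis i)].
Proof.
apply: (diag_graph_pow (@L2_hilbert R) jbasis_onb k_gt0 jeigen_ge).
- exact: Delta_car.
- by move=> h hh i; exact: ell_coef.
- exact: Delta_surj.
Qed.

Lemma jacobiA_selfadjoint : selfadjoint L2 (jacobiA k).
Proof.
apply: (diag_selfadjoint (@L2_hilbert R) jbasis_onb (l := jeigen)).
- exact: Delta_subspace.
- exact: Delta_car.
- by move=> h hh i; exact: ell_coef.
- exact: Delta_surj.
- exact: jbasis_Delta.
Qed.

Lemma jacobiA_bounded_below : bounded_below L2 (jacobiA k) k.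
Proof.
apply: (diag_bounded_below (@L2_hilbert R) jbasis_onb jeigen_ge).
- exact: Delta_car.
- by move=> h hh i; exact: ell_coef.
Qed.

(** From some index on the eigenvalues exceed the real part of [c] by at least 1; for the finitely
    many others a minimum of positive numbers remains. *)
Lemma jeigen_sep (c : R[i]) : (forall i, (jeigen i)%:C != c) ->
  exists2 d : R, 0 < d & forall i, d <= csq ((jeigen i)%:C - c).
Proof.
move=> ne.
have pos i : 0 < csq ((jeigen i)%:C - c).
  rewrite lt_neqAle csq_ge0 andbT eq_sym; apply/eqP => /csq_eq0 /eqP.
  by rewrite subr_eq0 (negPf (ne i)).
have [N HN] : exists N : nat, complex.Re c + 1 <= N%:R.
  by exists (Num.truncn (complex.Re c + 1)).+1; rewrite ltW// truncnS_gt.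
have fin M : exists2 d : R, 0 < d & forall i, (i < M)%N -> d <= csq ((jeigen i)%:C - c).
  elim: M => [|M [d d0 dP]]; first by exists 1.
  exists (Num.min d (csq ((jeigen M)%:C - c))); first by rewrite lt_min d0 pos.
  move=> i; rewrite ltnS leq_eqVlt => /predU1P[->|/dP h]; first by rewrite ge_min lexx orbT.
  by rewrite ge_min h.
have [d d0 dP] := fin N; exists (Num.min d 1); first by rewrite lt_min d0 ltr01.
move=> i; rewrite ge_min; have [iN|Ni] := ltnP i N; first by rewrite dP.
apply/orP; right.
have h : 1 <= jeigen i - complex.Re c.
  have h1 : N%:R <= ((i.+2 * (i.+2 - 1))%N%:R : R) by rewrite ler_nat; nia.
  rewrite /jeigen /jacobi_eigenvalue; have := k_gt0; lra.
rewrite /csq; case: (c) h => p q /= h.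
by have := sqr_ge0 (0 - q); nra.
Qed.

Lemma jeigen_set : [set (jeigen i)%:C | i in [set: nat]] =
  [set (jacobi_eigenvalue k m)%:C | m in [set m : nat | (2 <= m)%N]].
Proof.
apply/seteqP; split=> [_ [i _ <-]|_ [[|[|m]] // _ <-]]; first by exists i.+2.
by exists m.
Qed.

Lemma jacobiA_spectrum : Defs.spectrum L2 (jacobiA k) =
  [set (jacobi_eigenvalue k m)%:C | m in [set m : nat | (2 <= m)%N]].
Proof.
rewrite -jeigen_set; apply: (diag_spectrum (@L2_hilbert R) jbasis_onb).
- exact: Delta_car.
- by move=> h hh i; exact: ell_coef.
- exact: Delta_surj.
- exact: jbasis_Delta.
- exact: jeigen_sep.
Qed.

(** * The left-definite operators *)

Section Operator.
Variables (n : nat) (n_gt0 : (0 < n)%N).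

(* [ell k f] agrees almost everywhere with a function of [Vn n], by its
   coefficients; both are continuous, so that they agree on (-1,1). *)
Lemma ell_Vn f : Vn n.+2 f -> Vn n (ell k f).
Proof.
move=> hf; have df : Delta k f by exact: Vn_Delta hf.
have [_ lf le] := df.
(* The coefficients of [ell k f] are [mu c], and [mu^n |mu c|^2 = mu^(n+2) |c|^2] is summable by
   Bessel's inequality in [Hn n.+2]. *)
have [|g hg eg] := @Vn_representative n n_gt0 (ell k f) (nsq (Hn n.+2 k) f) le.
  move=> N; apply: (le_trans _ (@Vn_bessel n.+2 isT f N hf)); apply: ler_sum => i _.
  by rewrite ell_coef// csqM csqR mulrA -exprD addn2.
have [h1 h2] := (VnP _ _).1 hg; have [[f1 _] [f2 _]] := (VnP _ _).1 hf.
have [le1 le2] := (L2wP _ _).1 le; have lg := Vn_L2w hg; have [lg1 lg2] := (L2wP _ _).1 lg.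
have hd : L2w (-1) (ell k f - g) by exact: (carrierB (@L2_hilbert R)).
have /(L2_nsq0 hd) [z1 z2] : nsq L2 (ell k f - g) = 0 by apply/(hsameP (@L2_hilbert R)).
(* Here [n >= 1] enters: as [2 < n.+2], the second derivative is itself locally absolutely
   continuous, hence continuous. *)
have cell u x : rACn n.+2 u -> I x -> {for x, continuous (rell k u)}.
  move=> [_ ac] Ix; apply: cvgD; apply: cvgM.
  - by apply: cvgN; apply: cvgB; [exact: cvg_cst|exact: exprn_continuous].
  - by apply: rAC_continuous Ix; apply: (ac 2%N).
  - exact: cvg_cst.
  - by apply: rAC_continuous Ix; apply: (ac 0%N).
have cg u x : rV n u -> I x -> {for x, continuous u}.
  by move=> [[_ ac] _] Ix; apply: rAC_continuous Ix; apply: (ac 0%N).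
have cl u v x : {for x, continuous u} -> {for x, continuous v} -> {for x, continuous (lcomb (-1) u v)}.
  by move=> cu cv; apply: cvgD cv; apply: cvgM cu; exact: cvg_cst.
rewrite repartB in z1; rewrite impartB in z2.
rewrite repart_ell in z1; rewrite impart_ell in z2.
have agree u v : rACn n.+2 u -> rV n v ->
    {ae mu, forall x, I x -> lcomb (-1) v (rell k u) x = 0} -> rV n (rell k u).
  move=> uac hv z; apply: (rV_I _ hv) => x Ix.
  have cx y : I y -> {for y, continuous (lcomb (-1) v (rell k u))}.
    by move=> Iy; apply: cl; [exact: cg|exact: cell].
  have := ae_continuous_eq0 cx z Ix.
  by rewrite /lcomb mulN1r addrC => /eqP; rewrite subr_eq0 => /eqP ->.
by apply/VnP; rewrite repart_ell impart_ell; split; [exact: agree z1|exact: agree z2].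
Qed.

Let hK := Hn_hilbert n_gt0 k_gt0.
Let bK := jscaled_onb n_gt0.

Lemma jscaled_coef f i : Vn n f ->
  ip (Hn n k) f (jscaled n i) = (lsqrt jeigen n i)%:C * ip L2 f (jbasis i).
Proof.
move=> hf; apply: (scaled_coef k_gt0 jeigen_ge hK) => //.
- exact: jbasis_Vn.
- by move=> g j; exact: ipn_jbasis.
Qed.

Lemma Bn_car f : odom (Bn n k) f -> carrier (Hn n k) f /\ carrier (Hn n k) (oact (Bn n k) f).
Proof.
move=> hf; split; last exact: ell_Vn.
by apply: (Vn_le _ hf); rewrite -addn2 leq_addr.
Qed.

Lemma Bn_coef f : odom (Bn n k) f -> forall i,
  ip (Hn n k) (oact (Bn n k) f) (jscaled n i) = (jeigen i)%:C * ip (Hn n k) f (jscaled n i).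
Proof.
move=> hf i; have [h1 h2] := Bn_car hf.
rewrite !jscaled_coef// ell_coef; last exact: (Vn_Delta _ hf).
by rewrite mulrCA.
Qed.

(** Bessel's inequality for [g] in [Hn n] controls the sum of [mu^(n+2) |c|^2], so [f] has a
    representative in [Vn n.+2]. Equality of classes is first obtained in [L2] and then lifted by
    [Vn_nsq0]. *)
Lemma Bn_surj f g : carrier (Hn n k) f -> carrier (Hn n k) g ->
  (forall i, ip (Hn n k) g (jscaled n i) = (jeigen i)%:C * ip (Hn n k) f (jscaled n i)) ->
  exists2 f', odom (Bn n k) f' & hsame (Hn n k) f f'.
Proof.
move=> hf hg fg.
have cfg i : ip L2 g (jbasis i) = (jeigen i)%:C * ip L2 f (jbasis i).
  have := fg i; rewrite !jscaled_coef// mulrCA => /mulfI; apply.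
  by apply/negP => /eqP[] /eqP; rewrite gt_eqF// (lsqrt_gt0 k_gt0 jeigen_ge).
have [|f' hf' ff'] := @Vn_representative n.+2 isT f (nsq (Hn n k) g) (Vn_L2w hf).
  move=> N; apply: (le_trans _ (Vn_bessel n_gt0 N hg)); apply: ler_sum => i _.
  by rewrite cfg csqM csqR mulrA -exprD addn2.
have hf'n : Vn n f' by apply: (Vn_le _ hf'); rewrite -addn2 leq_addr.
exists f'; first exact: hf'.
apply/(hsameP hK hf hf'n); apply: Vn_nsq0; [exact: n_gt0|exact: (carrierB hK)|].
exact: (hsameP (@L2_hilbert R) (Vn_L2w hf) (Vn_L2w hf'n)).1.
Qed.

Lemma jscaled_dom i : odom (Bn n k) (jscaled n i).
Proof. by apply: (carrierZ (Hn_hilbert _ k_gt0)) => //; exact: jbasis_Vn. Qed.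

Lemma Bn_selfadjoint : selfadjoint (Hn n k) (Bn n k).
Proof.
apply: (diag_selfadjoint hK bK (l := jeigen)).
- by have [] := @Hn_hilbert R n.+2 k isT k_gt0.
- exact: Bn_car.
- exact: Bn_coef.
- exact: Bn_surj.
- exact: jscaled_dom.
Qed.

Lemma Bn_spectrum : Defs.spectrum (Hn n k) (Bn n k) =
  [set (jacobi_eigenvalue k m)%:C | m in [set m : nat | (2 <= m)%N]].
Proof.
rewrite -jeigen_set; apply: (diag_spectrum hK bK).
- exact: Bn_car.
- exact: Bn_coef.
- exact: Bn_surj.
- exact: jscaled_dom.
- exact: jeigen_sep.
Qed.

Lemma Hn_left_definite : left_definite_space L2 (jacobiA k) k n (Hn n k).
Proof.
apply: (left_definite (@L2_hilbert R) jbasis_onb k_gt0 jeigen_ge hK) => //.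
- by move=> f; exact: Vn_L2w.
- exact: jbasis_Vn.
- by move=> f i; exact: ipn_jbasis.
- exact: Vn_nsq0.
- exact: jacobiA_selfadjoint.
- exact: jacobiA_bounded_below.
- exact: jacobiA_graph_pow.
Qed.

Lemma Hn_complete_orthogonal : complete_orthogonal (Hn n k) jbasis.
Proof.
apply: (basis_complete_orthogonal (@L2_hilbert R) jbasis_onb k_gt0 jeigen_ge hK) => //.
- by move=> f; exact: Vn_L2w.
- exact: jbasis_Vn.
- by move=> f i; exact: ipn_jbasis.
- exact: Vn_nsq0.
Qed.

Lemma Bn_left_definite : left_definite_operator L2 (jacobiA k) k n (Hn n k) (Bn n k).
Proof.
split; [exact: Hn_left_definite|exact: Bn_selfadjoint|move=> f hf].
have df : Delta k f by exact: (Vn_Delta _ hf).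
have [_ lf le] := df; exists f => //.
by split; exact: (hsame_refl (@L2_hilbert R)).
Qed.

Lemma ip_jacobiP_Hn m l : (2 <= m)%N -> (2 <= l)%N ->
  ip (Hn n k) (jacobiP m) (jacobiP l) = (jacobi_eigenvalue k m ^+ n * (m == l)%:R)%:C.
Proof.
move: m l => [|[|m]] // [|[|l]] // _ _; have [_ oe _] := jbasis_onb.
rewrite -[ip _ _ _]/(ip (Hn n k) (jbasis m) (jbasis l)) ipn_jbasis//; last exact: jbasis_Vn.
rewrite oe !eqSS; case: eqVneq => [->|_]; last by rewrite !mulr0.
by rewrite !mulr1.
Qed.

End Operator.

Lemma jacobiP_eigenfunction m : (2 <= m)%N ->
  eigenfunction k (jacobi_eigenvalue k m) (jacobiP m).
Proof.
move: m => [|[|m]] // _; have [he oe _] := jbasis_onb; split.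
- exact: jbasis_Delta.
- apply/negP => /eqP /(hnorm_eq0 (@L2_hilbert R) (he m)).
  by rewrite /nsq oe eqxx => /eqP; rewrite oner_eq0.
- rewrite [oact _ _]ell_jacobiP//.
  apply: (hsame_refl (@L2_hilbert R)); apply: (carrierZ (@L2_hilbert R)).
  exact: (he m).
Qed.

End JacobiOperator.

Theorem theorem6p3 (R : realType) (k : R) (k_gt0 : 0 < k) :
  [/\ selfadjoint L2 (jacobiA k),
      bounded_below L2 (jacobiA k) k &
      forall m : nat, (2 <= m)%N ->
        eigenfunction k (jacobi_eigenvalue k m) (jacobiP m)] /\
  forall n : nat, (1 <= n)%N ->
    [/\ left_definite_space L2 (jacobiA k) k n (Hn n k),
        complete_orthogonal (Hn n k) (fun i : nat => jacobiP i.+2),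
        forall m l : nat, (2 <= m)%N -> (2 <= l)%N ->
          ip (Hn n k) (jacobiP m) (jacobiP l) =
          (jacobi_eigenvalue k m ^+ n * (m == l)%:R)%:C,
        left_definite_operator L2 (jacobiA k) k n (Hn n k) (Bn n k) &
        spectrum (Hn n k) (Bn n k) =
          [set (jacobi_eigenvalue k m)%:C | m in [set m : nat | (2 <= m)%N]] /\
        spectrum L2 (jacobiA k) =
          [set (jacobi_eigenvalue k m)%:C | m in [set m : nat | (2 <= m)%N]]].
Proof.
split; first split.
- exact: jacobiA_selfadjoint.
- exact: jacobiA_bounded_below.
- by move=> m m2; exact: jacobiP_eigenfunction.
move=> n n1; split.
- exact: Hn_left_definite.
- exact: Hn_complete_orthogonal.
- by move=> m l; exact: ip_jacobiP_Hn.
- exact: Bn_left_definite.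
- by split; [exact: Bn_spectrum|exact: jacobiA_spectrum].
Qed.
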